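(* Let $\mu,\nu\in\mathbb{C}$, let $N\ge 0$ be an integer, and define the remainder $R_N(z,\mu,\nu)$ by $$S_{\mu,\nu}(z)=z^{\mu-1}\sum_{n=0}^{N-1}(-1)^n\frac{a_n(-\mu,\nu)}{z^{2n}}+R_N(z,\mu,\nu).$$ If $|\arg z|<\frac{\pi}{2}$ and $\Re(\mu)+|\Re(\nu)|<2N+1$, then $$R_N(z,\mu,\nu)=(-1)^N\frac{2^{\mu+1}z^{\mu-2N-1}}{\Gamma\left(\frac{\nu-\mu+1}{2}\right)\Gamma\left(\frac{1-\mu-\nu}{2}\right)}\int_0^{+\infty}\frac{t^{2N-\mu}K_\nu(t)}{1+(t/z)^2}\,dt .$$
   Context: $S_{\mu,\nu}$ is the Lommel function: $S_{\mu,\nu}(z)=s_{\mu,\nu}(z)+2^{\mu-1}\Gamma\left(\frac{\mu-\nu+1}{2}\right)\Gamma\left(\frac{\mu+\nu+1}{2}\right)\left(\sin\left(\frac{(\mu-\nu)\pi}{2}\right)J_\nu(z)-\cos\left(\frac{(\mu-\nu)\pi}{2}\right)Y_\nu(z)\right)$, where $s_{\mu,\nu}(z)=\frac{z^{\mu+1}}{(\mu+1)^2-\nu^2}\,{}_1F_2\left(1;\frac{\mu-\nu+3}{2},\frac{\mu+\nu+3}{2};-\frac{z^2}{4}\right)$ (limiting values understood at exceptional parameters). $J_\nu,Y_\nu$ are Bessel functions, $K_\nu$ the modified Bessel function of the second kind. The coefficients are $a_n(\mu,\nu)=\prod_{k=1}^n\left((\mu+2k-1)^2-\nu^2\right)=2^{2n}\left(\frac{\mu-\nu+1}{2}\right)_n\left(\frac{\mu+\nu+1}{2}\right)_n$,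 with $(x)_n=\Gamma(x+n)/\Gamma(x)$. Empty sums are zero. Principal branches of powers are used. *)

(* Defs.v *)
From Stdlib Require Import Reals ZArith ClassicalEpsilon.
From Coquelicot Require Import Coquelicot.
Open Scope R_scope.

(** ** Generic complex limits (value chosen by choice; unique when F is proper). *)
Definition Clim {T : Type} (F : (T -> Prop) -> Prop) (f : T -> C) : C :=
  epsilon (inhabits (RtoC 0)) (fun l : C => filterlim f F (locally l)).

Fixpoint psum (a : nat -> C) (N : nat) : C :=
  match N with O => RtoC 0 | S n => Cplus (psum a n) (a n) end.

Definition Cseries (a : nat -> C) : C := Clim eventually (psum a).

Fixpoint Cpown (z : C) (n : nat) : C :=
  match n with O => RtoC 1 | S n => Cmult (Cpown z n) z end.

Definition cexp (z : C) : C :=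
  Cmult (RtoC (exp (Re z))) (cos (Im z), sin (Im z)).
Definition Ci : C := (0, 1).
Definition ccos (z : C) : C :=
  Cdiv (Cplus (cexp (Cmult Ci z)) (cexp (Copp (Cmult Ci z)))) (RtoC 2).
Definition csin (z : C) : C :=
  Cdiv (Cminus (cexp (Cmult Ci z)) (cexp (Copp (Cmult Ci z)))) (Cmult (RtoC 2) Ci).

(** Principal argument in (-pi, pi] (with the convention arg 0 = 0). *)
Definition Carg (z : C) : R :=
  let x := Re z in let y := Im z in
  if Rlt_dec 0 x then atan (y / x)
  else if Rlt_dec x 0 then
    (if Rle_dec 0 y then atan (y / x) + PI else atan (y / x) - PI)
  else (if Rlt_dec 0 y then PI / 2 else if Rlt_dec y 0 then - (PI / 2) else 0).

Definition clog (z : C) : C := (ln (Cmod z), Carg z).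
Definition cpow (z w : C) : C :=
  if Ceq_dec z (RtoC 0) then RtoC 0 else cexp (Cmult w (clog z)).

Fixpoint poch (x : C) (n : nat) : C :=
  match n with O => RtoC 1 | S k => Cmult (poch x k) (Cplus x (RtoC (INR k))) end.

(** Reciprocal Gamma function (entire), via the Euler/Gauss limit
    1/Gamma(z) = lim_n z(z+1)...(z+n) / (n! n^z). *)
Definition rgamma (z : C) : C :=
  Clim eventually (fun n : nat =>
    Cdiv (poch z (S n)) (Cmult (RtoC (INR (fact n))) (cpow (RtoC (INR n)) z))).
Definition Cgamma (z : C) : C := Cinv (rgamma z).

Definition BesselJ (nu z : C) : C :=
  Cmult (cpow (Cdiv z (RtoC 2)) nu)
    (Cseries (fun k => Cmult (RtoC ((-1) ^ k / INR (fact k)))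
       (Cmult (rgamma (Cplus (RtoC (INR k + 1)) nu)) (Cpown (Cdiv z (RtoC 2)) (2 * k))))).

Definition BesselI (nu z : C) : C :=
  Cmult (cpow (Cdiv z (RtoC 2)) nu)
    (Cseries (fun k => Cmult (RtoC (/ INR (fact k)))
       (Cmult (rgamma (Cplus (RtoC (INR k + 1)) nu)) (Cpown (Cdiv z (RtoC 2)) (2 * k))))).

Definition Cint (w : C) : Prop := exists m : Z, w = RtoC (IZR m).
Definition Codd (w : C) : Prop := exists m : Z, w = RtoC (IZR (2 * m + 1)).

Definition BesselY_gen (nu z : C) : C :=
  Cdiv (Cminus (Cmult (BesselJ nu z) (ccos (Cmult nu (RtoC PI)))) (BesselJ (Copp nu) z))
       (csin (Cmult nu (RtoC PI))).

Definition BesselK_gen (nu z : C) : C :=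
  Cdiv (Cmult (RtoC (PI / 2)) (Cminus (BesselI (Copp nu) z) (BesselI nu z)))
       (csin (Cmult nu (RtoC PI))).
Definition BesselK (nu z : C) : C :=
  Clim (within (fun nu' : C => ~ Cint nu') (locally nu)) (fun nu' => BesselK_gen nu' z).

Definition hyp1F2_1 (a b x : C) : C :=
  Cseries (fun k => Cdiv (Cpown x k) (Cmult (poch a k) (poch b k))).

Definition lommel_s (mu nu z : C) : C :=
  Cmult (Cdiv (cpow z (Cplus mu (RtoC 1)))
              (Cminus (Cpown (Cplus mu (RtoC 1)) 2) (Cpown nu 2)))
        (hyp1F2_1 (Cdiv (Cplus (Cminus mu nu) (RtoC 3)) (RtoC 2))
                  (Cdiv (Cplus (Cplus mu nu) (RtoC 3)) (RtoC 2))
                  (Copp (Cdiv (Cpown z 2) (RtoC 4)))).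

Definition lommel_generic (p : C * C) : Prop :=
  ~ Cint (snd p) /\ ~ Codd (Cplus (fst p) (snd p)) /\ ~ Codd (Cminus (fst p) (snd p)).

Definition lommel_S_gen (mu nu z : C) : C :=
  Cplus (lommel_s mu nu z)
   (Cmult (Cmult (cpow (RtoC 2) (Cminus mu (RtoC 1)))
            (Cmult (Cgamma (Cdiv (Cplus (Cminus mu nu) (RtoC 1)) (RtoC 2)))
                   (Cgamma (Cdiv (Cplus (Cplus mu nu) (RtoC 1)) (RtoC 2)))))
      (Cminus (Cmult (csin (Cdiv (Cmult (Cminus mu nu) (RtoC PI)) (RtoC 2))) (BesselJ nu z))
              (Cmult (ccos (Cdiv (Cmult (Cminus mu nu) (RtoC PI)) (RtoC 2))) (BesselY_gen nu z)))).

Definition lommel_S (mu nu z : C) : C :=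
  Clim (within lommel_generic (locally ((mu, nu) : C * C)))
       (fun p : C * C => lommel_S_gen (fst p) (snd p) z).

Fixpoint lommel_a (n : nat) (mu nu : C) : C :=
  match n with
  | O => RtoC 1
  | S k => Cmult (lommel_a k mu nu)
             (Cminus (Cpown (Cplus mu (RtoC (2 * INR (S k) - 1))) 2) (Cpown nu 2))
  end.

Definition lommel_R (N : nat) (z mu nu : C) : C :=
  Cminus (lommel_S mu nu z)
    (Cmult (cpow z (Cminus mu (RtoC 1)))
       (psum (fun n => Cdiv (Cmult (RtoC ((-1) ^ n)) (lommel_a n (Copp mu) nu))
                            (Cpown z (2 * n))) N)).

(* Main.v *)
(** Put [alpha = (1 - mu + nu)/2], [beta = (1 - mu - nu)/2], [zeta = z^2/4]. The substitution
    [t = 2 e^(x/2)] and [K_nu t = (t/2)^(-nu)/2 * int exp(- e^(x-u) - e^u + nu u) du] turn the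
    integral with [N = 0] into a multiple of
      [X(alpha, beta) = int e^(beta x) / (zeta + e^x) (int exp(- e^(x-u) - e^u + nu u) du) dx].
    Replacing [e^(-w)] by a remainder of its Taylor series moves such integrals from one strip of
    exponents to the next at the price of explicit Gamma values. Iterating this expands [K_nu],
    and then [X], into the entire functions [Om(a, b, w) = sum_k w^k / (Gamma(a+k) Gamma(b+k))], and
    the expansion of [X] is the definition of [S_(mu,nu)] up to an elementary factor. The equation
    [Om(a, b, w) = 1/(Gamma a Gamma b) + w Om(a+1, b+1, w)], used [N] times, splits off the first
    [N] asymptotic terms and moves [(alpha, beta)] to [(alpha + N, beta + N)]. All this needs
    generic parameters; both sides being continuous, the exceptional ones follow in the limit. *)

Require Import Defs.
From Stdlib Require Import Reals ZArith Lra Lia ClassicalEpsilon Classical FunctionalExtensionality.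
From Coquelicot Require Import Coquelicot.
Open Scope R_scope.

(** Classically, moving to the next strip is a contour shift in a Mellin-Barnes integral. No contour
    occurs here: subtracting one more Taylor term of [exp (- w)] makes the integral converge in the
    next strip, and the subtracted term is itself a Gamma integral, which plays the part of the
    residue. The remainders vanish in the limit because their bounds carry inverse factorials, so
    the resulting series are exact. The identity [e^x / (zeta + e^x) = 1 - zeta / (zeta + e^x)] is
    what carries the expansion of the inner integral into the outer one, each power leaving an
    integral in closed form. Putting every integral on the whole line reduces convergence,
    continuity in parameters, differentiation under the integral and exchange of integrations to a
    single decay condition, [dom]. Since [rgamma], [BesselK] and [lommel_S] are chosen limits,
    convergence must be proved before any of them has a known value: hence the moment argument for
    the Euler limit, and the care taken to approach exceptional parameters through generic ones. *)

Lemma Cmod_le_abs (x y : R) : Cmod (x, y) <= Rabs x + Rabs y.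
Proof.
  replace (x, y) with (RtoC x + Ci * RtoC y)%C
    by (unfold Ci, RtoC, Cplus, Cmult; simpl; f_equal; ring).
  eapply Rle_trans; [apply Cmod_triangle|].
  rewrite Cmod_mult, !Cmod_R, Cmod_Ci. lra.
Qed.

Lemma im_le_Cmod (c : C) : Rabs (Im c) <= Cmod c.
Proof.
  eapply Rle_trans; [apply Rmax_r | apply (Rmax_Cmod c)].
Qed.

(** * Limits of complex-valued functions along a filter *)

Section FilterLimits.
Context {T : Type} {F : (T -> Prop) -> Prop} {FF : Filter F}.

(** The uniform structure of [C] is that of the product, whose balls are squares; passing to the
    modulus costs a factor 2, absorbed by [pos_div_2]. *)
Lemma filterlim_Cmod (f : T -> C) (l : C) :
  filterlim f F (locally l) <->
  (forall eps : posreal, F (fun x => Cmod (f x - l)%C < eps)).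
Proof.
  rewrite (filterlim_locally (U := C_UniformSpace) f l). split; intros H eps.
  - specialize (H (pos_div_2 eps)). revert H. apply filter_imp. intros x [H1 H2].
    unfold ball in H1, H2; simpl in H1, H2; unfold AbsRing_ball, abs, minus, plus, opp in H1, H2; simpl in H1, H2.
    eapply Rle_lt_trans; [apply (Cmod_le_abs (fst (f x) - fst l) (snd (f x) - snd l))|].
    unfold Rminus. lra.
  - specialize (H eps). revert H. apply filter_imp. intros x H.
    split; unfold ball; simpl; unfold AbsRing_ball, abs, minus, plus, opp; simpl;
      eapply Rle_lt_trans; try exact H.
    + apply (re_le_Cmod (f x - l)%C).
    + apply (im_le_Cmod (f x - l)%C).
Qed.

Lemma flim_squeeze (f : T -> C) (l : C) (g : T -> R) :
  F (fun x => Cmod (f x - l)%C <= g x) -> filterlim g F (locally 0) ->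
  filterlim f F (locally l).
Proof.
  intros H Hg. apply filterlim_Cmod. intros eps.
  assert (H2 := proj1 (filterlim_locally g 0) Hg eps).
  generalize (filter_and _ _ H H2). apply filter_imp. intros x [A B].
  unfold ball in B; simpl in B; unfold AbsRing_ball, abs, minus, plus, opp in B; simpl in B.
  apply Rabs_def2 in B. lra.
Qed.

Lemma flim_C_pair (u v : T -> R) (a b : R) :
  filterlim u F (locally a) -> filterlim v F (locally b) ->
  filterlim (fun x => (u x, v x) : C) F (locally ((a, b) : C)).
Proof.
  intros Hu Hv. apply (filterlim_locally (U := C_UniformSpace)). intros eps.
  generalize (filter_and _ _ (proj1 (filterlim_locally _ _) Hu eps)
                (proj1 (filterlim_locally _ _) Hv eps)).
  apply filter_imp. intros x [A B]. split; assumption.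
Qed.

Lemma flim_Re (f : T -> C) (l : C) :
  filterlim f F (locally l) -> filterlim (fun x => Re (f x)) F (locally (Re l)).
Proof.
  intros H. apply filterlim_locally. intros eps.
  generalize (proj1 (filterlim_locally (U := C_UniformSpace) _ _) H eps).
  apply filter_imp. intros x [A B]. exact A.
Qed.

Lemma flim_Im (f : T -> C) (l : C) :
  filterlim f F (locally l) -> filterlim (fun x => Im (f x)) F (locally (Im l)).
Proof.
  intros H. apply filterlim_locally. intros eps.
  generalize (proj1 (filterlim_locally (U := C_UniformSpace) _ _) H eps).
  apply filter_imp. intros x [A B]. exact B.
Qed.

Lemma flim_Cplus (f g : T -> C) (a b : C) :
  filterlim f F (locally a) -> filterlim g F (locally b) ->
  filterlim (fun x => f x + g x)%C F (locally (a + b)%C).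
Proof.
  intros Hf Hg. apply filterlim_Cmod. intros eps.
  generalize (filter_and _ _ (proj1 (filterlim_Cmod _ _) Hf (pos_div_2 eps))
                (proj1 (filterlim_Cmod _ _) Hg (pos_div_2 eps))).
  apply filter_imp. intros x [A B]. simpl in A, B.
  replace (f x + g x - (a + b))%C with ((f x - a) + (g x - b))%C by ring.
  eapply Rle_lt_trans; [apply Cmod_triangle|]. lra.
Qed.

Lemma flim_Copp (f : T -> C) (a : C) :
  filterlim f F (locally a) -> filterlim (fun x => - f x)%C F (locally (- a)%C).
Proof.
  intros Hf. apply filterlim_Cmod. intros eps.
  generalize (proj1 (filterlim_Cmod _ _) Hf eps).
  apply filter_imp. intros x A.
  replace (- f x - - a)%C with (- (f x - a))%C by ring. now rewrite Cmod_opp.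
Qed.

Lemma flim_Cminus (f g : T -> C) (a b : C) :
  filterlim f F (locally a) -> filterlim g F (locally b) ->
  filterlim (fun x => f x - g x)%C F (locally (a - b)%C).
Proof. intros Hf Hg. apply flim_Cplus; [exact Hf | now apply flim_Copp]. Qed.

Lemma flim_Cmult (f g : T -> C) (a b : C) :
  filterlim f F (locally a) -> filterlim g F (locally b) ->
  filterlim (fun x => f x * g x)%C F (locally (a * b)%C).
Proof.
  intros Hf Hg. apply filterlim_Cmod. intros eps.
  assert (HM : 0 < Cmod a + Cmod b + 1) by (pose proof (Cmod_ge_0 a); pose proof (Cmod_ge_0 b); lra).
  (* With [e] this minimum, the three terms of the expansion of [f x * g x - a * b] used below add
     up to at most [e * (1 + Cmod a + Cmod b)]; the entry 1 turns [e * e] into [e]. *)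
  assert (He : 0 < Rmin 1 (eps / (Cmod a + Cmod b + 1) / 2)).
  { apply Rmin_pos; [lra|]. pose proof (cond_pos eps).
    apply Rdiv_lt_0_compat; [|lra]. apply Rdiv_lt_0_compat; lra. }
  generalize (filter_and _ _ (proj1 (filterlim_Cmod _ _) Hf (mkposreal _ He))
                (proj1 (filterlim_Cmod _ _) Hg (mkposreal _ He))).
  apply filter_imp. intros x [A B]. simpl in A, B.
  set (e := Rmin 1 (eps / (Cmod a + Cmod b + 1) / 2)) in *.
  assert (E1 : e <= 1) by apply Rmin_l.
  assert (E2 : e <= eps / (Cmod a + Cmod b + 1) / 2) by apply Rmin_r.
  assert (E3 : e * (Cmod a + Cmod b + 1) <= eps / 2).
  { apply Rmult_le_compat_r with (r := Cmod a + Cmod b + 1) in E2; [|lra].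
    replace (eps / (Cmod a + Cmod b + 1) / 2 * (Cmod a + Cmod b + 1)) with (eps / 2) in E2 by (field; lra). lra. }
  replace (f x * g x - a * b)%C with ((f x - a) * (g x - b) + (f x - a) * b + a * (g x - b))%C by ring.
  eapply Rle_lt_trans; [apply Cmod_triangle|].
  eapply Rle_lt_trans; [apply Rplus_le_compat_r, Cmod_triangle|].
  rewrite !Cmod_mult.
  pose proof (Cmod_ge_0 a). pose proof (Cmod_ge_0 b).
  pose proof (Cmod_ge_0 (f x - a)%C). pose proof (Cmod_ge_0 (g x - b)%C).
  pose proof (cond_pos eps).
  assert (Cmod (f x - a)%C * Cmod (g x - b)%C <= e * 1) by (apply Rmult_le_compat; lra).
  assert (Cmod (f x - a)%C * Cmod b <= e * Cmod b) by (apply Rmult_le_compat_r; lra).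
  assert (Cmod a * Cmod (g x - b)%C <= Cmod a * e) by (apply Rmult_le_compat_l; lra).
  nra.
Qed.

Lemma flim_Cinv (f : T -> C) (a : C) :
  a <> RtoC 0 -> filterlim f F (locally a) -> filterlim (fun x => / f x)%C F (locally (/ a)%C).
Proof.
  intros Ha Hf. apply filterlim_Cmod. intros eps.
  assert (HM := proj1 (Cmod_gt_0 a) Ha). pose proof (cond_pos eps).
  (* The first entry keeps [Cmod (f x)] above [Cmod a / 2]; the second pays for the denominator
     [f x * a] of the difference of inverses. *)
  assert (He : 0 < Rmin (Cmod a / 2) (eps * (Cmod a * Cmod a) / 2)).
  { apply Rmin_pos; [lra|]. assert (0 < Cmod a * Cmod a) by nra. nra. }
  generalize (proj1 (filterlim_Cmod _ _) Hf (mkposreal _ He)).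
  apply filter_imp. intros x A. simpl in A.
  set (e := Rmin (Cmod a / 2) (eps * (Cmod a * Cmod a) / 2)) in *.
  assert (E1 : e <= Cmod a / 2) by apply Rmin_l.
  assert (E2 : e <= eps * (Cmod a * Cmod a) / 2) by apply Rmin_r.
  assert (L : Cmod a / 2 < Cmod (f x)).
  { assert (Cmod a <= Cmod (f x) + Cmod (f x - a)%C); [|lra].
    replace a with (f x + - (f x - a))%C at 1 by ring.
    eapply Rle_trans; [apply Cmod_triangle|]. rewrite Cmod_opp. lra. }
  assert (Hfx : f x <> RtoC 0) by (apply Cmod_gt_0; lra).
  replace (/ f x - / a)%C with (- (f x - a) * / (f x * a))%C by (field; split; auto).
  rewrite Cmod_mult, Cmod_opp, Cmod_inv, Cmod_mult by (apply Cmult_neq_0; auto).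
  apply Rmult_lt_reg_r with (Cmod (f x) * Cmod a); [nra|].
  rewrite Rmult_assoc, Rinv_l by nra. nra.
Qed.

Lemma flim_Cdiv (f g : T -> C) (a b : C) :
  b <> RtoC 0 -> filterlim f F (locally a) -> filterlim g F (locally b) ->
  filterlim (fun x => f x / g x)%C F (locally (a / b)%C).
Proof. intros Hb Hf Hg. apply flim_Cmult; [exact Hf | now apply flim_Cinv]. Qed.

Lemma flim_RtoC (f : T -> R) (a : R) :
  filterlim f F (locally a) -> filterlim (fun x => RtoC (f x)) F (locally (RtoC a)).
Proof. intros H. apply flim_C_pair; [exact H | apply filterlim_const]. Qed.

Lemma flim_cexp (f : T -> C) (a : C) :
  filterlim f F (locally a) -> filterlim (fun x => cexp (f x)) F (locally (cexp a)).
Proof.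
  intros H. unfold cexp. apply flim_Cmult.
  - apply flim_RtoC. eapply filterlim_comp; [apply flim_Re, H|]. apply (continuous_exp (Re a)).
  - apply flim_C_pair; (eapply filterlim_comp; [apply flim_Im, H|]);
    [apply (continuous_cos (Im a)) | apply (continuous_sin (Im a))].
Qed.

Lemma flim_unique {PF : ProperFilter' F} (f : T -> C) (a b : C) :
  filterlim f F (locally a) -> filterlim f F (locally b) -> a = b.
Proof. apply (filterlim_locally_unique (V := C_R_NormedModule)). Qed.

(** [epsilon] returns some limit as soon as one exists, and a proper filter admits only one. Proving
    convergence is thus the way to compute any [Clim]. *)
Lemma Clim_eq {PF : ProperFilter' F} (f : T -> C) (l : C) :
  filterlim f F (locally l) -> Clim F f = l.
Proof.
  intros H. apply (flim_unique (PF := PF) f); [|exact H].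
  unfold Clim. apply (epsilon_spec (inhabits (RtoC 0)) (fun l => filterlim f F (locally l))).
  now exists l.
Qed.

Lemma flim_psum (f : nat -> T -> C) (a : nat -> C) (N : nat) :
  (forall k, filterlim (f k) F (locally (a k))) ->
  filterlim (fun x => psum (fun k => f k x) N) F (locally (psum a N)).
Proof.
  intros H. induction N as [|N IH]; simpl.
  - apply filterlim_const.
  - now apply flim_Cplus.
Qed.

Lemma flim_poch (f : T -> C) (a : C) (n : nat) :
  filterlim f F (locally a) -> filterlim (fun x => poch (f x) n) F (locally (poch a n)).
Proof.
  intros H. induction n as [|n IH]; simpl; [apply filterlim_const|].
  apply flim_Cmult; [exact IH|]. apply flim_Cplus; [exact H | apply filterlim_const].
Qed.

End FilterLimits.

(** * The complex exponential and natural powers *)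

Lemma cexp_add (a b : C) : cexp (a + b)%C = (cexp a * cexp b)%C.
Proof.
  destruct a as [a a'], b as [b b']. unfold cexp, Cplus, Cmult, RtoC; simpl.
  rewrite exp_plus, cos_plus, sin_plus. f_equal; ring.
Qed.

Lemma cexp_0 : cexp (RtoC 0) = RtoC 1.
Proof. unfold cexp; simpl. rewrite exp_0, cos_0, sin_0. unfold Cmult, RtoC; simpl. f_equal; ring. Qed.

Lemma cexp_opp_mult (a : C) : (cexp (- a) * cexp a)%C = RtoC 1.
Proof. rewrite <- cexp_add. replace (- a + a)%C with (RtoC 0) by ring. apply cexp_0. Qed.

Lemma Cmod_cexp (a : C) : Cmod (cexp a) = exp (Re a).
Proof.
  unfold cexp. rewrite Cmod_mult, Cmod_R, Rabs_pos_eq by (left; apply exp_pos).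
  unfold Cmod at 1; simpl.
  replace (cos (Im a) * (cos (Im a) * 1) + sin (Im a) * (sin (Im a) * 1)) with 1
    by (pose proof (sin2_cos2 (Im a)); unfold Rsqr in *; lra).
  rewrite sqrt_1; ring.
Qed.

Lemma cexp_neq_0 (a : C) : cexp a <> RtoC 0.
Proof. apply Cmod_gt_0. rewrite Cmod_cexp. apply exp_pos. Qed.

Lemma Cmult_reg_r (a b c : C) : c <> RtoC 0 -> (a * c = b * c)%C -> a = b.
Proof.
  intros Hc H. replace a with (a * c / c)%C by (field; exact Hc). rewrite H. now field.
Qed.

Lemma cexp_opp (a : C) : cexp (- a)%C = (/ cexp a)%C.
Proof.
  apply Cmult_reg_r with (cexp a); [apply cexp_neq_0|].
  rewrite cexp_opp_mult, Cinv_l; auto using cexp_neq_0.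
Qed.

Lemma cexp_R (x : R) : cexp (RtoC x) = RtoC (exp x).
Proof. unfold cexp; simpl. rewrite cos_0, sin_0. unfold Cmult, RtoC; simpl. f_equal; ring. Qed.

Lemma cexp_nat (n : nat) (a : C) : cexp (RtoC (INR n) * a)%C = Cpown (cexp a) n.
Proof.
  induction n as [|n IH]; simpl Cpown.
  - simpl. rewrite Cmult_0_l. apply cexp_0.
  - rewrite S_INR, RtoC_plus, <- IH, <- cexp_add. f_equal. ring.
Qed.

Lemma Cpown_Cmod (a : C) (n : nat) : Cmod (Cpown a n) = Cmod a ^ n.
Proof. induction n; simpl; [apply Cmod_1|]. rewrite Cmod_mult, IHn. ring. Qed.

Lemma Cpown_neq_0 (a : C) (n : nat) : a <> RtoC 0 -> Cpown a n <> RtoC 0.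
Proof. intros H; induction n; simpl; [apply C1_nz | now apply Cmult_neq_0]. Qed.

Lemma Cpown_mult (a b : C) (n : nat) : Cpown (a * b)%C n = (Cpown a n * Cpown b n)%C.
Proof. induction n; simpl; [ring | rewrite IHn; ring]. Qed.

Lemma Cpown_R (x : R) (n : nat) : Cpown (RtoC x) n = RtoC (x ^ n).
Proof. induction n; simpl; [reflexivity|]. rewrite IHn, <- RtoC_mult. f_equal. ring. Qed.

Lemma Cpown_mul_exp (a : C) (m n : nat) : Cpown a (m * n) = Cpown (Cpown a m) n.
Proof.
  assert (Hadd : forall p q, Cpown a (p + q) = (Cpown a p * Cpown a q)%C).
  { intros p q. induction q; simpl; [rewrite Nat.add_0_r; ring|].
    rewrite Nat.add_succ_r; simpl. rewrite IHq. ring. }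
  induction n; simpl; [now rewrite Nat.mul_0_r|].
  rewrite Nat.mul_succ_r, Hadd, IHn. reflexivity.
Qed.

(** * Integrals of complex-valued functions over bounded intervals *)

Notation CInt := (@RInt C_R_CompleteNormedModule).
Notation is_CInt := (@is_RInt C_R_NormedModule).
Notation is_Cderive := (@is_derive R_AbsRing C_R_NormedModule).
Notation Ccont := (@continuous R_UniformSpace C_UniformSpace).

Lemma ex_CInt (f : R -> C) (a b : R) :
  (forall x, Ccont f x) -> @ex_RInt C_R_NormedModule f a b.
Proof. intros H. apply (ex_RInt_continuous (V := C_R_CompleteNormedModule)). intros; apply H. Qed.

Lemma CInt_correct (f : R -> C) (a b : R) :
  (forall x, Ccont f x) -> is_CInt f a b (CInt f a b).
Proof. intros H. apply (RInt_correct (V := C_R_CompleteNormedModule)). now apply ex_CInt. Qed.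

Lemma CInt_eq (f : R -> C) (a b : R) (l : C) : is_CInt f a b l -> CInt f a b = l.
Proof. apply (is_RInt_unique (V := C_R_CompleteNormedModule)). Qed.

(** [C_R_NormedModule] has real scalars only, so a complex factor is handled through real and
    imaginary parts. *)
Lemma is_CInt_Cmult (f : R -> C) (a b : R) (c l : C) :
  is_CInt f a b l -> is_CInt (fun x => c * f x)%C a b (c * l)%C.
Proof.
  intros H. destruct c as [c1 c2].
  assert (H1 := is_RInt_fct_extend_fst (U := R_NormedModule) (V := R_NormedModule) _ _ _ _ H).
  assert (H2 := is_RInt_fct_extend_snd (U := R_NormedModule) (V := R_NormedModule) _ _ _ _ H).
  apply (is_RInt_fct_extend_pair (U := R_NormedModule) (V := R_NormedModule)).
  - apply (is_RInt_minus (V := R_NormedModule)); now apply (is_RInt_scal (V := R_NormedModule)).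
  - apply (is_RInt_plus (V := R_NormedModule)); now apply (is_RInt_scal (V := R_NormedModule)).
Qed.

Lemma is_CInt_plus (f g : R -> C) (a b : R) (l m : C) :
  is_CInt f a b l -> is_CInt g a b m -> is_CInt (fun x => f x + g x)%C a b (l + m)%C.
Proof. apply (is_RInt_plus (V := C_R_NormedModule)). Qed.

Lemma CInt_norm_le (f : R -> C) (g : R -> R) (a b lg : R) :
  a <= b -> (forall x, Ccont f x) -> (forall x, a <= x <= b -> Cmod (f x) <= g x) ->
  is_RInt g a b lg -> Cmod (CInt f a b) <= lg.
Proof.
  intros Hab Hc Hb Hg. rewrite Cmod_norm.
  apply (norm_RInt_le (V := C_R_NormedModule) f g a b); auto.
  - intros x Hx. specialize (Hb x Hx). rewrite Cmod_norm in Hb. exact Hb.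
  - now apply CInt_correct.
Qed.

Lemma CInt_Chasles (f : R -> C) (a b c : R) :
  (forall x, Ccont f x) -> (CInt f a b + CInt f b c)%C = CInt f a c.
Proof.
  intros H. apply (RInt_Chasles (V := C_R_CompleteNormedModule)); now apply ex_CInt.
Qed.

Lemma CInt_swap (f : R -> C) (a b : R) :
  (forall x, Ccont f x) -> CInt f b a = (- CInt f a b)%C.
Proof.
  intros H. symmetry. apply (opp_RInt_swap (V := C_R_CompleteNormedModule)). now apply ex_CInt.
Qed.

Lemma continuous_Cmult {U : UniformSpace} (f g : U -> C) (x : U) :
  @continuous U C_UniformSpace f x -> @continuous U C_UniformSpace g x ->
  @continuous U C_UniformSpace (fun y => f y * g y)%C x.
Proof. apply flim_Cmult. Qed.

Lemma continuous_Cplus {U : UniformSpace} (f g : U -> C) (x : U) :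
  @continuous U C_UniformSpace f x -> @continuous U C_UniformSpace g x ->
  @continuous U C_UniformSpace (fun y => f y + g y)%C x.
Proof. apply flim_Cplus. Qed.

Lemma continuous_Cminus {U : UniformSpace} (f g : U -> C) (x : U) :
  @continuous U C_UniformSpace f x -> @continuous U C_UniformSpace g x ->
  @continuous U C_UniformSpace (fun y => f y - g y)%C x.
Proof. apply flim_Cminus. Qed.

Lemma continuous_Cinv {U : UniformSpace} (f : U -> C) (x : U) :
  f x <> RtoC 0 -> @continuous U C_UniformSpace f x ->
  @continuous U C_UniformSpace (fun y => / f y)%C x.
Proof. apply flim_Cinv. Qed.

Lemma continuous_RtoC {U : UniformSpace} (f : U -> R) (x : U) :
  @continuous U R_UniformSpace f x -> @continuous U C_UniformSpace (fun y => RtoC (f y)) x.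
Proof. apply flim_RtoC. Qed.

Lemma continuous_cexp {U : UniformSpace} (f : U -> C) (x : U) :
  @continuous U C_UniformSpace f x -> @continuous U C_UniformSpace (fun y => cexp (f y)) x.
Proof. apply flim_cexp. Qed.

(** ** Improper integrals of exponentially decaying functions *)

(** After [s = exp u], power behaviour at 0 and at infinity becomes exponential decay at both ends
    of the line, so this one condition fits every improper integrand below. The constants are
    explicit so that they can be shared by a family of integrands. *)
Definition dom (K d : R) (f : R -> C) : Prop :=
  0 < d /\ (forall x, Ccont f x) /\ (forall x, Cmod (f x) <= K * exp (- d * Rabs x)).

(** The symmetric limit loses nothing: [LInt_flim_gen] lets the two ends move independently under
    [dom]. *)
Definition LInt (f : R -> C) : C := Clim (Rbar_locally p_infty) (fun T => CInt f (- T) T).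

Lemma dom_K_pos (K d : R) (f : R -> C) : dom K d f -> 0 <= K.
Proof.
  intros (_ & _ & H). specialize (H 0). pose proof (Cmod_ge_0 (f 0)).
  rewrite Rabs_R0, Rmult_0_r, exp_0 in H. lra.
Qed.

Lemma is_RInt_exp_decay (K d a b : R) :
  d <> 0 -> is_RInt (fun x => K * exp (- d * x)) a b (K / d * (exp (- d * a) - exp (- d * b))).
Proof.
  intros Hd.
  replace (K / d * (exp (- d * a) - exp (- d * b)))
    with (minus ((fun x => - (K / d) * exp (- d * x)) b) ((fun x => - (K / d) * exp (- d * x)) a))
    by (unfold minus, plus, opp; simpl; ring).
  apply (is_RInt_derive (V := R_CompleteNormedModule) (fun x => - (K / d) * exp (- d * x)) (fun x => K * exp (- d * x))).
  - intros x _. auto_derive; [exact I | field; exact Hd].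
  - intros x _. apply (continuous_scal_r (V := R_NormedModule)). apply (continuous_comp (fun x => - d * x) exp).
    + apply (continuous_scal_r (V := R_NormedModule)). apply continuous_id.
    + apply continuous_exp.
Qed.

Lemma CInt_tail_right (f : R -> C) (K d A u v : R) :
  dom K d f -> 0 <= A -> A <= u -> A <= v -> Cmod (CInt f u v) <= K / d * exp (- d * A).
Proof.
  intros Hf HA. pose proof (dom_K_pos _ _ _ Hf) as HK. destruct Hf as (Hd & Hc & Hb).
  assert (Main : forall u v, A <= u -> u <= v -> Cmod (CInt f u v) <= K / d * exp (- d * A)).
  { clear u v. intros u v Hu Huv. eapply Rle_trans.
    - apply CInt_norm_le with (g := fun x => K * exp (- d * x)); auto.
      + intros x Hx. rewrite <- (Rabs_pos_eq x) at 2 by lra. apply Hb.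
      + apply is_RInt_exp_decay; lra.
    - apply Rmult_le_compat_l; [apply Rmult_le_pos; [exact HK | left; now apply Rinv_0_lt_compat]|].
      assert (exp (- d * u) <= exp (- d * A)).
      { destruct (Req_dec u A) as [->|]; [lra|]. left. apply exp_increasing. nra. }
      pose proof (exp_pos (- d * v)). lra. }
  intros Hu Hv. destruct (Rle_dec u v) as [H|H]; [now apply Main|].
  rewrite (CInt_swap f v u) by exact Hc. rewrite Cmod_opp. apply Main; lra.
Qed.

Lemma CInt_reflect (f : R -> C) (a b : R) :
  (forall x, Ccont f x) -> CInt (fun x => f (- x)) a b = CInt f (- b) (- a).
Proof.
  intros Hc. apply CInt_eq.
  assert (H := is_RInt_comp_lin (V := C_R_NormedModule) f (-1) 0 a b (CInt f (-1 * a + 0) (-1 * b + 0))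
                 (CInt_correct _ _ _ Hc)).
  apply (is_RInt_opp (V := C_R_NormedModule)) in H.
  replace (-1 * a + 0) with (- a) in H by ring. replace (-1 * b + 0) with (- b) in H by ring.
  rewrite (CInt_swap f (- a) (- b)) by exact Hc.
  eapply (is_RInt_ext (V := C_R_NormedModule)); [|exact H].
  intros x _. replace (- x) with (-1 * x + 0) by ring.
  generalize (f (-1 * x + 0)). intros [p q].
  apply injective_projections; cbn; unfold opp, scal; cbn; unfold mult; cbn; ring.
Qed.

Lemma dom_reflect (f : R -> C) (K d : R) : dom K d f -> dom K d (fun x => f (- x)).
Proof.
  intros (Hd & Hc & Hb). split; [exact Hd|split].
  - intros x. apply (continuous_comp (fun x : R => - x) f).
    + apply (continuous_opp (V := R_NormedModule)), continuous_id.
    + apply Hc.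
  - intros x. rewrite <- (Rabs_Ropp x). apply Hb.
Qed.

Lemma CInt_tail_left (f : R -> C) (K d A u v : R) :
  dom K d f -> 0 <= A -> u <= - A -> v <= - A -> Cmod (CInt f u v) <= K / d * exp (- d * A).
Proof.
  intros Hf HA Hu Hv.
  assert (H := CInt_tail_right _ K d A (- v) (- u) (dom_reflect _ _ _ Hf) HA ltac:(lra) ltac:(lra)).
  rewrite CInt_reflect, !Ropp_involutive in H by apply Hf. exact H.
Qed.

Lemma CInt_two_tails (f : R -> C) (K d A a b a' b' : R) :
  dom K d f -> 0 <= A -> a <= - A -> a' <= - A -> A <= b -> A <= b' ->
  Cmod (CInt f a b - CInt f a' b')%C <= 2 * K / d * exp (- d * A).
Proof.
  intros Hf HA Ha Ha' Hb Hb'. assert (Hc := proj1 (proj2 Hf)).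
  rewrite <- (CInt_Chasles f a a' b) by exact Hc.
  rewrite <- (CInt_Chasles f a' b' b) by exact Hc.
  replace (CInt f a a' + (CInt f a' b' + CInt f b' b) - CInt f a' b')%C
    with (CInt f a a' + CInt f b' b)%C by ring.
  eapply Rle_trans; [apply Cmod_triangle|].
  pose proof (CInt_tail_left f K d A a a' Hf HA Ha Ha').
  pose proof (CInt_tail_right f K d A b' b Hf HA Hb' Hb).
  replace (2 * K / d) with (K / d + K / d) by (unfold Rdiv; ring). lra.
Qed.

Lemma exp_decay_small (K d eps : R) : 0 < d -> 0 < eps ->
  exists A, 0 <= A /\ K * exp (- d * A) < eps.
Proof.
  intros Hd He. destruct (Rle_dec K 0) as [HK|HK].
  - exists 0. split; [lra|]. pose proof (exp_pos (- d * 0)). nra.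
  (* This [A] gives [K <= d * A * eps], and [d * A < exp (d * A)]. *)
  - exists (Rmax 0 (K / (d * eps))). split; [apply Rmax_l|].
    set (A := Rmax _ _). assert (HA : K / (d * eps) <= A) by apply Rmax_r.
    assert (HA0 : 0 <= A) by apply Rmax_l.
    assert (H1 : K <= d * A * eps).
    { apply Rmult_le_compat_r with (r := d * eps) in HA; [|nra].
      replace (K / (d * eps) * (d * eps)) with K in HA by (field; lra). lra. }
    pose proof (exp_pos (d * A)).
    replace (- d * A) with (- (d * A)) by ring. rewrite exp_Ropp.
    apply Rmult_lt_reg_r with (exp (d * A)); [assumption|].
    rewrite Rmult_assoc, Rinv_l, Rmult_1_r by lra.
    assert (d * A < exp (d * A)).
    { destruct (Req_dec (d * A) 0) as [E|E]; [rewrite E, exp_0; lra|].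
      pose proof (exp_ineq1 (d * A) E). lra. }
    nra.
Qed.

(** Two truncations beyond [A] differ by at most the tails, so the Cauchy criterion gives the limit,
    and the same estimate passes to it. The later facts about [LInt] rest on this rate. *)
Lemma LInt_tail (f : R -> C) (K d A a b : R) :
  dom K d f -> 0 <= A -> a <= - A -> A <= b ->
  Cmod (CInt f a b - LInt f)%C <= 2 * K / d * exp (- d * A).
Proof.
  intros Hf HA Ha Hb.
  assert (Hex : exists l : C, filterlim (fun T => CInt f (- T) T) (Rbar_locally p_infty) (locally l)).
  { apply (proj1 (filterlim_locally_cauchy (U := C_R_CompleteNormedModule) (F := Rbar_locally p_infty) (fun T => CInt f (- T) T))). intros eps.
    destruct (exp_decay_small (2 * K / d) d eps (proj1 Hf) (cond_pos eps)) as (B & HB & HB').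
    exists (fun T => B < T). split; [now exists B|].
    intros u v Hu Hv. apply (C_NormedModule_mixin_compat1 (CInt f (- u) u)).
    eapply Rle_lt_trans; [|exact HB'].
    apply (CInt_two_tails f K d B); auto; lra. }
  destruct Hex as [l Hl].
  assert (E : LInt f = l) by (apply Clim_eq; exact Hl).
  rewrite E. apply le_epsilon. intros eps He.
  destruct (proj1 (filterlim_Cmod _ _) Hl (mkposreal eps He)) as [M HM].
  assert (HT := HM (Rmax A M + 1) ltac:(pose proof (Rmax_r A M); lra)).
  set (T := Rmax A M + 1) in *. assert (A < T) by (unfold T; pose proof (Rmax_l A M); lra).
  simpl in HT.
  replace (CInt f a b - l)%C with ((CInt f a b - CInt f (- T) T) + (CInt f (- T) T - l))%C by ring.
  eapply Rle_trans; [apply Cmod_triangle|].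
  pose proof (CInt_two_tails f K d A a b (- T) T Hf HA Ha ltac:(lra) Hb ltac:(lra)). lra.
Qed.

(** Free endpoints are needed for translations and for the substitution that leads back to the
    half-line. *)
Lemma LInt_flim_gen {T : Type} {F : (T -> Prop) -> Prop} {FF : Filter F} (f : R -> C) (K d : R) (a b : T -> R) :
  dom K d f -> filterlim a F (Rbar_locally m_infty) -> filterlim b F (Rbar_locally p_infty) ->
  filterlim (fun t => CInt f (a t) (b t)) F (locally (LInt f)).
Proof.
  intros Hf Ha Hb. apply filterlim_Cmod. intros eps.
  destruct (exp_decay_small (2 * K / d) d eps (proj1 Hf) (cond_pos eps)) as (B & HB & HB').
  assert (Ha' : F (fun t => a t < - B)) by (apply (Ha (fun x => x < - B)); exists (- B); auto).
  assert (Hb' : F (fun t => B < b t)) by (apply (Hb (fun x => B < x)); exists B; auto).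
  generalize (filter_and _ _ Ha' Hb'). apply filter_imp. intros t [H1 H2].
  eapply Rle_lt_trans; [|exact HB']. apply (LInt_tail f K d B); auto; lra.
Qed.

Lemma filterlim_Ropp_infty : filterlim (fun T => - T) (Rbar_locally p_infty) (Rbar_locally m_infty).
Proof. intros P [M HM]. exists (- M). intros x Hx. apply HM. lra. Qed.

Lemma LInt_flim (f : R -> C) (K d : R) : dom K d f ->
  filterlim (fun T => CInt f (- T) T) (Rbar_locally p_infty) (locally (LInt f)).
Proof.
  intros Hf. apply (LInt_flim_gen f K d); auto using filterlim_Ropp_infty, filterlim_id.
Qed.

Lemma LInt_eq (f : R -> C) (l : C) :
  filterlim (fun T => CInt f (- T) T) (Rbar_locally p_infty) (locally l) -> LInt f = l.
Proof. apply Clim_eq. Qed.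

Lemma LInt_ext (f g : R -> C) : (forall x, f x = g x) -> LInt f = LInt g.
Proof. intros H. replace g with f; [reflexivity|]. now apply functional_extensionality. Qed.

Lemma LInt_bound (f : R -> C) (K d : R) : dom K d f -> Cmod (LInt f) <= 2 * K / d.
Proof.
  (* On the degenerate interval from 0 to 0 the whole integral is tail. *)
  intros Hf. assert (H := LInt_tail f K d 0 0 0 Hf ltac:(lra) ltac:(lra) ltac:(lra)).
  rewrite Rmult_0_r, exp_0, Rmult_1_r in H.
  rewrite (RInt_point (V := C_R_CompleteNormedModule)) in H.
  change (Cmod (RtoC 0 - LInt f)%C <= 2 * K / d) in H.
  replace (RtoC 0 - LInt f)%C with (- LInt f)%C in H by ring.
  now rewrite Cmod_opp in H.
Qed.

(** Smallness on a compact set and decay outside it: the estimate behind both dominated convergence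
    and differentiation under the integral. *)
Lemma LInt_bound_split (f : R -> C) (K d A e : R) :
  dom K d f -> 0 <= A -> (forall x, Rabs x <= A -> Cmod (f x) <= e) ->
  Cmod (LInt f) <= 2 * A * e + 2 * K / d * exp (- d * A).
Proof.
  intros Hf HA He. assert (H := LInt_tail f K d A (- A) A Hf HA ltac:(lra) ltac:(lra)).
  assert (H2 : Cmod (CInt f (- A) A) <= (A - - A) * e).
  { apply CInt_norm_le with (g := fun _ => e); [lra | apply Hf | |].
    - intros x Hx. apply He. apply Rabs_le. lra.
    - apply (is_RInt_const (V := R_NormedModule)). }
  replace (LInt f) with (CInt f (- A) A + - (CInt f (- A) A - LInt f))%C by ring.
  eapply Rle_trans; [apply Cmod_triangle|]. rewrite Cmod_opp. lra.
Qed.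

Lemma dom_Cmult (c : C) (f : R -> C) (K d : R) : dom K d f -> dom (Cmod c * K) d (fun x => c * f x)%C.
Proof.
  intros (Hd & Hc & Hb). split; [exact Hd|split].
  - intros x. apply continuous_Cmult; [apply continuous_const | apply Hc].
  - intros x. rewrite Cmod_mult, Rmult_assoc. apply Rmult_le_compat_l; [apply Cmod_ge_0 | apply Hb].
Qed.

Lemma dom_weaken (f : R -> C) (K d K' d' : R) : dom K d f -> K <= K' -> 0 < d' <= d -> dom K' d' f.
Proof.
  intros Hf HK Hd'. pose proof (dom_K_pos _ _ _ Hf). destruct Hf as (Hd & Hc & Hb).
  split; [lra|split; [exact Hc|]]. intros x. eapply Rle_trans; [apply Hb|].
  pose proof (Rabs_pos x).
  assert (exp (- d * Rabs x) <= exp (- d' * Rabs x)).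
  { destruct (Req_dec (- d * Rabs x) (- d' * Rabs x)) as [->|]; [lra|]. left. apply exp_increasing. nra. }
  pose proof (exp_pos (- d * Rabs x)). nra.
Qed.

Lemma dom_plus (f g : R -> C) (K d K' d' : R) :
  dom K d f -> dom K' d' g -> dom (K + K') (Rmin d d') (fun x => f x + g x)%C.
Proof.
  intros Hf Hg. assert (Hm : 0 < Rmin d d') by (apply Rmin_pos; [apply Hf | apply Hg]).
  assert (Hf' := dom_weaken f K d K (Rmin d d') Hf (Rle_refl _) (conj Hm (Rmin_l _ _))).
  assert (Hg' := dom_weaken g K' d' K' (Rmin d d') Hg (Rle_refl _) (conj Hm (Rmin_r _ _))).
  split; [exact Hm|split].
  - intros x. apply continuous_Cplus; [apply Hf | apply Hg].
  - intros x. eapply Rle_trans; [apply Cmod_triangle|]. rewrite Rmult_plus_distr_r.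
    apply Rplus_le_compat; [apply Hf' | apply Hg'].
Qed.

Lemma LInt_Cmult (c : C) (f : R -> C) (K d : R) : dom K d f -> LInt (fun x => c * f x)%C = (c * LInt f)%C.
Proof.
  intros Hf. apply LInt_eq.
  apply (filterlim_ext (fun T => c * CInt f (- T) T)%C).
  - intros T. symmetry. apply CInt_eq, is_CInt_Cmult, CInt_correct, Hf.
  - apply flim_Cmult; [apply filterlim_const | now apply (LInt_flim f K d)].
Qed.

Lemma LInt_plus (f g : R -> C) (K d K' d' : R) : dom K d f -> dom K' d' g ->
  LInt (fun x => f x + g x)%C = (LInt f + LInt g)%C.
Proof.
  intros Hf Hg. apply LInt_eq.
  apply (filterlim_ext (fun T => CInt f (- T) T + CInt g (- T) T)%C).
  - intros T. symmetry. apply CInt_eq, is_CInt_plus; apply CInt_correct; [apply Hf | apply Hg].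
  - apply flim_Cplus; [now apply (LInt_flim f K d) | now apply (LInt_flim g K' d')].
Qed.

Lemma LInt_minus (f g : R -> C) (K d K' d' : R) : dom K d f -> dom K' d' g ->
  LInt (fun x => f x - g x)%C = (LInt f - LInt g)%C.
Proof.
  intros Hf Hg.
  rewrite (LInt_ext _ (fun x => f x + (- RtoC 1) * g x)%C) by (intros; ring).
  rewrite (LInt_plus f _ K d _ d' Hf (dom_Cmult (- RtoC 1) g K' d' Hg)), (LInt_Cmult _ g K' d' Hg). ring.
Qed.

Lemma dom_minus (f g : R -> C) (K d K' d' : R) :
  dom K d f -> dom K' d' g -> dom (K + K') (Rmin d d') (fun x => f x - g x)%C.
Proof.
  intros Hf Hg. assert (H := dom_plus _ _ _ _ _ _ Hf (dom_Cmult (- RtoC 1) g K' d' Hg)).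
  rewrite Cmod_m1, Rmult_1_l in H.
  destruct H as (H1 & H2 & H3). split; [exact H1|split].
  - intros x. apply continuous_Cminus; [apply Hf | apply Hg].
  - intros x. specialize (H3 x). replace (f x - g x)%C with (f x + - (1) * g x)%C by ring. exact H3.
Qed.

Lemma LInt_reflect (f : R -> C) (K d : R) : dom K d f -> LInt (fun x => f (- x)) = LInt f.
Proof.
  intros Hf. apply LInt_eq.
  apply (filterlim_ext (fun T => CInt f (- T) T)).
  - intros T. rewrite CInt_reflect, Ropp_involutive by apply Hf. reflexivity.
  - now apply (LInt_flim f K d).
Qed.

Lemma CInt_shift (f : R -> C) (c a b : R) :
  (forall x, Ccont f x) -> CInt (fun x => f (x + c)) a b = CInt f (a + c) (b + c).
Proof.
  intros Hc. apply CInt_eq.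
  assert (H := is_RInt_comp_lin (V := C_R_NormedModule) f 1 c a b (CInt f (1 * a + c) (1 * b + c))
                 (CInt_correct _ _ _ Hc)).
  rewrite !Rmult_1_l in H.
  eapply (is_RInt_ext (V := C_R_NormedModule)); [|exact H].
  intros x _. replace (x + c) with (1 * x + c) by ring. apply (scal_one (V := C_R_NormedModule)).
Qed.

Lemma dom_shift (f : R -> C) (c K d : R) :
  dom K d f -> dom (K * exp (d * Rabs c)) d (fun x => f (x + c)).
Proof.
  intros Hf. pose proof (dom_K_pos _ _ _ Hf). destruct Hf as (Hd & Hc & Hb). split; [exact Hd|split].
  - intros x. apply (continuous_comp (fun x : R => x + c) f).
    + apply (continuous_plus (V := R_NormedModule)); [apply continuous_id | apply continuous_const].
    + apply Hc.
  - intros x. eapply Rle_trans; [apply Hb|]. rewrite Rmult_assoc, <- exp_plus.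
    apply Rmult_le_compat_l; [assumption|].
    assert (Rabs x <= Rabs (x + c) + Rabs c).
    { replace x with ((x + c) + - c) at 1 by ring. rewrite <- (Rabs_Ropp c). apply Rabs_triang. }
    assert (L : - d * Rabs (x + c) <= d * Rabs c + - d * Rabs x) by nra.
    destruct L as [L|L]; [left; now apply exp_increasing | rewrite L; lra].
Qed.

Lemma LInt_shift (f : R -> C) (c K d : R) : dom K d f -> LInt (fun x => f (x + c)) = LInt f.
Proof.
  intros Hf. apply LInt_eq.
  apply (filterlim_ext (fun T => CInt f (- T + c) (T + c))).
  - intros T. rewrite CInt_shift by apply Hf. reflexivity.
  - apply (LInt_flim_gen f K d); [exact Hf| |].
    + intros P [M HM]. exists (c - M). intros x Hx. apply HM. lra.
    + intros P [M HM]. exists (M - c). intros x Hx. apply HM. lra.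
Qed.

Lemma LInt_derivative (F f : R -> C) (K d : R) (a b : C) :
  dom K d f -> (forall x, is_Cderive F x (f x)) ->
  filterlim F (Rbar_locally m_infty) (locally a) -> filterlim F (Rbar_locally p_infty) (locally b) ->
  LInt f = (b - a)%C.
Proof.
  intros Hf HF Ha Hb. apply LInt_eq.
  apply (filterlim_ext (fun T => F T - F (- T)%R)%C).
  - intros T. symmetry. apply CInt_eq.
    apply (is_RInt_derive (V := C_R_CompleteNormedModule) F f (- T) T).
    + intros x _. apply HF.
    + intros x _. apply Hf.
  - apply flim_Cminus; [exact Hb|]. eapply filterlim_comp; [apply filterlim_Ropp_infty | exact Ha].
Qed.

Lemma dom_lim (f : R -> C) (K d : R) : dom K d f ->
  filterlim f (Rbar_locally m_infty) (locally (RtoC 0)) /\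
  filterlim f (Rbar_locally p_infty) (locally (RtoC 0)).
Proof.
  intros Hf. pose proof (dom_K_pos _ _ _ Hf). destruct Hf as (Hd & Hc & Hb).
  assert (Main : forall eps : posreal, exists A, forall x, A < Rabs x -> Cmod (f x - RtoC 0)%C < eps).
  { intros eps. destruct (exp_decay_small K d eps Hd (cond_pos eps)) as (A & HA & HA').
    exists A. intros x Hx. replace (f x - RtoC 0)%C with (f x) by ring.
    eapply Rle_lt_trans; [apply Hb|]. eapply Rle_lt_trans; [|exact HA'].
    apply Rmult_le_compat_l; [assumption|]. left. apply exp_increasing. nra. }
  split; apply filterlim_Cmod; intros eps; destruct (Main eps) as [A HA].
  - exists (- Rabs A - 1). intros x Hx. apply HA.
    pose proof (Rle_abs A). pose proof (Rabs_pos A). rewrite Rabs_left; lra.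
  - exists (Rabs A). intros x Hx. apply HA.
    pose proof (Rle_abs A). pose proof (Rabs_pos A). rewrite Rabs_pos_eq; lra.
Qed.

(** Integration by parts takes this form below: the boundary term is a decaying [F], and the
    derivative is written as a combination of the integrals to be related. *)
Lemma LInt_derivative_0 (F f : R -> C) (K d K' d' : R) :
  dom K d f -> dom K' d' F -> (forall x, is_Cderive F x (f x)) -> LInt f = RtoC 0.
Proof.
  intros Hf HF Hd. destruct (dom_lim _ _ _ HF) as [H1 H2].
  rewrite (LInt_derivative F f K d (RtoC 0) (RtoC 0)); auto. ring.
Qed.

(** ** Dependence on parameters *)

(** Dominated convergence in elementary form: a common exponential majorant makes the tails
    uniformly small, so uniform convergence on compact sets suffices. *)
Lemma LInt_filterlim {T : Type} {F : (T -> Prop) -> Prop} {FF : Filter F}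
  (f : T -> R -> C) (g : R -> C) (K d : R) :
  dom K d g -> F (fun t => dom K d (f t)) ->
  (forall A eps : posreal, F (fun t => forall x, Rabs x <= A -> Cmod (f t x - g x)%C <= eps)) ->
  filterlim (fun t => LInt (f t)) F (locally (LInt g)).
Proof.
  intros Hg Hf Hu. apply filterlim_Cmod. intros eps.
  assert (Hd := proj1 Hg).
  destruct (exp_decay_small (2 * (K + K) / d) d (eps / 2) Hd ltac:(pose proof (cond_pos eps); lra))
    as (B & HB & HB').
  assert (HA : 0 < B + 1) by lra.
  assert (He : 0 < eps / 2 / (2 * (B + 1))).
  { apply Rdiv_lt_0_compat; [pose proof (cond_pos eps); lra | lra]. }
  generalize (filter_and _ _ Hf (Hu (mkposreal _ HA) (mkposreal _ He))). apply filter_imp.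
  intros t [H1 H2]. simpl in H2.
  rewrite <- (LInt_minus (f t) g K d K d H1 Hg).
  assert (Hm := dom_minus _ _ _ _ _ _ H1 Hg). rewrite Rmin_left in Hm by lra.
  eapply Rle_lt_trans; [apply (LInt_bound_split _ _ _ B (eps / 2 / (2 * (B + 1))) Hm HB)|].
  - intros x Hx. apply H2. lra.
  - assert (2 * B * (eps / 2 / (2 * (B + 1))) <= eps / 2).
    { replace (eps / 2) with (2 * (B + 1) * (eps / 2 / (2 * (B + 1)))) at 2 by (field; lra).
      apply Rmult_le_compat_r; lra. }
    lra.
Qed.

(** Joint continuity along the segment, made uniform by compactness; it supplies the local
    hypothesis of [LInt_filterlim]. *)
Lemma uniform_on_segment {P : UniformSpace} (f : P -> R -> C) (p0 : P) (A : R) (eps : posreal) :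
  (forall x, @continuous (prod_UniformSpace P R_UniformSpace) C_UniformSpace
               (fun q => f (fst q) (snd q)) (p0, x)) ->
  locally p0 (fun p => forall x, Rabs x <= A -> Cmod (f p x - f p0 x)%C <= eps).
Proof.
  intros Hc.
  assert (Hd : forall x : R, exists d : posreal, forall p y, ball p0 d p -> Rabs (y - x) < d ->
             Cmod (f p y - f p0 x)%C < eps / 2).
  { intros x. assert (He : 0 < eps / 2) by (pose proof (cond_pos eps); lra).
    assert (H : @locally (prod_UniformSpace P R_UniformSpace) (p0, x)
                  (fun q => Cmod (f (fst q) (snd q) - f p0 x)%C < eps / 2))
      by exact (proj1 (filterlim_Cmod _ _) (Hc x) (mkposreal _ He)).
    destruct H as [d Hd]. exists d. intros p y Hp Hy. apply (Hd (p, y)). split; assumption. }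
  (* The compactness theorem takes a gauge as a function, so a radius is chosen at each point;
     [Tn 1 R] is [R] paired with [unit]. *)
  pose (delta := fun t : Compactness.Tn 1 R => epsilon (inhabits (mkposreal 1 Rlt_0_1))
     (fun d : posreal => forall p y, ball p0 d p -> Rabs (y - fst t) < d -> Cmod (f p y - f p0 (fst t))%C < eps / 2)).
  assert (Hdelta : forall t, forall p y, ball p0 (delta t) p -> Rabs (y - fst t) < delta t ->
            Cmod (f p y - f p0 (fst t))%C < eps / 2).
  { intros t. unfold delta. apply epsilon_spec. apply Hd. }
  destruct (compactness_value 1 (- A, tt) (A, tt) delta) as [d0 Hd0].
  exists d0. intros p Hp x Hx.
  (* The covering property of [compactness_value] is stated under a double negation, which a proof
     by contradiction removes. *)
  apply NNPP. intros Hn.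
  apply (Hd0 (x, tt)).
  { split; [|exact I]. apply Rabs_le_between in Hx. simpl. lra. }
  intros [[t []] (Ht1 & Ht2 & Ht3)]. apply Hn. destruct Ht2 as [Ht2 _]. simpl in Ht2.
  assert (E1 := Hdelta (t, tt) p x (ball_le _ _ _ Ht3 _ Hp) Ht2).
  assert (E2 := Hdelta (t, tt) p0 x (ball_center _ _) Ht2).
  replace (f p x - f p0 x)%C with ((f p x - f p0 t) + - (f p0 x - f p0 t))%C by ring.
  simpl in E1, E2.
  eapply Rle_trans; [apply Cmod_triangle|]. rewrite Cmod_opp. lra.
Qed.

Lemma LInt_continuous {P : UniformSpace} (f : P -> R -> C) (p0 : P) (K d : R) :
  (forall x, @continuous (prod_UniformSpace P R_UniformSpace) C_UniformSpace
               (fun q => f (fst q) (snd q)) (p0, x)) ->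
  locally p0 (fun p => dom K d (f p)) ->
  @continuous P C_UniformSpace (fun p => LInt (f p)) p0.
Proof.
  intros Hc Hd. apply (LInt_filterlim f (f p0) K d); auto.
  - now apply locally_singleton in Hd.
  - intros A eps. now apply uniform_on_segment.
Qed.

(** * Derivatives of complex-valued functions of a real variable *)

Lemma Rplus_half_mult (e x : R) : e / 2 * x + e / 2 * x = e * x.
Proof. field. Qed.

Lemma is_Cderive_components (f : R -> C) (x : R) (l : C) :
  is_Cderive f x l <-> is_derive (fun t => Re (f t)) x (Re l) /\ is_derive (fun t => Im (f t)) x (Im l).
Proof.
  split.
  - intros H. split.
    + apply (filterdiff_comp' (U := AbsRing_NormedModule R_AbsRing) (V := C_R_NormedModule) (W := R_NormedModule)
             f (fun c : C => Re c) x (fun y : R => scal y l) (fun c : C => Re c) H).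
      apply filterdiff_linear. apply (is_linear_fst (U := R_NormedModule) (V := R_NormedModule)).
    + apply (filterdiff_comp' (U := AbsRing_NormedModule R_AbsRing) (V := C_R_NormedModule) (W := R_NormedModule)
             f (fun c : C => Im c) x (fun y : R => scal y l) (fun c : C => Im c) H).
      apply filterdiff_linear. apply (is_linear_snd (U := R_NormedModule) (V := R_NormedModule)).
  - intros [[_ H1] [_ H2]]. split; [apply is_linear_scal_l|].
    intros y Hy eps.
    generalize (filter_and _ _ (H1 y Hy (pos_div_2 eps)) (H2 y Hy (pos_div_2 eps))).
    apply filter_imp. intros t [A B]. simpl in A, B.
    rewrite <- Cmod_norm.
    eapply Rle_trans; [apply (Cmod_le_abs
      (fst (minus (minus (f t) (f y)) (scal (minus t y) l : C_R_NormedModule)))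
      (snd (minus (minus (f t) (f y)) (scal (minus t y) l : C_R_NormedModule))))|].
    eapply Rle_trans; [apply Rplus_le_compat; [exact A | exact B]|]. right. apply Rplus_half_mult.
Qed.

(** The mean value theorem has no complex form; applying it to real and imaginary parts separately
    produces the factor 2. *)
Lemma C_mean_value_bound (f df : R -> C) (D x y : R) :
  (forall t, Rabs (t - x) <= Rabs (y - x) -> is_Cderive f t (df t) /\ Cmod (df t) <= D) ->
  Cmod (f y - f x)%C <= 2 * D * Rabs (y - x).
Proof.
  intros H.
  assert (H1 := bounded_variation (fun t => Re (f t)) (fun t => Re (df t)) D x y).
  assert (H2 := bounded_variation (fun t => Im (f t)) (fun t => Im (df t)) D x y).
  eapply Rle_trans; [apply (Cmod_le_abs (Re (f y) - Re (f x)) (Im (f y) - Im (f x)))|].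
  assert (Rabs (Re (f y) - Re (f x)) <= D * Rabs (y - x)).
  { apply H1. intros t Ht. destruct (H t Ht) as [A B]. apply is_Cderive_components in A.
    split; [apply A | eapply Rle_trans; [apply re_le_Cmod | exact B]]. }
  assert (Rabs (Im (f y) - Im (f x)) <= D * Rabs (y - x)).
  { apply H2. intros t Ht. destruct (H t Ht) as [A B]. apply is_Cderive_components in A.
    split; [apply A | eapply Rle_trans; [apply im_le_Cmod | exact B]]. }
  lra.
Qed.

Lemma is_Cderive_eps (f : R -> C) (x : R) (l : C) :
  (forall eps : posreal, exists del : posreal, forall y, Rabs (y - x) < del ->
     Cmod (f y - f x - RtoC (y - x) * l)%C <= eps * Rabs (y - x)) ->
  is_Cderive f x l.
Proof.
  intros H. split; [apply is_linear_scal_l|]. intros x0 Hx0.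
  apply (is_filter_lim_locally_unique (V := AbsRing_NormedModule R_AbsRing)) in Hx0. subst x0. intros eps.
  destruct (H eps) as [del Hdel]. exists del. intros y Hy.
  rewrite <- Cmod_norm. eapply Rle_trans; [|apply (Hdel y Hy)].
  right. f_equal. unfold minus, plus, opp; cbn. unfold Cminus, Cmult, Cplus, Copp; cbn.
  unfold scal, plus, opp; cbn. unfold mult; cbn. apply injective_projections; cbn; ring.
Qed.

Lemma is_Cderive_ext (f g : R -> C) (x : R) (l : C) :
  (forall t, f t = g t) -> is_Cderive f x l -> is_Cderive g x l.
Proof. intros H. apply (is_derive_ext (V := C_R_NormedModule)). exact H. Qed.

Lemma is_Cderive_eq (f : R -> C) (x : R) (l l' : C) :
  l = l' -> is_Cderive f x l -> is_Cderive f x l'.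
Proof. now intros ->. Qed.

Lemma is_Cderive_const (c : C) (x : R) : is_Cderive (fun _ => c) x (RtoC 0).
Proof. apply (is_derive_const (V := C_R_NormedModule)). Qed.

Lemma is_Cderive_RtoC (f : R -> R) (x l : R) :
  is_derive f x l -> is_Cderive (fun t => RtoC (f t)) x (RtoC l).
Proof.
  intros H. apply is_Cderive_components. split; [exact H|].
  change (is_derive (fun _ : R => 0) x 0). apply (is_derive_const (V := R_NormedModule)).
Qed.

Lemma is_Cderive_plus (f g : R -> C) (x : R) (l m : C) :
  is_Cderive f x l -> is_Cderive g x m -> is_Cderive (fun t => f t + g t)%C x (l + m)%C.
Proof. apply (is_derive_plus (V := C_R_NormedModule)). Qed.

Lemma is_Cderive_mult (f g : R -> C) (x : R) (l m : C) :
  is_Cderive f x l -> is_Cderive g x m -> is_Cderive (fun t => f t * g t)%C x (l * g x + f x * m)%C.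
Proof.
  intros Hf Hg. apply is_Cderive_components in Hf. apply is_Cderive_components in Hg.
  destruct Hf as [F1 F2], Hg as [G1 G2]. apply is_Cderive_components. split.
  - replace (Re (l * g x + f x * m)%C) with
      ((Re l * Re (g x) + Re (f x) * Re m) - (Im l * Im (g x) + Im (f x) * Im m))
      by (destruct (f x), (g x), l, m; simpl; ring).
    apply (is_derive_minus (V := R_NormedModule) (fun t => Re (f t) * Re (g t)) (fun t => Im (f t) * Im (g t)));
      now apply (is_derive_mult (K := R_AbsRing)); [| |intros; apply Rmult_comm].
  - replace (Im (l * g x + f x * m)%C) with
      ((Re l * Im (g x) + Re (f x) * Im m) + (Im l * Re (g x) + Im (f x) * Re m))
      by (destruct (f x), (g x), l, m; simpl; ring).
    apply (is_derive_plus (V := R_NormedModule) (fun t => Re (f t) * Im (g t)) (fun t => Im (f t) * Re (g t)));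
      now apply (is_derive_mult (K := R_AbsRing)); [| |intros; apply Rmult_comm].
Qed.

Lemma is_Cderive_Cmult (c : C) (f : R -> C) (x : R) (l : C) :
  is_Cderive f x l -> is_Cderive (fun t => c * f t)%C x (c * l)%C.
Proof.
  intros H. eapply is_Cderive_eq; [|apply (is_Cderive_mult _ _ _ _ _ (is_Cderive_const c x) H)]. ring.
Qed.

Lemma is_Cderive_minus (f g : R -> C) (x : R) (l m : C) :
  is_Cderive f x l -> is_Cderive g x m -> is_Cderive (fun t => f t - g t)%C x (l - m)%C.
Proof. apply (is_derive_minus (V := C_R_NormedModule)). Qed.

Lemma is_Cderive_id (x : R) : is_Cderive (fun t => RtoC t) x (RtoC 1).
Proof. apply is_Cderive_RtoC. apply (is_derive_id (K := R_AbsRing)). Qed.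

Lemma is_Cderive_cexp (f : R -> C) (x : R) (l : C) :
  is_Cderive f x l -> is_Cderive (fun t => cexp (f t)) x (l * cexp (f x))%C.
Proof.
  intros H. apply is_Cderive_components in H. destruct H as [H1 H2].
  unfold cexp.
  assert (E : is_Cderive (fun t => RtoC (exp (Re (f t)))) x (RtoC (Re l * exp (Re (f x))))).
  { apply is_Cderive_RtoC. apply (is_derive_comp (V := R_NormedModule) exp (fun t => Re (f t))); [apply is_derive_exp | exact H1]. }
  assert (T : is_Cderive (fun t => (cos (Im (f t)), sin (Im (f t))) : C) x
                (Im l * - sin (Im (f x)), Im l * cos (Im (f x)))).
  { apply is_Cderive_components. split.
    - apply (is_derive_comp (V := R_NormedModule) cos (fun t => Im (f t))); [apply is_derive_cos | exact H2].
    - apply (is_derive_comp (V := R_NormedModule) sin (fun t => Im (f t))); [apply is_derive_sin | exact H2]. }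
  eapply is_Cderive_eq; [|apply (is_Cderive_mult _ _ _ _ _ E T)].
  destruct (f x) as [a b], l as [p q]. unfold Cplus, Cmult, RtoC; simpl. f_equal; ring.
Qed.

Lemma is_Cderive_cexp_lin (c : C) (x : R) :
  is_Cderive (fun t => cexp (c * RtoC t)%C) x (c * cexp (c * RtoC x))%C.
Proof.
  eapply is_Cderive_eq; [|apply (is_Cderive_cexp _ _ _ (is_Cderive_Cmult c _ _ _ (is_Cderive_id x)))].
  ring.
Qed.

Lemma is_Cderive_Cinv (f : R -> C) (x : R) (l : C) :
  f x <> RtoC 0 -> is_Cderive f x l -> is_Cderive (fun t => / f t)%C x (- l / (f x * f x))%C.
Proof.
  intros Hn H. apply is_Cderive_components in H. destruct H as [H1 H2].
  assert (Hp : 0 < Re (f x) ^ 2 + Im (f x) ^ 2).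
  { rewrite <- Cmod2_alt. apply pow_lt. now apply Cmod_gt_0. }
  set (u := fun t => Re (f t)) in *. set (v := fun t => Im (f t)) in *.
  change (0 < u x ^ 2 + v x ^ 2) in Hp.
  assert (Hd : is_derive (fun t => u t ^ 2 + v t ^ 2) x (2 * u x * Re l + 2 * v x * Im l)).
  { apply (is_derive_plus (V := R_NormedModule) (fun t => u t ^ 2) (fun t => v t ^ 2)).
    - replace (2 * u x * Re l) with (INR 2 * Re l * u x ^ 1) by (simpl; ring). now apply (is_derive_pow u 2).
    - replace (2 * v x * Im l) with (INR 2 * Im l * v x ^ 1) by (simpl; ring). now apply (is_derive_pow v 2). }
  assert (Ef : f x = (u x, v x)) by (unfold u, v; destruct (f x); reflexivity).
  apply is_Cderive_components. split.
  - apply (is_derive_ext (fun t => u t / (u t ^ 2 + v t ^ 2))); [reflexivity|].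
    replace (Re (- l / (f x * f x))%C)
      with ((Re l * (u x ^ 2 + v x ^ 2) - u x * (2 * u x * Re l + 2 * v x * Im l)) / (u x ^ 2 + v x ^ 2) ^ 2).
    + apply (is_derive_div u (fun t => u t ^ 2 + v t ^ 2)); auto; lra.
    + rewrite Ef. destruct l as [p q]. simpl. field. split; [|lra].
      replace _ with ((u x ^ 2 + v x ^ 2) ^ 2) by ring. apply pow_nonzero; lra.
  - apply (is_derive_ext (fun t => (- v t) / (u t ^ 2 + v t ^ 2))); [reflexivity|].
    replace (Im (- l / (f x * f x))%C)
      with (((- Im l) * (u x ^ 2 + v x ^ 2) - (- v x) * (2 * u x * Re l + 2 * v x * Im l)) / (u x ^ 2 + v x ^ 2) ^ 2).
    + apply (is_derive_div (fun t => - v t) (fun t => u t ^ 2 + v t ^ 2)); auto; [|lra].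
      now apply (is_derive_opp (V := R_NormedModule)).
    + rewrite Ef. destruct l as [p q]. simpl. field. split; [|lra].
      replace _ with ((u x ^ 2 + v x ^ 2) ^ 2) by ring. apply pow_nonzero; lra.
Qed.

(** The difference quotient error is bounded pointwise by the oscillation of [dF] in the parameter.
    That oscillation is small on a compact set and at most twice the majorant elsewhere, which is
    the situation of [LInt_bound_split]. *)
Lemma LInt_is_derive (F dF : R -> R -> C) (s0 K d K' d' : R) (r : posreal) :
  (forall s, Rabs (s - s0) < r -> dom K' d' (F s)) ->
  (forall s, Rabs (s - s0) < r -> dom K d (dF s)) ->
  (forall s x, Rabs (s - s0) < r -> is_Cderive (fun s => F s x) s (dF s x)) ->
  (forall x, @continuous (prod_UniformSpace R_UniformSpace R_UniformSpace) C_UniformSpace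
               (fun q => dF (fst q) (snd q)) (s0, x)) ->
  is_Cderive (fun s => LInt (F s)) s0 (LInt (dF s0)).
Proof.
  intros HF HdF Hder Hcont. apply is_Cderive_eps. intros eps.
  assert (H0 : Rabs (s0 - s0) < r) by (rewrite Rminus_diag, Rabs_R0; apply cond_pos).
  assert (HK := dom_K_pos _ _ _ (HdF s0 H0)). assert (Hd := proj1 (HdF s0 H0)).
  pose proof (cond_pos eps) as He.
  (* Of the 8, a factor 2 comes from the mean value bound, 2 from the oscillation of [dF] and 2 from
     the two tails. The 8 in [eps / (8 * (A + 1))] below likewise leaves [eps / 2] for the compact
     part. *)
  destruct (exp_decay_small (8 * K / d) d (eps / 2) Hd ltac:(lra)) as (A & HA & HA').
  assert (He1 : 0 < eps / (8 * (A + 1))) by (apply Rdiv_lt_0_compat; lra).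
  destruct (uniform_on_segment dF s0 A (mkposreal _ He1) Hcont) as [d1 Hd1].
  assert (Hdel : 0 < Rmin d1 r) by (apply Rmin_pos; apply cond_pos).
  exists (mkposreal _ Hdel). simpl. intros y Hy.
  assert (Hyr : Rabs (y - s0) < r) by (eapply Rlt_le_trans; [exact Hy | apply Rmin_r]).
  assert (Hyd : Rabs (y - s0) < d1) by (eapply Rlt_le_trans; [exact Hy | apply Rmin_l]).
  set (h := Rabs (y - s0)) in *. assert (Hh : 0 <= h) by apply Rabs_pos.
  assert (Hm1 := dom_minus _ _ _ _ _ _ (HF y Hyr) (HF s0 H0)).
  assert (Hm2 := dom_Cmult (RtoC (y - s0)) _ _ _ (HdF s0 H0)).
  rewrite <- (LInt_minus _ _ _ _ _ _ (HF y Hyr) (HF s0 H0)).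
  rewrite <- (LInt_Cmult (RtoC (y - s0)) _ _ _ (HdF s0 H0)).
  rewrite <- (LInt_minus _ _ _ _ _ _ Hm1 Hm2).
  (* Subtracting the linear function [dF s0 x * s] before applying the mean value bound replaces
     [dF] by its increment. *)
  assert (Hmv : forall x D, (forall s, Rabs (s - s0) <= h -> Cmod (dF s x - dF s0 x)%C <= D) ->
      Cmod (F y x - F s0 x - RtoC (y - s0) * dF s0 x)%C <= 2 * D * h).
  { intros x D HD.
    replace (F y x - F s0 x - RtoC (y - s0) * dF s0 x)%C
      with ((F y x - dF s0 x * RtoC y) - (F s0 x - dF s0 x * RtoC s0))%C
      by (rewrite RtoC_minus; ring).
    apply (C_mean_value_bound (fun s => F s x - dF s0 x * RtoC s)%C (fun s => dF s x - dF s0 x)%C).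
    intros t Ht. split; [|apply HD, Ht].
    apply is_Cderive_minus; [apply Hder; fold h in Ht; lra|].
    eapply is_Cderive_eq; [|apply is_Cderive_Cmult, is_Cderive_id]. ring. }
  assert (Hdom : dom (4 * K * h) d (fun x => F y x - F s0 x - RtoC (y - s0) * dF s0 x)%C).
  { destruct (dom_minus _ _ _ _ _ _ Hm1 Hm2) as (_ & Hc & _).
    split; [exact Hd|split; [exact Hc|]]. intros x.
    replace (4 * K * h * exp (- d * Rabs x)) with (2 * (2 * K * exp (- d * Rabs x)) * h) by ring.
    apply Hmv. intros s Hs. unfold Cminus. eapply Rle_trans; [apply Cmod_triangle|]. rewrite Cmod_opp.
    assert (E1 := proj2 (proj2 (HdF s ltac:(lra))) x).
    assert (E2 := proj2 (proj2 (HdF s0 H0)) x). lra. }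
  eapply Rle_trans; [apply (LInt_bound_split _ _ _ A (2 * (eps / (8 * (A + 1))) * h) Hdom HA)|].
  - intros x Hx. apply Hmv. intros s Hs. apply Hd1; [|exact Hx]. simpl.
    apply (Rle_lt_trans _ h); [exact Hs | exact Hyd].
  - assert (2 * A * (2 * (eps / (8 * (A + 1))) * h) <= eps / 2 * h).
    { replace (eps / 2 * h) with (2 * (A + 1) * (2 * (eps / (8 * (A + 1))) * h)) by (field; lra).
      apply Rmult_le_compat_r; [|lra].
      apply Rmult_le_pos; [lra | exact Hh]. }
    replace (2 * (4 * K * h) / d * exp (- d * A)) with (8 * K / d * exp (- d * A) * h) by (field; lra).
    assert (8 * K / d * exp (- d * A) * h <= eps / 2 * h) by (apply Rmult_le_compat_r; lra).
    lra.
Qed.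

Lemma CInt_bound (f : R -> C) (K d a b : R) : dom K d f -> Cmod (CInt f a b) <= 2 * K / d.
Proof.
  intros Hf. assert (Hc := proj1 (proj2 Hf)). assert (Hd := proj1 Hf). assert (HK := dom_K_pos _ _ _ Hf).
  assert (Half : forall y, Cmod (CInt f 0 y) <= K / d).
  { intros y. replace (K / d) with (K / d * exp (- d * 0)) by (rewrite Rmult_0_r, exp_0; ring).
    destruct (Rle_dec 0 y).
    - apply (CInt_tail_right f K d 0); auto; lra.
    - apply (CInt_tail_left f K d 0); auto; lra. }
  rewrite <- (CInt_Chasles f a 0 b), (CInt_swap f 0 a) by exact Hc.
  eapply Rle_trans; [apply Cmod_triangle|]. rewrite Cmod_opp.
  pose proof (Half a). pose proof (Half b).
  replace (2 * K / d) with (K / d + K / d) by (unfold Rdiv; ring). lra.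
Qed.

Lemma CInt_is_derive (f : R -> C) (a x : R) : (forall x, Ccont f x) -> is_Cderive (fun y => CInt f a y) x (f x).
Proof.
  intros Hc. apply (is_derive_RInt (V := C_R_NormedModule) f (fun y => CInt f a y) a x).
  - apply filter_forall. intros y. now apply CInt_correct.
  - apply Hc.
Qed.

Lemma continuous_comp_R {U : UniformSpace} (f : R -> C) (g : U -> R) (x : U) :
  @continuous U R_UniformSpace g x -> Ccont f (g x) -> @continuous U C_UniformSpace (fun y => f (g y)) x.
Proof. intros Hg Hf. apply (continuous_comp g f); assumption. Qed.

Lemma continuous_Rminus {U : UniformSpace} (f g : U -> R) (x : U) :
  @continuous U R_UniformSpace f x -> @continuous U R_UniformSpace g x ->
  @continuous U R_UniformSpace (fun y => f y - g y) x.
Proof. apply (continuous_minus (V := R_NormedModule)). Qed.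

Lemma dom_bounded_mult (h g : R -> C) (M K d : R) :
  (forall x, Ccont h x) -> (forall x, Cmod (h x) <= M) -> dom K d g -> dom (M * K) d (fun u => h u * g u)%C.
Proof.
  intros Hc Hb Hg. split; [apply Hg|split].
  - intros x. apply continuous_Cmult; [apply Hc | apply Hg].
  - intros x. rewrite Cmod_mult, Rmult_assoc.
    apply Rmult_le_compat; [apply Cmod_ge_0 | apply Cmod_ge_0 | apply Hb | apply Hg].
Qed.

(** * Convolutions, in place of double integrals *)

Section Convolution.
Variables (f g : R -> C) (K d : R).
Hypotheses (Hf : dom K d f) (Hg : dom K d g).

(** From [|s| <= |s - u| + |u|]: half of the decay rate is spent on [s], the other half remains for
    the integration in [u]. *)
Lemma dom_convolution_integrand (s : R) :
  dom (K * K * exp (- (d / 2) * Rabs s)) (d / 2) (fun u => f (s - u) * g u)%C.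
Proof.
  pose proof (dom_K_pos _ _ _ Hf) as HK. destruct Hf as (Hd & Hfc & Hfb), Hg as (_ & Hgc & Hgb).
  split; [lra|split].
  - intros x. apply continuous_Cmult; [|apply Hgc].
    apply (continuous_comp_R f (fun u => s - u)); [|apply Hfc].
    apply continuous_Rminus; [apply continuous_const | apply continuous_id].
  - intros u. rewrite Cmod_mult.
    eapply Rle_trans; [apply Rmult_le_compat; [apply Cmod_ge_0 | apply Cmod_ge_0 | apply Hfb | apply Hgb]|].
    replace (K * exp (- d * Rabs (s - u)) * (K * exp (- d * Rabs u)))
      with (K * K * exp (- d * Rabs (s - u) + - d * Rabs u)) by (rewrite exp_plus; ring).
    replace (K * K * exp (- (d / 2) * Rabs s) * exp (- (d / 2) * Rabs u))
      with (K * K * exp (- (d / 2) * Rabs s + - (d / 2) * Rabs u)) by (rewrite exp_plus; ring).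
    apply Rmult_le_compat_l; [nra|].
    assert (Rabs s <= Rabs (s - u) + Rabs u).
    { replace s with ((s - u) + u) at 1 by ring. apply Rabs_triang. }
    pose proof (Rabs_pos (s - u)).
    assert (L : - d * Rabs (s - u) + - d * Rabs u <= - (d / 2) * Rabs s + - (d / 2) * Rabs u) by nra.
    destruct L as [L|L]; [left; now apply exp_increasing | rewrite L; lra].
Qed.

Lemma continuous_convolution_integrand (s x : R) :
  @continuous (prod_UniformSpace R_UniformSpace R_UniformSpace) C_UniformSpace
    (fun q => f (fst q - snd q) * g (snd q))%C (s, x).
Proof.
  apply continuous_Cmult.
  - apply (continuous_comp_R f (fun q : R * R => fst q - snd q)); [|apply Hf].
    apply (continuous_Rminus (U := prod_UniformSpace R_UniformSpace R_UniformSpace)); [apply continuous_fst | apply continuous_snd].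
  - apply (continuous_comp_R g (fun q : R * R => snd q)); [|apply Hg]. apply continuous_snd.
Qed.

Lemma dom_convolution : dom (4 * (K * K) / d) (d / 2) (fun s => LInt (fun u => f (s - u) * g u)%C).
Proof.
  assert (Hd := proj1 Hf). assert (HK := dom_K_pos _ _ _ Hf). split; [lra|split].
  - intros s. apply (LInt_continuous (P := R_UniformSpace) (fun s u => f (s - u) * g u)%C s (K * K) (d / 2)).
    + intros x. apply continuous_convolution_integrand.
    + apply filter_forall. intros s'. eapply dom_weaken; [apply dom_convolution_integrand| |lra].
      assert (exp (- (d / 2) * Rabs s') <= 1).
      { rewrite <- exp_0. pose proof (Rabs_pos s').
        assert (L : - (d / 2) * Rabs s' <= 0) by nra.
        destruct L as [L|L]; [left; now apply exp_increasing | rewrite L; lra]. }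
      assert (0 <= K * K) by nra. nra.
  - intros s. eapply Rle_trans; [apply (LInt_bound _ _ _ (dom_convolution_integrand s))|].
    right. field. lra.
Qed.

(** Differentiating [s |-> int F(s-u) g(u) du], with [F] a primitive of [f], replaces Fubini's theorem. *)
Lemma LInt_convolution : LInt (fun s => LInt (fun u => f (s - u) * g u)%C) = (LInt f * LInt g)%C.
Proof.
  assert (Hd := proj1 Hf). assert (HK := dom_K_pos _ _ _ Hf). assert (Hfc := proj1 (proj2 Hf)).
  set (Fp := fun y => CInt f 0 y).
  assert (HFp : forall x, is_Cderive Fp x (f x)) by (intros x; apply CInt_is_derive; exact Hfc).
  assert (HFpc : forall x, Ccont Fp x).
  { intros x. apply (ex_derive_continuous (V := C_R_NormedModule)). exists (f x). apply HFp. }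
  assert (Hshift : forall s x, Ccont (fun u => Fp (s - u)) x).
  { intros s x. apply (continuous_comp_R Fp (fun u => s - u)); [|apply HFpc].
    apply continuous_Rminus; [apply continuous_const | apply continuous_id]. }
  assert (HdomF : forall s, dom (2 * K / d * K) d (fun u => Fp (s - u)%R * g u)%C).
  { intros s. apply dom_bounded_mult; auto. intros u. unfold Fp. now apply CInt_bound. }
  (* [Fp] is bounded but does not decay; the decay of [g] alone makes [H] converge. Its derivative
     is the convolution. *)
  set (H := fun s => LInt (fun u => Fp (s - u)%R * g u)%C).
  assert (HH : forall s, is_Cderive H s (LInt (fun u => f (s - u) * g u)%C)).
  { intros s. apply (LInt_is_derive (fun s u => Fp (s - u)%R * g u)%C (fun s u => f (s - u) * g u)%C s
                       (K * K) d (2 * K / d * K) d (mkposreal 1 Rlt_0_1)).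
    - intros; apply HdomF.
    - intros s' _. apply dom_bounded_mult; auto.
      + intros x. apply (continuous_comp_R f (fun u => s' - u)); [|apply Hfc].
        apply continuous_Rminus; [apply continuous_const | apply continuous_id].
      + intros u. eapply Rle_trans; [apply Hf|].
        assert (exp (- d * Rabs (s' - u)) <= 1).
        { rewrite <- exp_0. pose proof (Rabs_pos (s' - u)).
          assert (L : - d * Rabs (s' - u) <= 0) by nra.
          destruct L as [L|L]; [left; now apply exp_increasing | rewrite L; lra]. }
        nra.
    - intros s' u _. eapply is_Cderive_eq; [|apply is_Cderive_mult; [|apply is_Cderive_const]].
      2: { apply (is_derive_comp (V := C_R_NormedModule) Fp (fun s => s - u) s' (f (s' - u)) 1); [apply HFp|].
           auto_derive; auto. }
      rewrite (scal_one (V := C_R_NormedModule)). ring.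
    - intros x. apply continuous_convolution_integrand. }
  assert (Hconv := dom_convolution).
  (* The integral of the convolution over [[- T, T]] is [H T - H (- T)], a single integral in which
     [g u] is weighted by the integral of [f] over a translated window; that weight tends to
     [LInt f]. *)
  apply LInt_eq. apply (filterlim_ext (fun T => LInt (fun u => CInt f (- T - u) (T - u) * g u)%C)).
  - intros T. transitivity (H T - H (- T)%R)%C.
    + unfold H. rewrite <- (LInt_minus _ _ _ _ _ _ (HdomF T) (HdomF (- T))). apply LInt_ext. intros u.
      unfold Fp. rewrite <- (CInt_Chasles f (- T - u) 0 (T - u)), (CInt_swap f 0 (- T - u)) by exact Hfc. ring.
    + symmetry. apply CInt_eq.
      apply (is_RInt_derive (V := C_R_CompleteNormedModule) H); intros x _; [apply HH | apply Hconv].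
  - rewrite <- (LInt_Cmult _ _ _ _ Hg).
    apply (LInt_filterlim (fun T u => CInt f (- T - u) (T - u) * g u)%C _ (2 * K / d * K) d).
    + apply dom_bounded_mult; auto.
      * intros x. apply continuous_const.
      * intros x. now apply LInt_bound.
    + apply filter_forall. intros T. apply dom_bounded_mult; auto.
      * intros x. apply (continuous_ext (fun u => Fp (T - u)%R - Fp (- T - u)%R)%C).
        { intros u. unfold Fp. rewrite <- (CInt_Chasles f (- T - u) 0 (T - u)), (CInt_swap f 0 (- T - u)) by exact Hfc.
          simpl. ring. }
        apply continuous_Cminus; apply Hshift.
      * intros x. now apply CInt_bound.
    + intros A eps.
      destruct (exp_decay_small (2 * K / d * K) d eps Hd (cond_pos eps)) as (B & HB & HB').
      (* For [|u| <= A] and [T > A + B] the translated window still contains [[- B, B]]. *)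
      exists (A + B). intros T HT u Hu.
      replace (CInt f (- T - u) (T - u) * g u - LInt f * g u)%C
        with ((CInt f (- T - u) (T - u) - LInt f) * g u)%C by ring.
      rewrite Cmod_mult. apply Rabs_le_between in Hu.
      assert (E1 : Cmod (CInt f (- T - u) (T - u) - LInt f)%C <= 2 * K / d * exp (- d * B))
        by (apply (LInt_tail f K d B); auto; lra).
      assert (E2 : Cmod (g u) <= K).
      { eapply Rle_trans; [apply Hg|].
        assert (exp (- d * Rabs u) <= 1).
        { rewrite <- exp_0. pose proof (Rabs_pos u).
          assert (L : - d * Rabs u <= 0) by nra.
          destruct L as [L|L]; [left; now apply exp_increasing | rewrite L; lra]. }
        nra. }
      eapply Rle_trans; [apply Rmult_le_compat; [apply Cmod_ge_0 | apply Cmod_ge_0 | exact E1 | exact E2]|].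
      lra.
Qed.

End Convolution.

Lemma exp_le (x y : R) : x <= y -> exp x <= exp y.
Proof. intros [H|H]; [left; now apply exp_increasing | rewrite H; lra]. Qed.

(** ** Remainders of the exponential series *)

Fixpoint Erem (m : nat) (w : R) : R :=
  match m with
  | O => exp (- w)
  | S k => Erem k w - (- w) ^ k / INR (fact k)
  end.

(** [pred 0 = 0] fits the case [m = 0], where the derivative of [exp (- w)] is minus itself. *)
Lemma is_derive_Erem (m : nat) (w : R) : is_derive (Erem m) w (- Erem (pred m) w).
Proof.
  assert (Hpow : forall k, is_derive (fun w => (- w) ^ S k / INR (fact (S k))) w (- ((- w) ^ k / INR (fact k)))).
  { intros k. pose proof (INR_fact_neq_0 k). pose proof (not_0_INR (S k) ltac:(lia)).
    replace (- ((- w) ^ k / INR (fact k))) with (INR (S k) * (-1) * (- w) ^ k / INR (fact (S k))).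
    - apply (is_derive_ext (fun w => / INR (fact (S k)) * (- w) ^ S k)); [intros; simpl; unfold Rdiv; apply Rmult_comm|].
      replace (INR (S k) * (-1) * (- w) ^ k / INR (fact (S k)))
        with (/ INR (fact (S k)) * (INR (S k) * (-1) * (- w) ^ pred (S k))) by (simpl pred; unfold Rdiv; ring).
      apply (is_derive_scal (fun w => (- w) ^ S k)). apply (is_derive_pow (fun w => - w)).
      auto_derive; auto.
    - rewrite fact_simpl, mult_INR. field. auto. }
  induction m as [|m IH].
  - simpl. auto_derive; auto; ring.
  - simpl pred. simpl Erem. destruct m as [|m].
    + simpl. auto_derive; auto. field.
    + replace (- Erem (S m) w) with (- Erem m w - - ((- w) ^ m / INR (fact m))) by (simpl; ring).
      apply (is_derive_minus (V := R_NormedModule) (Erem (S m)) (fun w => (- w) ^ S m / INR (fact (S m)))); auto.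
Qed.

Lemma nonneg_of_derive (f df : R -> R) (x : R) :
  (forall t, is_derive f t (df t)) -> f 0 = 0 -> (forall t, 0 <= t -> 0 <= df t) -> 0 <= x -> 0 <= f x.
Proof.
  intros Hd H0 Hp Hx.
  destruct (MVT_gen f 0 x df) as [c [Hc E]].
  - intros; apply Hd.
  - intros t _. apply continuity_pt_filterlim. apply (ex_derive_continuous (V := R_NormedModule)). now exists (df t).
  - rewrite Rmin_left in Hc by lra. assert (0 <= df c) by (apply Hp; lra). nra.
Qed.

Lemma Erem_S_0 (m : nat) : Erem (S m) 0 = 0.
Proof.
  induction m as [|m IH].
  - simpl. rewrite Ropp_0, exp_0. field.
  - change (Erem (S (S m)) 0) with (Erem (S m) 0 - (- 0) ^ S m / INR (fact (S m))). rewrite IH.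
    rewrite Ropp_0, pow_i by lia. unfold Rdiv. ring.
Qed.

(** By induction: up to sign, the derivative of each remainder is the previous one, and the
    remainders of positive order vanish at 0. *)
Lemma Erem_alternating (m : nat) (w : R) :
  0 <= w -> 0 <= (-1) ^ m * Erem m w <= w ^ m / INR (fact m).
Proof.
  revert w. induction m as [|m IH]; intros w Hw.
  - simpl. pose proof (exp_pos (- w)). assert (exp (- w) <= 1) by (rewrite <- exp_0; apply exp_le; lra). lra.
  - assert (Hder : forall t, is_derive (fun w => (-1) ^ S m * Erem (S m) w) t ((-1) ^ m * Erem m t)).
    { intros t. replace ((-1) ^ m * Erem m t) with ((-1) ^ S m * - Erem (pred (S m)) t) by (simpl; ring).
      apply (is_derive_scal (Erem (S m))), is_derive_Erem. }
    assert (Hpow : forall t, is_derive (fun w => w ^ S m / INR (fact (S m))) t (t ^ m / INR (fact m))).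
    { intros t. pose proof (INR_fact_neq_0 m). pose proof (not_0_INR (S m) ltac:(lia)).
      apply (is_derive_ext (fun w => / INR (fact (S m)) * w ^ S m)); [intros; simpl; unfold Rdiv; apply Rmult_comm|].
      replace (t ^ m / INR (fact m)) with (/ INR (fact (S m)) * (INR (S m) * 1 * t ^ pred (S m))).
      - apply (is_derive_scal (fun w => w ^ S m)). apply (is_derive_pow (fun w => w)). apply (is_derive_id (K := R_AbsRing)).
      - simpl pred. rewrite fact_simpl, mult_INR. field. auto. }
    split.
    + apply (nonneg_of_derive (fun w => (-1) ^ S m * Erem (S m) w) (fun t => (-1) ^ m * Erem m t)); auto.
      * rewrite Erem_S_0; ring.
      * intros t Ht. apply IH, Ht.
    + apply Rminus_le_0.
      apply (nonneg_of_derive (fun w => w ^ S m / INR (fact (S m)) - (-1) ^ S m * Erem (S m) w)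
               (fun t => t ^ m / INR (fact m) - (-1) ^ m * Erem m t)); auto.
      * intros t. apply (is_derive_minus (V := R_NormedModule) (fun w => w ^ S m / INR (fact (S m)))); auto.
      * rewrite Erem_S_0, pow_i by lia. unfold Rdiv. ring.
      * intros t Ht. specialize (IH t Ht). lra.
Qed.

Lemma Rabs_m1_pow (m : nat) (x : R) : Rabs ((-1) ^ m * x) = Rabs x.
Proof. rewrite Rabs_mult, pow_1_abs. ring. Qed.

Lemma Erem_le_pow (m : nat) (w : R) : 0 <= w -> Rabs (Erem m w) <= w ^ m / INR (fact m).
Proof.
  intros Hw. rewrite <- (Rabs_m1_pow m). destruct (Erem_alternating m w Hw). rewrite Rabs_pos_eq; lra.
Qed.

(** The bound for large [w]. With signs made positive, the next remainder is [w ^ m / m!] minus the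
    current one, and [Erem_alternating] says that what is subtracted is nonnegative. *)
Lemma Erem_S_le_pow (m : nat) (w : R) : 0 <= w -> Rabs (Erem (S m) w) <= w ^ m / INR (fact m).
Proof.
  intros Hw. rewrite <- (Rabs_m1_pow (S m)).
  destruct (Erem_alternating (S m) w Hw) as [H _]. destruct (Erem_alternating m w Hw) as [H' _].
  rewrite Rabs_pos_eq by exact H.
  replace ((-1) ^ S m * Erem (S m) w) with (((-1) ^ m * (- w) ^ m) / INR (fact m) - (-1) ^ m * Erem m w)
    by (simpl; unfold Rdiv; ring).
  rewrite <- Rpow_mult_distr. replace (-1 * - w) with w by ring. lra.
Qed.

Lemma exp_nat (n : nat) (u : R) : exp (INR n * u) = exp u ^ n.
Proof.
  induction n; [simpl; now rewrite Rmult_0_l, exp_0|].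
  rewrite S_INR, Rmult_plus_distr_r, exp_plus, IHn, Rmult_1_l. simpl. ring.
Qed.

Lemma pow_le_fact_exp (n : nat) (w : R) : 0 <= w -> w ^ n <= INR (fact n) * exp w.
Proof.
  revert w. induction n as [|n IH]; intros w Hw.
  - simpl. rewrite Rmult_1_l, <- exp_0. now apply exp_le.
  (* The [- 1] makes the function vanish at 0, so that its sign follows from that of its
     derivative. *)
  - assert (H : 0 <= INR (fact (S n)) * (exp w - 1) - w ^ S n).
    { apply (nonneg_of_derive (fun w => INR (fact (S n)) * (exp w - 1) - w ^ S n)
        (fun w => INR (fact (S n)) * exp w - INR (S n) * w ^ n)); auto.
      - intros t. apply (is_derive_minus (V := R_NormedModule) (fun w => INR (fact (S n)) * (exp w - 1))).
        + apply (is_derive_scal (fun w => exp w - 1)). auto_derive; auto; ring.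
        + replace (INR (S n) * t ^ n) with (INR (S n) * 1 * t ^ pred (S n)) by (simpl pred; ring).
          apply (is_derive_pow (fun w => w)). apply (is_derive_id (K := R_AbsRing)).
      - rewrite exp_0, pow_i by lia. ring.
      - intros t Ht. specialize (IH t Ht). rewrite fact_simpl, mult_INR.
        assert (0 <= INR (S n)) by apply pos_INR. nra. }
    pose proof (pos_INR (fact (S n))). lra.
Qed.

(** Exponents [r] for which [|Erem m (exp u)| <= Erem_const m N * exp (r * u)] for all real [u]:
    [Erem m w] decays like [w^m] at [0] and grows like [w^(m-1)] at infinity, except that
    [Erem 0] decays faster than any power at infinity. *)
Definition adm (m N : nat) (r : R) : Prop :=
  match m with O => - INR N <= r <= 0 | S k => INR k <= r <= INR k + 1 end.

Definition Erem_const (m N : nat) : R :=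
  match m with O => INR (fact N) | S k => / INR (fact k) end.

Lemma Erem_const_pos (m N : nat) : 0 < Erem_const m N.
Proof. destruct m; simpl; [|apply Rinv_0_lt_compat]; apply INR_fact_lt_0. Qed.

(** For [u <= 0] the order of vanishing at [w = 0] and the upper limit on [r] decide; for [u > 0],
    the growth of the remainder and the lower limit. For [m = 0] the latter is
    [w ^ N <= N! * exp w]. *)
Lemma Erem_exp_bound (m N : nat) (r u : R) :
  adm m N r -> Rabs (Erem m (exp u)) <= Erem_const m N * exp (r * u).
Proof.
  intros Ha. pose proof (exp_pos u) as Hu. destruct m as [|k]; simpl in Ha.
  - unfold Erem, Erem_const. rewrite Rabs_pos_eq by (left; apply exp_pos).
    assert (Hf : 1 <= INR (fact N)) by (change 1 with (INR 1); apply le_INR, lt_O_fact).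
    destruct (Rle_dec u 0) as [H|H].
    + assert (exp (- exp u) <= 1) by (rewrite <- exp_0; apply exp_le; lra).
      assert (1 <= exp (r * u)) by (rewrite <- exp_0; apply exp_le; nra). nra.
    + assert (E : exp (- exp u) <= INR (fact N) * exp (- INR N * u)).
      { assert (P := pow_le_fact_exp N (exp u) (Rlt_le _ _ Hu)). rewrite <- exp_nat in P.
        rewrite exp_Ropp. replace (- INR N * u) with (- (INR N * u)) by ring. rewrite exp_Ropp.
        pose proof (exp_pos (exp u)). pose proof (exp_pos (INR N * u)).
        apply Rmult_le_reg_r with (exp (exp u) * exp (INR N * u)); [nra|].
        replace (/ exp (exp u) * (exp (exp u) * exp (INR N * u))) with (exp (INR N * u)) by (field; lra).
        replace (INR (fact N) * / exp (INR N * u) * (exp (exp u) * exp (INR N * u)))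
          with (INR (fact N) * exp (exp u)) by (field; lra). exact P. }
      assert (exp (- INR N * u) <= exp (r * u)) by (apply exp_le; nra).
      assert (0 < INR (fact N)) by apply INR_fact_lt_0. nra.
  - simpl Erem_const. pose proof (INR_fact_lt_0 k) as Hk.
    assert (Hk' : 0 < / INR (fact k)) by now apply Rinv_0_lt_compat.
    destruct (Rle_dec u 0) as [H|H].
    + eapply Rle_trans; [apply Erem_le_pow; lra|]. rewrite <- exp_nat.
      assert (exp (INR (S k) * u) <= exp (r * u)) by (apply exp_le; rewrite S_INR; nra).
      assert (/ INR (fact (S k)) <= / INR (fact k)).
      { apply Rinv_le_contravar; [exact Hk|]. apply le_INR. rewrite fact_simpl. nia. }
      pose proof (exp_pos (INR (S k) * u)). unfold Rdiv. rewrite Rmult_comm.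
      assert (0 < / INR (fact (S k))) by (apply Rinv_0_lt_compat, INR_fact_lt_0).
      apply Rmult_le_compat; lra.
    + eapply Rle_trans; [apply Erem_S_le_pow; lra|]. rewrite <- exp_nat.
      assert (exp (INR k * u) <= exp (r * u)) by (apply exp_le; nra).
      unfold Rdiv. rewrite Rmult_comm. apply Rmult_le_compat_l; lra.
Qed.

Lemma continuous_Erem_exp (m : nat) (u : R) : @continuous R_UniformSpace R_UniformSpace (fun u => Erem m (exp u)) u.
Proof.
  apply (continuous_comp exp (Erem m)); [apply continuous_exp|].
  apply (ex_derive_continuous (V := R_NormedModule)). eexists. apply is_derive_Erem.
Qed.

(** ** Euler's integral and its Cauchy-Saalschuetz continuations *)

(** In the variable [s = exp u] this is [Erem m s * s^(c - 1) ds]. *)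
Definition Gam_integrand (m : nat) (c : C) (u : R) : C :=
  (RtoC (Erem m (exp u)) * cexp (c * RtoC u))%C.

Definition Gam (m : nat) (c : C) : C := LInt (Gam_integrand m c).

Definition strip (m : nat) (s : R) : Prop :=
  match m with O => 0 < s | S k => - INR k - 1 < s < - INR k end.

(** An open strip leaves room [d] on both sides, and the same [d] and [N] serve for all nearby
    exponents; this gives the uniform majorant required for continuity in [c]. *)
Lemma strip_adm (m : nat) (s : R) : strip m s ->
  exists d N, 0 < d /\ forall s', Rabs (s' - s) <= d -> adm m N (d - s') /\ adm m N (- d - s').
Proof.
  intros H. destruct m as [|k]; simpl in H.
  - destruct (INR_unbounded (2 * s)) as [N HN].
    exists (s / 2), N. split; [lra|]. intros s' Hs. apply Rabs_le_between in Hs. simpl. split; split; lra.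
  - exists (Rmin (s + INR k + 1) (- INR k - s) / 2), O.
    pose proof (Rmin_l (s + INR k + 1) (- INR k - s)). pose proof (Rmin_r (s + INR k + 1) (- INR k - s)).
    assert (0 < Rmin (s + INR k + 1) (- INR k - s)) by (apply Rmin_pos; lra).
    split; [lra|]. intros s' Hs. apply Rabs_le_between in Hs. simpl. split; split; lra.
Qed.

Lemma Re_mult_RtoC (c : C) (u : R) : Re (c * RtoC u)%C = Re c * u.
Proof. destruct c. simpl. ring. Qed.

Lemma Gam_integrand_dom (m N : nat) (d : R) (c : C) :
  0 < d -> adm m N (d - Re c) -> adm m N (- d - Re c) -> dom (Erem_const m N) d (Gam_integrand m c).
Proof.
  intros Hd H1 H2. split; [exact Hd|split].
  - intros u. apply continuous_Cmult.
    + apply continuous_RtoC. apply continuous_Erem_exp.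
    + apply continuous_cexp. apply continuous_Cmult; [apply continuous_const|].
      apply continuous_RtoC, continuous_id.
  - intros u. unfold Gam_integrand. rewrite Cmod_mult, Cmod_R, Cmod_cexp, Re_mult_RtoC.
    pose proof (exp_pos (Re c * u)).
    destruct (Rle_dec u 0) as [Hu|Hu].
    + rewrite (Rabs_left1 u) by exact Hu.
      eapply Rle_trans; [apply Rmult_le_compat_r; [lra | apply (Erem_exp_bound m N _ u H1)]|].
      rewrite Rmult_assoc, <- exp_plus. right. do 2 f_equal. ring.
    + rewrite (Rabs_pos_eq u) by lra.
      eapply Rle_trans; [apply Rmult_le_compat_r; [lra | apply (Erem_exp_bound m N _ u H2)]|].
      rewrite Rmult_assoc, <- exp_plus. right. do 2 f_equal. ring.
Qed.

Lemma strip_dom (m : nat) (c : C) : strip m (Re c) -> exists K d, dom K d (Gam_integrand m c).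
Proof.
  intros H. destruct (strip_adm m _ H) as (d & N & Hd & Ha).
  destruct (Ha (Re c)) as [H1 H2]; [rewrite Rminus_diag, Rabs_R0; lra|].
  exists (Erem_const m N), d. now apply Gam_integrand_dom.
Qed.

Lemma Gam_continuous (m : nat) (c0 : C) : strip m (Re c0) ->
  filterlim (Gam m) (locally c0) (locally (Gam m c0)).
Proof.
  intros H. destruct (strip_adm m _ H) as (d & N & Hd & Ha).
  apply (LInt_continuous (P := C_UniformSpace) (Gam_integrand m) c0 (Erem_const m N) d).
  - intros x. apply continuous_Cmult.
    + apply continuous_RtoC. apply (continuous_comp (fun q : C * R => snd q) (fun u => Erem m (exp u))).
      * apply continuous_snd.
      * apply continuous_Erem_exp.
    + apply continuous_cexp. apply continuous_Cmult; [apply continuous_fst|].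
      apply continuous_RtoC, continuous_snd.
  - exists (mkposreal d Hd). intros c [Hc _].
    destruct (Ha (Re c)) as [H1 H2]; [left; exact Hc|]. now apply Gam_integrand_dom.
Qed.

Lemma cexp_plus_1_mult (c : C) (u : R) :
  cexp ((c + RtoC 1) * RtoC u)%C = (RtoC (exp u) * cexp (c * RtoC u))%C.
Proof.
  replace ((c + RtoC 1) * RtoC u)%C with (RtoC u + c * RtoC u)%C by ring. now rewrite cexp_add, cexp_R.
Qed.

Lemma strip_pred (m : nat) (s : R) : strip m s -> strip (pred m) (s + 1).
Proof. destruct m as [|[|k]]; cbn -[INR]; rewrite ?S_INR; simpl INR; lra. Qed.

(** Integration by parts: differentiating the remainder lowers its order while the exponent rises by
    1. At [m = 0] this is the usual functional equation of Gamma. *)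
Lemma Gam_recurrence (m : nat) (c : C) : strip m (Re c) ->
  (c * Gam m c)%C = Gam (pred m) (c + RtoC 1)%C.
Proof.
  intros H. destruct (strip_dom m c H) as (K & d & Hdom).
  assert (H' : strip (pred m) (Re (c + RtoC 1)%C)).
  { replace (Re (c + RtoC 1)%C) with (Re c + 1) by (destruct c; simpl; ring). now apply strip_pred. }
  destruct (strip_dom (pred m) _ H') as (K' & d' & Hdom').
  assert (D1 := dom_Cmult c _ _ _ Hdom).
  assert (E := LInt_derivative_0 (Gam_integrand m c)
     (fun u => c * Gam_integrand m c u - Gam_integrand (pred m) (c + RtoC 1) u)%C
     _ _ _ _ (dom_minus _ _ _ _ _ _ D1 Hdom') Hdom).
  rewrite (LInt_minus _ _ _ _ _ _ D1 Hdom'), (LInt_Cmult _ _ _ _ Hdom) in E.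
  fold (Gam m c) (Gam (pred m) (c + RtoC 1)%C) in E.
  assert (E0 : (c * Gam m c - Gam (pred m) (c + RtoC 1) = RtoC 0)%C).
  { apply E. intros u. unfold Gam_integrand. rewrite cexp_plus_1_mult.
    eapply is_Cderive_eq; [|apply is_Cderive_mult; [apply is_Cderive_RtoC | apply is_Cderive_cexp_lin]].
    2: { apply (is_derive_comp (V := R_NormedModule) (Erem m) exp); [apply is_derive_Erem | apply is_derive_exp]. }
    unfold scal; cbn. unfold mult; cbn. rewrite RtoC_mult, RtoC_opp. ring. }
  replace (c * Gam m c)%C with ((c * Gam m c - Gam (pred m) (c + RtoC 1)) + Gam (pred m) (c + RtoC 1))%C by ring.
  rewrite E0. ring.
Qed.

Lemma Gam_1 : Gam 0 (RtoC 1) = RtoC 1.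
Proof.
  destruct (strip_dom 0 (RtoC 1) ltac:(simpl; lra)) as (K & d & Hdom).
  (* Here an explicit primitive exists, with limits -1 and 0 at the two ends. *)
  unfold Gam. rewrite (LInt_derivative (fun u => RtoC (- exp (- exp u))) _ K d (- RtoC 1)%C (RtoC 0) Hdom); [ring| | |].
  - intros u. unfold Gam_integrand. eapply is_Cderive_eq; [|apply is_Cderive_RtoC; auto_derive; auto].
    rewrite Cmult_1_l, cexp_R, <- RtoC_mult. f_equal. simpl. ring.
  - rewrite <- RtoC_opp. apply flim_RtoC.
    replace (- (1)) with (- exp (- 0)) by (rewrite Ropp_0, exp_0; ring).
    apply (filterlim_comp _ _ _ exp (fun w => - exp (- w)) _ (locally 0)); [apply is_lim_exp_m|].
    apply (ex_derive_continuous (V := R_NormedModule) (fun w => - exp (- w))). auto_derive; auto.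
  - apply flim_RtoC. rewrite <- Ropp_0.
    apply (filterlim_comp _ _ _ (fun u => exp (- exp u)) Ropp _ (locally 0)).
    + apply (filterlim_comp _ _ _ (fun u => - exp u) exp _ (Rbar_locally m_infty)); [|apply is_lim_exp_m].
      eapply filterlim_comp; [apply is_lim_exp_p | apply filterlim_Ropp_infty].
    + apply (ex_derive_continuous (V := R_NormedModule) Ropp). auto_derive; auto.
Qed.

Lemma Gam_nat (n : nat) : Gam 0 (RtoC (INR n + 1)) = RtoC (INR (fact n)).
Proof.
  induction n as [|n IH].
  - simpl INR. rewrite Rplus_0_l. apply Gam_1.
  - rewrite S_INR, RtoC_plus.
    change O with (pred 0) at 1. rewrite <- Gam_recurrence by (simpl; pose proof (pos_INR n); lra).
    rewrite IH, <- RtoC_mult. f_equal. rewrite fact_simpl, mult_INR, S_INR. ring.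
Qed.

Lemma Gam_poch (z : C) (n : nat) : 0 < Re z -> Gam 0 (z + RtoC (INR n))%C = (poch z n * Gam 0 z)%C.
Proof.
  intros Hz. induction n as [|n IH]; [simpl; rewrite Cplus_0_r; ring|].
  rewrite S_INR, RtoC_plus, Cplus_assoc.
  change O with (pred 0) at 1. rewrite <- Gam_recurrence.
  - rewrite IH. simpl. ring.
  - destruct z as [a b]; simpl in *. pose proof (pos_INR n). lra.
Qed.

(** * Moments of the Gamma distribution *)

Lemma LInt_le (f : R -> C) (g : R -> R) (K d K' d' : R) :
  dom K d f -> dom K' d' (fun x => RtoC (g x)) -> (forall x, Cmod (f x) <= g x) ->
  Cmod (LInt f) <= Re (LInt (fun x => RtoC (g x))).
Proof.
  intros Hf Hg Hb. apply le_epsilon. intros eps He.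
  assert (L1 := proj1 (filterlim_Cmod _ _) (LInt_flim _ _ _ Hf) (mkposreal (eps / 2) ltac:(lra))).
  assert (L2 := proj1 (filterlim_Cmod _ _) (LInt_flim _ _ _ Hg) (mkposreal (eps / 2) ltac:(lra))).
  assert (L3 : Rbar_locally p_infty (fun T => 0 < T)) by (now exists 0).
  destruct (filter_ex _ (filter_and _ _ L3 (filter_and _ _ L1 L2))) as (T & HT & H1 & H2).
  simpl in H1, H2.
  set (I := LInt f) in *. set (J := LInt (fun x => RtoC (g x))) in *.
  set (i := CInt f (- T) T) in *. set (j := CInt (fun x => RtoC (g x)) (- T) T) in *.
  assert (Hij : Cmod i <= Re j).
  { apply CInt_norm_le with (g := g); [lra | apply Hf | intros; apply Hb |].
    apply (is_RInt_fct_extend_fst (U := R_NormedModule) (V := R_NormedModule) (fun x => RtoC (g x)) (- T) T j).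
    apply CInt_correct, Hg. }
  assert (Cmod I <= Cmod i + eps / 2).
  { replace I with (i + - (i - I))%C by ring.
    eapply Rle_trans; [apply Cmod_triangle|]. rewrite Cmod_opp. lra. }
  assert (Re j <= Re J + eps / 2).
  { assert (A := re_le_Cmod (j - J)%C). assert (E : Re (j - J)%C = Re j - Re J) by (destruct j, J; reflexivity).
    rewrite E in A. apply Rabs_le_between in A. lra. }
  lra.
Qed.

Lemma abs_exp_minus_1 (x : R) : Rabs (exp x - 1) <= Rabs x * (1 + exp x).
Proof.
  assert (H1 : x <= exp x - 1).
  { destruct (Req_dec x 0) as [->|E]; [rewrite exp_0; lra|]. pose proof (exp_ineq1 x E). lra. }
  assert (H2 : - x <= exp (- x) - 1).
  { destruct (Req_dec x 0) as [->|E]; [rewrite Ropp_0, exp_0; lra|]. pose proof (exp_ineq1 (- x) ltac:(lra)). lra. }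
  pose proof (exp_pos x). pose proof (exp_pos (- x)).
  assert (E : exp x * exp (- x) = 1) by (rewrite <- exp_plus, Rplus_opp_r; apply exp_0).
  destruct (Rle_dec 0 x) as [Hx|Hx].
  - rewrite (Rabs_pos_eq x) by exact Hx. rewrite Rabs_pos_eq by lra. nra.
  - rewrite (Rabs_left x) by lra. rewrite Rabs_left1; [nra|].
    assert (exp x <= 1) by (rewrite <- exp_0; apply exp_le; lra). lra.
Qed.

(** The square of the modulus is [2 - 2 * cos y = 4 * sin (y / 2) ^ 2]. *)
Lemma Cmod_cis_minus_1 (y : R) : Cmod ((cos y, sin y) - RtoC 1)%C <= Rabs y.
Proof.
  assert (P : 2 - 2 * cos y <= y * y).
  { assert (Hc : cos y = 1 - 2 * sin (y / 2) * sin (y / 2)).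
    { replace y with (2 * (y / 2)) at 1 by field. rewrite cos_2a_sin. ring. }
    assert (Hs : sin (y / 2) * sin (y / 2) <= (y / 2) * (y / 2)).
    { assert (A : Rabs (sin (y / 2)) <= Rabs (y / 2)).
      { destruct (MVT_gen sin 0 (y / 2) cos) as [c [_ E]].
        - intros; apply is_derive_sin.
        - intros; apply continuity_sin.
        - rewrite sin_0, !Rminus_0_r in E. rewrite E, Rabs_mult.
          assert (Rabs (cos c) <= 1) by (apply Rabs_le; pose proof (COS_bound c); lra).
          pose proof (Rabs_pos (y / 2)). nra. }
      apply Rsqr_le_abs_1 in A. exact A. }
    nra. }
  apply Rsqr_incr_0_var; [|apply Rabs_pos].
  rewrite <- Rsqr_abs. unfold Rsqr.
  replace (Cmod _ * Cmod _) with (Cmod ((cos y, sin y) - RtoC 1)%C ^ 2) by ring.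
  rewrite Cmod2_alt. simpl. pose proof (sin2_cos2 y) as Q. unfold Rsqr in Q. nra.
Qed.

Lemma Cmod_cexp_minus_1 (w : C) : Cmod (cexp w - RtoC 1)%C <= Rabs (Re w) * (1 + exp (Re w)) + Rabs (Im w).
Proof.
  destruct w as [a b]. unfold cexp; simpl.
  replace (exp a * (cos b, sin b) - 1)%C with (RtoC (exp a - 1) * (cos b, sin b) + ((cos b, sin b) - RtoC 1))%C
    by (rewrite RtoC_minus; ring).
  eapply Rle_trans; [apply Cmod_triangle|]. apply Rplus_le_compat; [|apply Cmod_cis_minus_1].
  rewrite Cmod_mult, Cmod_R.
  replace (Cmod (cos b, sin b)) with 1; [rewrite Rmult_1_r; apply abs_exp_minus_1|].
  unfold Cmod; simpl. pose proof (sin2_cos2 b) as Q. unfold Rsqr in Q.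
  replace (cos b * (cos b * 1) + sin b * (sin b * 1)) with 1 by lra. now rewrite sqrt_1.
Qed.

(** With [X = exp L], this bounds [X^z - 1] by [|X - 1|] and powers of [X], and so allows
    Gamma integrals to be compared with their integer moments. *)
Lemma cexp_power_minus_1 (z : C) (M : nat) (L : R) :
  0 <= Re z -> Re z <= INR M ->
  Cmod (cexp (z * RtoC L) - RtoC 1)%C <=
  5 * (1 + Cmod z) * (Rabs (exp L - 1) * (2 + exp L ^ M)).
Proof.
  intros H0 HM. rewrite <- exp_nat.
  set (X := exp L). assert (HX : 0 < X) by apply exp_pos.
  assert (HXM : 0 < exp (INR M * L)) by apply exp_pos.
  assert (HCm : 0 <= Cmod z) by apply Cmod_ge_0.
  assert (HIm : Rabs (Im z) <= Cmod z) by apply im_le_Cmod.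
  assert (HRe : Rabs (Re z) <= Cmod z) by apply re_le_Cmod.
  rewrite Rabs_pos_eq in HRe by exact H0.
  assert (ERe : Re (z * RtoC L)%C = Re z * L) by apply Re_mult_RtoC.
  assert (EIm : Im (z * RtoC L)%C = Im z * L) by (destruct z; simpl; ring).
  (* The main case: [Cmod_cexp_minus_1] gives a bound linear in [L], and [|L|] is comparable to
     [|X - 1|] unless [X] is close to 0. *)
  assert (Small : Rabs L <= 3 * Rabs (X - 1) -> exp (Re z * L) <= 1 + exp (INR M * L) ->
     Cmod (cexp (z * RtoC L) - RtoC 1)%C <= 5 * (1 + Cmod z) * (Rabs (X - 1) * (2 + exp (INR M * L)))).
  { intros HL HE. eapply Rle_trans; [apply Cmod_cexp_minus_1|]. rewrite ERe, EIm, !Rabs_mult.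
    rewrite (Rabs_pos_eq (Re z)) by exact H0.
    set (E := exp (INR M * L)) in *. set (D := Rabs (X - 1)) in *.
    assert (HD : 0 <= D) by apply Rabs_pos. pose proof (Rabs_pos L) as HLp.
    pose proof (Rabs_pos (Im z)). pose proof (exp_pos (Re z * L)).
    assert (A : Re z * Rabs L * (1 + exp (Re z * L)) <= Cmod z * (3 * D) * (2 + E)).
    { apply Rmult_le_compat; [nra | lra | nra | lra]. }
    assert (B : Rabs (Im z) * Rabs L <= Cmod z * (3 * D)).
    { apply Rmult_le_compat; lra. }
    assert (HE0 : 0 < E) by exact HXM.
    assert (P1 : 0 <= Cmod z * D) by nra.
    assert (P2 : 0 <= D * E) by nra.
    assert (P3 : 0 <= Cmod z * D * E) by nra.
    replace (5 * (1 + Cmod z) * (D * (2 + E))) with (10 * D + 5 * (D * E) + 10 * (Cmod z * D) + 5 * (Cmod z * D * E)) by ring.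
    replace (Cmod z * (3 * D) * (2 + E)) with (6 * (Cmod z * D) + 3 * (Cmod z * D * E)) in A by ring.
    replace (Cmod z * (3 * D)) with (3 * (Cmod z * D)) in B by ring. lra. }
  destruct (Rle_dec 0 L) as [HL|HL].
  - apply Small.
    + rewrite Rabs_pos_eq by exact HL.
      assert (L <= X - 1).
      { unfold X. destruct (Req_dec L 0) as [->|E]; [rewrite exp_0; lra|]. pose proof (exp_ineq1 L E). lra. }
      rewrite Rabs_pos_eq by lra. lra.
    + assert (exp (Re z * L) <= exp (INR M * L)) by (apply exp_le; nra). lra.
  - assert (HX1 : X < 1) by (unfold X; rewrite <- exp_0; apply exp_increasing; lra).
    assert (HE : exp (Re z * L) <= 1) by (rewrite <- exp_0; apply exp_le; nra).
    assert (Hinv : X * exp (- L) = 1) by (unfold X; rewrite <- exp_plus, Rplus_opp_r; apply exp_0).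
    (* For [-1 <= L < 0], [- L <= exp (- L) - 1 = exp (- L) * (1 - X)] and [exp 1 <= 3]. For
       [L < -1], [X <= 1/2], so the right-hand side is at least 5 while the left-hand side is at
       most 2. *)
    destruct (Rle_dec (-1) L) as [HL1|HL1].
    + apply Small; [|lra]. rewrite (Rabs_left L), (Rabs_left (X - 1)) by lra.
      assert (- L <= exp (- L) - 1) by (pose proof (exp_ineq1 (- L) ltac:(lra)); lra).
      assert (exp (- L) <= 3).
      { apply Rle_trans with (exp 1); [apply exp_le; lra | apply exp_le_3]. }
      nra.
    + assert (X <= / 2).
      { apply Rle_trans with (exp (Ropp 1)); [unfold X; apply exp_le; lra|].
        rewrite exp_Ropp. apply Rinv_le_contravar; [lra|]. pose proof (exp_ineq1 1 ltac:(lra)). lra. }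
      rewrite (Rabs_left (X - 1)) by lra.
      assert (Cmod (cexp (z * RtoC L) - RtoC 1)%C <= 2).
      { unfold Cminus. eapply Rle_trans; [apply Cmod_triangle|]. rewrite Cmod_opp, Cmod_1, Cmod_cexp, ERe. lra. }
      assert (1 <= - (X - 1) * (2 + exp (INR M * L))) by nra.
      assert (5 * 1 <= 5 * (1 + Cmod z)) by lra.
      assert (5 * 1 * 1 <= 5 * (1 + Cmod z) * (- (X - 1) * (2 + exp (INR M * L))))
        by (apply Rmult_le_compat; lra).
      lra.
Qed.

(** The [j]-th moment of [s / n] under the density [gdens n], as [gmoment_nat] shows. *)
Definition rising (n j : nat) : R := INR (fact (n + j)) / (INR (fact n) * INR n ^ j).

Lemma rising_lim (j : nat) : filterlim (fun n => rising n j) eventually (locally 1).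
Proof.
  induction j as [|j IH].
  - apply (filterlim_ext (fun _ => 1)); [|apply filterlim_const].
    intros n. unfold rising. rewrite Nat.add_0_r. simpl. field. apply INR_fact_neq_0.
  - apply (filterlim_ext_loc (fun n => rising n j * (1 + INR (S j) * / INR n))).
    + exists 1%nat. intros n Hn. unfold rising. rewrite Nat.add_succ_r, fact_simpl, mult_INR.
      replace (S (n + j)) with (n + S j)%nat by lia. rewrite plus_INR. simpl pow.
      pose proof (INR_fact_neq_0 n). assert (INR n <> 0) by (apply not_0_INR; lia).
      assert (INR n ^ j <> 0) by now apply pow_nonzero.
      field. auto.
    + replace 1 with (1 * (1 + INR (S j) * 0)) at 1 by ring.
      apply (is_lim_seq_mult' (fun n => rising n j) (fun n => 1 + INR (S j) * / INR n)); [exact IH|].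
      apply (is_lim_seq_plus' (fun _ => 1) (fun n => INR (S j) * / INR n)); [apply is_lim_seq_const|].
      apply (is_lim_seq_scal_l (fun n => / INR n) (INR (S j)) 0).
      apply (is_lim_seq_inv INR p_infty); [apply is_lim_seq_INR | discriminate].
Qed.

(** The probability density of [u = ln s] when [s] has the Gamma distribution with parameter [n + 1]. *)
Definition gdens (n : nat) (u : R) : R := exp (- exp u) * exp ((INR n + 1) * u) / INR (fact n).

Lemma gdens_pos (n : nat) (u : R) : 0 < gdens n u.
Proof.
  unfold gdens. apply Rdiv_lt_0_compat; [|apply INR_fact_lt_0].
  apply Rmult_lt_0_compat; apply exp_pos.
Qed.

Lemma gdens_integrand (n : nat) (z : C) (u : R) : (0 < n)%nat ->
  (RtoC (gdens n u) * cexp (z * RtoC (u - ln (INR n))))%C =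
  (/ (RtoC (INR (fact n)) * cexp (z * RtoC (ln (INR n)))) * Gam_integrand 0 (z + RtoC (INR n + 1)) u)%C.
Proof.
  intros Hn. unfold gdens, Gam_integrand, Erem, Rdiv.
  rewrite !RtoC_mult, RtoC_inv by apply INR_fact_neq_0.
  replace ((z + RtoC (INR n + 1)) * RtoC u)%C with (z * RtoC u + RtoC ((INR n + 1) * u))%C
    by (rewrite RtoC_mult; ring).
  replace (z * RtoC (u - ln (INR n)))%C with (z * RtoC u + - (z * RtoC (ln (INR n))))%C
    by (rewrite RtoC_minus; ring).
  rewrite !cexp_add, cexp_opp, cexp_R.
  field. split; [apply cexp_neq_0|]. intros E. apply RtoC_inj in E. now apply (INR_fact_neq_0 n).
Qed.

(** The mean of [(s / n)^z], that is [Gamma(z + n + 1) / (n! n^z)]. That it tends to 1 is the link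
    between Euler's integral and the limit defining [rgamma]. *)
Definition gmoment (n : nat) (z : C) : C := LInt (fun u => RtoC (gdens n u) * cexp (z * RtoC (u - ln (INR n))))%C.

Lemma gmoment_dom (n : nat) (z : C) : (0 < n)%nat -> 0 <= Re z ->
  exists K d, dom K d (fun u => RtoC (gdens n u) * cexp (z * RtoC (u - ln (INR n))))%C.
Proof.
  intros Hn Hz. destruct (strip_dom 0 (z + RtoC (INR n + 1))%C) as (K & d & H).
  { destruct z as [a b]; simpl in *. pose proof (pos_INR n). lra. }
  eexists. exists d.
  replace (fun u => _) with (fun u => / (RtoC (INR (fact n)) * cexp (z * RtoC (ln (INR n)))) * Gam_integrand 0 (z + RtoC (INR n + 1)) u)%C.
  - apply dom_Cmult, H.
  - apply functional_extensionality. intros u. now rewrite <- gdens_integrand.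
Qed.

Lemma gmoment_eq (n : nat) (z : C) : (0 < n)%nat -> 0 <= Re z ->
  gmoment n z = (Gam 0 (z + RtoC (INR n + 1)) / (RtoC (INR (fact n)) * cexp (z * RtoC (ln (INR n)))))%C.
Proof.
  intros Hn Hz. destruct (strip_dom 0 (z + RtoC (INR n + 1))%C) as (K & d & H).
  { destruct z as [a b]; simpl in *. pose proof (pos_INR n). lra. }
  unfold gmoment. rewrite (LInt_ext _ _ (fun u => gdens_integrand n z u Hn)), (LInt_Cmult _ _ _ _ H).
  unfold Gam, Cdiv. ring.
Qed.

Lemma gmoment_nat (n j : nat) : (0 < n)%nat -> gmoment n (RtoC (INR j)) = RtoC (rising n j).
Proof.
  intros Hn. rewrite gmoment_eq by (auto; simpl; apply pos_INR).
  rewrite <- RtoC_plus. replace (INR j + (INR n + 1)) with (INR (n + j) + 1) by (rewrite plus_INR; ring).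
  rewrite Gam_nat, <- RtoC_mult, cexp_R, exp_nat, exp_ln by (apply lt_0_INR; lia).
  unfold rising. rewrite <- RtoC_mult, <- RtoC_div; [reflexivity|].
  apply Rmult_integral_contrapositive_currified; [apply INR_fact_neq_0|].
  apply pow_nonzero. apply not_0_INR. lia.
Qed.

Lemma gdens_moment_nat (n j : nat) (u : R) :
  (RtoC (gdens n u) * cexp (RtoC (INR j) * RtoC (u - ln (INR n))))%C = RtoC (gdens n u * exp (u - ln (INR n)) ^ j).
Proof. now rewrite <- RtoC_mult, cexp_R, <- RtoC_mult, exp_nat. Qed.

(** Expansion of the majorant [(k + (X-1)^2/k) (2 + X^M)] of [|X-1| (2 + X^M)] into powers of [X]. *)
Lemma gmoment_bound (n M : nat) (z : C) (k : R) : (0 < n)%nat -> 0 <= Re z -> Re z <= INR M -> 0 < k ->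
  Cmod (gmoment n z - RtoC 1)%C <= 5 * (1 + Cmod z) *
   (k * (2 + rising n M) + (2 * rising n 2 - 4 * rising n 1 + 2
     + rising n (M + 2) - 2 * rising n (M + 1) + rising n M) / k).
Proof.
  intros Hn H0 HM Hk.
  pose (mom := fun j u => (RtoC (gdens n u) * cexp (RtoC (INR j) * RtoC (u - ln (INR n))))%C).
  assert (Dm : forall j, exists K d, dom K d (mom j)) by (intros j; apply gmoment_dom; auto; simpl; apply pos_INR).
  assert (Em : forall j, LInt (mom j) = RtoC (rising n j)) by (intros j; exact (gmoment_nat n j Hn)).
  destruct (gmoment_dom n z Hn H0) as (Kz & dz & Dz).
  destruct (Dm 0%nat) as (K0 & d0 & D0). destruct (Dm 1%nat) as (K1 & d1 & D1).
  destruct (Dm 2%nat) as (K2 & d2 & D2). destruct (Dm M) as (KM & dM & DM).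
  destruct (Dm (M + 1)%nat) as (KM1 & dM1 & DM1). destruct (Dm (M + 2)%nat) as (KM2 & dM2 & DM2).
  assert (E0 : rising n 0 = 1).
  { unfold rising. rewrite Nat.add_0_r. simpl. field. apply INR_fact_neq_0. }
  set (a := 5 * (1 + Cmod z)).
  set (c0 := RtoC (a * (2 * k + 2 / k))). set (c1 := RtoC (a * (- 4 / k))). set (c2 := RtoC (a * (2 / k))).
  set (cM := RtoC (a * (k + / k))). set (cM1 := RtoC (a * (- 2 / k))). set (cM2 := RtoC (a * / k)).
  assert (S1 := dom_plus _ _ _ _ _ _ (dom_Cmult c0 _ _ _ D0) (dom_Cmult c1 _ _ _ D1)).
  assert (S2 := dom_plus _ _ _ _ _ _ S1 (dom_Cmult c2 _ _ _ D2)).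
  assert (S3 := dom_plus _ _ _ _ _ _ S2 (dom_Cmult cM _ _ _ DM)).
  assert (S4 := dom_plus _ _ _ _ _ _ S3 (dom_Cmult cM1 _ _ _ DM1)).
  assert (S5 := dom_plus _ _ _ _ _ _ S4 (dom_Cmult cM2 _ _ _ DM2)).
  pose (G := fun u => a * gdens n u *
     ((k + (exp (u - ln (INR n)) - 1) ^ 2 / k) * (2 + exp (u - ln (INR n)) ^ M))).
  assert (EG : forall u, (c0 * mom 0%nat u + c1 * mom 1%nat u + c2 * mom 2%nat u + cM * mom M u
       + cM1 * mom (M + 1)%nat u + cM2 * mom (M + 2)%nat u)%C = RtoC (G u)).
  { intros u. unfold mom, c0, c1, c2, cM, cM1, cM2, G. rewrite !gdens_moment_nat, <- !RtoC_mult, <- !RtoC_plus.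
    f_equal. rewrite !pow_add. simpl. field. lra. }
  cbv beta in S5. rewrite (functional_extensionality _ _ EG) in S5.
  assert (EI : Re (LInt (fun u => RtoC (G u))) = a * (k * (2 + rising n M) + (2 * rising n 2 - 4 * rising n 1 + 2
     + rising n (M + 2) - 2 * rising n (M + 1) + rising n M) / k)).
  { rewrite <- (LInt_ext _ _ EG).
    rewrite (LInt_plus _ _ _ _ _ _ S4 (dom_Cmult cM2 _ _ _ DM2)), (LInt_plus _ _ _ _ _ _ S3 (dom_Cmult cM1 _ _ _ DM1)),
      (LInt_plus _ _ _ _ _ _ S2 (dom_Cmult cM _ _ _ DM)), (LInt_plus _ _ _ _ _ _ S1 (dom_Cmult c2 _ _ _ D2)),
      (LInt_plus _ _ _ _ _ _ (dom_Cmult c0 _ _ _ D0) (dom_Cmult c1 _ _ _ D1)).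
    rewrite (LInt_Cmult c0 _ _ _ D0), (LInt_Cmult c1 _ _ _ D1), (LInt_Cmult c2 _ _ _ D2),
      (LInt_Cmult cM _ _ _ DM), (LInt_Cmult cM1 _ _ _ DM1), (LInt_Cmult cM2 _ _ _ DM2), !Em, E0.
    unfold c0, c1, c2, cM, cM1, cM2. rewrite <- !RtoC_mult, <- !RtoC_plus. simpl Re. field. lra. }
  fold a. rewrite <- EI.
  replace (gmoment n z - RtoC 1)%C with (LInt (fun u => RtoC (gdens n u) * cexp (z * RtoC (u - ln (INR n))) - mom 0%nat u)%C).
  (* The majorant [G] is integrated exactly by moments; an exponential bound would not see the
     concentration near [X = 1]. *)
  - apply (LInt_le _ G _ _ _ _ (dom_minus _ _ _ _ _ _ Dz D0) S5).
    intros u. unfold mom. simpl INR. rewrite Cmult_0_l, cexp_0.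
    replace (_ - _)%C with (RtoC (gdens n u) * (cexp (z * RtoC (u - ln (INR n))) - RtoC 1))%C by ring.
    rewrite Cmod_mult, Cmod_R, Rabs_pos_eq by (left; apply gdens_pos).
    eapply Rle_trans; [apply Rmult_le_compat_l; [left; apply gdens_pos | apply (cexp_power_minus_1 z M)]; auto|].
    fold a. unfold G.
    replace (gdens n u * (a * (Rabs (exp (u - ln (INR n)) - 1) * (2 + exp (u - ln (INR n)) ^ M))))
      with (a * gdens n u * (Rabs (exp (u - ln (INR n)) - 1) * (2 + exp (u - ln (INR n)) ^ M))) by ring.
    apply Rmult_le_compat_l.
    + apply Rmult_le_pos; [unfold a; pose proof (Cmod_ge_0 z); lra | left; apply gdens_pos].
    + apply Rmult_le_compat_r.
      * pose proof (pow_lt (exp (u - ln (INR n))) M (exp_pos _)). lra.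
      (* [|v| <= k + v^2 / k] follows from [(k - |v|)^2 >= 0]; it trades the absolute value for a
         polynomial. *)
      * set (v := exp (u - ln (INR n)) - 1).
        rewrite <- (pow2_abs v). set (w := Rabs v).
        apply Rmult_le_reg_r with k; [exact Hk|].
        replace ((k + w ^ 2 / k) * k) with (k ^ 2 + w ^ 2) by (field; lra).
        pose proof (Rabs_pos v). fold w in H. pose proof (pow2_ge_0 (k - w)). nra.
  - rewrite (LInt_minus _ _ _ _ _ _ Dz D0). fold (gmoment n z). rewrite Em, E0. reflexivity.
Qed.

(** The variable [s / n] concentrates at 1: all its integer moments tend to 1, so the coefficient of
    [1 / k] in the bound tends to 0 for fixed [k], and [k] is at our disposal. *)
Lemma gmoment_lim (z : C) : 0 <= Re z -> filterlim (fun n => gmoment n z) eventually (locally (RtoC 1)).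
Proof.
  intros Hz. destruct (INR_unbounded (Re z)) as [M HM].
  apply filterlim_Cmod. intros eps. pose proof (cond_pos eps) as He.
  set (a := 5 * (1 + Cmod z)). assert (Ha : 0 < a) by (unfold a; pose proof (Cmod_ge_0 z); lra).
  (* The bound then tends to [3 * a * k = 3 / 8 * eps], which leaves room for an error [eps / 2]. *)
  set (k := eps / (8 * a)). assert (Hk : 0 < k) by (apply Rdiv_lt_0_compat; lra).
  assert (HL : filterlim (fun n => a * (k * (2 + rising n M) + (2 * rising n 2 - 4 * rising n 1 + 2
     + rising n (M + 2) - 2 * rising n (M + 1) + rising n M) / k)) eventually
     (locally (a * (k * (2 + 1) + (2 * 1 - 4 * 1 + 2 + 1 - 2 * 1 + 1) / k)))).
  { assert (Rl := rising_lim).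
    apply (is_lim_seq_scal_l _ a (k * (2 + 1) + (2 * 1 - 4 * 1 + 2 + 1 - 2 * 1 + 1) / k)).
    apply is_lim_seq_plus'.
    - apply (is_lim_seq_scal_l _ k (2 + 1)). apply is_lim_seq_plus'; [apply is_lim_seq_const | apply Rl].
    - apply (is_lim_seq_scal_r _ (/ k) (2 * 1 - 4 * 1 + 2 + 1 - 2 * 1 + 1)).
      apply is_lim_seq_plus'; [|apply Rl].
      apply is_lim_seq_minus'; [|apply (is_lim_seq_scal_l _ 2 1), Rl].
      apply is_lim_seq_plus'; [|apply Rl].
      apply is_lim_seq_plus'; [|apply is_lim_seq_const].
      apply is_lim_seq_minus'; [apply (is_lim_seq_scal_l _ 2 1), Rl | apply (is_lim_seq_scal_l _ 4 1), Rl]. }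
  replace (a * _) with (3 / 8 * eps) in HL by (unfold k; field; lra).
  assert (HE := proj1 (filterlim_locally _ _) HL (pos_div_2 eps)).
  assert (HN : eventually (fun n => (0 < n)%nat)) by (exists 1%nat; intros; lia).
  generalize (filter_and _ _ HN HE). apply filter_imp. intros n [Hn B].
  unfold ball in B; simpl in B; unfold AbsRing_ball, abs, minus, plus, opp in B; simpl in B.
  apply Rabs_def2 in B.
  eapply Rle_lt_trans; [apply (gmoment_bound n M z k Hn Hz ltac:(lra) Hk)|]. fold a. lra.
Qed.

(** ** The reciprocal Gamma function *)

Definition rgamma_seq (z : C) (n : nat) : C :=
  (poch z (S n) / (RtoC (INR (fact n)) * cpow (RtoC (INR n)) z))%C.

Lemma cpow_pos (t : R) (w : C) : 0 < t -> cpow (RtoC t) w = cexp (w * RtoC (ln t))%C.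
Proof.
  intros Ht. unfold cpow. destruct (Ceq_dec (RtoC t) (RtoC 0)) as [E|_].
  - apply RtoC_inj in E. lra.
  - do 2 f_equal. unfold clog. rewrite Cmod_R, Rabs_pos_eq by lra.
    unfold Carg. simpl. destruct (Rlt_dec 0 t); [|lra].
    unfold Rdiv. rewrite Rmult_0_l, atan_0. reflexivity.
Qed.

Definition is_rgamma (z r : C) : Prop := filterlim (rgamma_seq z) eventually (locally r).

Lemma is_rgamma_eq (z r : C) : is_rgamma z r -> rgamma z = r.
Proof. intros H. apply Clim_eq. exact H. Qed.

(** The product [rgamma_seq z n * Gam 0 z] equals [gmoment n z] for positive [n]. The limit 1 gives
    both the value and the fact that Gamma has no zero here. *)
Lemma Gam_is_rgamma (z : C) : 0 < Re z -> Gam 0 z <> RtoC 0 /\ is_rgamma z (/ Gam 0 z)%C.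
Proof.
  intros Hz.
  assert (HL : filterlim (fun n => rgamma_seq z n * Gam 0 z)%C eventually (locally (RtoC 1))).
  { apply (filterlim_ext_loc (fun n => gmoment n z)); [|apply gmoment_lim; lra].
    exists 1%nat. intros n Hn. rewrite gmoment_eq by (try lia; lra).
    unfold rgamma_seq. rewrite cpow_pos by (apply lt_0_INR; lia).
    replace (INR n + 1) with (INR (S n)) by (rewrite S_INR; ring).
    rewrite Gam_poch by exact Hz. unfold Cdiv. ring. }
  assert (Hne : Gam 0 z <> RtoC 0).
  { intros E. apply C1_nz. symmetry. apply (flim_unique (F := eventually) (fun n => rgamma_seq z n * Gam 0 z)%C); [|exact HL].
    rewrite E. apply (filterlim_ext (fun _ => RtoC 0)); [intros; ring | apply filterlim_const]. }
  split; [exact Hne|].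
  assert (H := flim_Cmult _ (fun _ => / Gam 0 z)%C _ _ HL (filterlim_const (/ Gam 0 z)%C)).
  rewrite Cmult_1_l in H. revert H. apply filterlim_ext. intros n. now field.
Qed.

Lemma poch_shift (z : C) (n : nat) : poch z (S n) = (z * poch (z + RtoC 1) n)%C.
Proof.
  induction n as [|n IH]; [simpl; ring|].
  change (poch z (S (S n))) with (poch z (S n) * (z + RtoC (INR (S n))))%C.
  rewrite IH, S_INR, RtoC_plus. simpl. ring.
Qed.

Lemma INR_inv_lim : filterlim (fun n => / INR n) eventually (locally 0).
Proof. apply (is_lim_seq_inv INR p_infty); [apply is_lim_seq_INR | discriminate]. Qed.

(** For positive [n] the two sequences satisfy [rgamma_seq z n = z * rgamma_seq (z + 1) n / (1 + (z
    + 1) / n)] once the denominator is nonzero, so convergence at [z + 1] propagates to [z]. *)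
Lemma is_rgamma_step (z r : C) : is_rgamma (z + RtoC 1)%C r -> is_rgamma z (z * r)%C.
Proof.
  intros H.
  assert (Hq : filterlim (fun n => RtoC 1 + (z + RtoC 1) * RtoC (/ INR n))%C eventually (locally (RtoC 1))).
  { assert (E := flim_Cplus _ _ _ _ (filterlim_const (RtoC 1))
      (flim_Cmult _ _ _ _ (filterlim_const (z + RtoC 1)%C) (flim_RtoC _ _ INR_inv_lim))).
    replace (RtoC 1 + (z + RtoC 1) * RtoC 0)%C with (RtoC 1) in E by ring. exact E. }
  unfold is_rgamma. replace (z * r)%C with (z * r / RtoC 1)%C by (field; apply C1_nz).
  assert (HQne : eventually (fun n => (RtoC 1 + (z + RtoC 1) * RtoC (/ INR n))%C <> RtoC 0)).
  { generalize (proj1 (filterlim_Cmod _ _) Hq (mkposreal 1 Rlt_0_1)). apply filter_imp.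
    intros n Hn E. rewrite E in Hn. simpl in Hn.
    replace (RtoC 0 - RtoC 1)%C with (- RtoC 1)%C in Hn by ring. rewrite Cmod_m1 in Hn. lra. }
  apply (filterlim_ext_loc (fun n => z * rgamma_seq (z + RtoC 1) n / (RtoC 1 + (z + RtoC 1) * RtoC (/ INR n)))%C).
  - assert (HN : eventually (fun n => (0 < n)%nat)) by (exists 1%nat; intros; lia).
    generalize (filter_and _ _ HN HQne). apply filter_imp. intros n [Hn Hne].
    assert (HnR : INR n <> 0) by (apply not_0_INR; lia).
    unfold rgamma_seq. rewrite !cpow_pos by (apply lt_0_INR; lia).
    rewrite (poch_shift z n).
    change (poch (z + RtoC 1) (S n)) with (poch (z + RtoC 1) n * (z + RtoC 1 + RtoC (INR n)))%C.
    replace ((z + RtoC 1) * RtoC (ln (INR n)))%C with (z * RtoC (ln (INR n)) + RtoC (ln (INR n)))%C by ring.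
    rewrite cexp_add, cexp_R, exp_ln by (apply lt_0_INR; lia).
    rewrite RtoC_inv in Hne |- * by exact HnR.
    assert (HnC : RtoC (INR n) <> RtoC 0) by (intros E; apply RtoC_inj in E; auto).
    assert (HfC : RtoC (INR (fact n)) <> RtoC 0) by (intros E; apply RtoC_inj in E; now apply (INR_fact_neq_0 n)).
    pose proof (cexp_neq_0 (z * RtoC (ln (INR n)))%C).
    field. repeat split; auto.
    intros E. apply Hne. replace (RtoC 1 + (z + RtoC 1) * / RtoC (INR n))%C
       with ((RtoC (INR n) + z + RtoC 1) / RtoC (INR n))%C by (field; auto).
    replace (RtoC (INR n) + z + RtoC 1)%C with (RtoC (INR n) + (z + RtoC 1))%C by ring. rewrite E. field. auto.
  - apply flim_Cdiv; [apply C1_nz | | exact Hq]. apply flim_Cmult; [apply filterlim_const | exact H].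
Qed.

(** Convergence on the right half-plane spreads to the whole plane one unit at a time; only then is
    [rgamma] known to be a genuine limit everywhere. *)
Lemma rgamma_correct (z : C) : is_rgamma z (rgamma z).
Proof.
  assert (Main : forall n z, - INR n < Re z -> exists r, is_rgamma z r).
  { induction n as [|n IH]; intros w Hw.
    - exists (/ Gam 0 w)%C. apply Gam_is_rgamma. simpl in Hw. lra.
    - destruct (IH (w + RtoC 1)%C) as [r Hr].
      + destruct w as [a b]. cbn -[INR] in *. rewrite S_INR in Hw. lra.
      + exists (w * r)%C. now apply is_rgamma_step. }
  destruct (INR_unbounded (- Re z)) as [n Hn].
  destruct (Main n z ltac:(lra)) as [r Hr]. now rewrite (is_rgamma_eq z r Hr).
Qed.

Lemma rgamma_step (z : C) : rgamma z = (z * rgamma (z + RtoC 1))%C.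
Proof. apply is_rgamma_eq, is_rgamma_step, rgamma_correct. Qed.

Lemma rgamma_poch (z : C) (n : nat) : rgamma z = (poch z n * rgamma (z + RtoC (INR n)))%C.
Proof.
  induction n as [|n IH]; [simpl; rewrite Cplus_0_r; ring|].
  rewrite IH, (rgamma_step (z + RtoC (INR n))%C), S_INR, RtoC_plus, Cplus_assoc. simpl. ring.
Qed.

(** The subtracted integrals continue Gamma to the left: both sides obey the same recurrence, and
    the induction ends in the half-plane of Euler's integral. *)
Lemma rgamma_Gam (m : nat) (c : C) : strip m (Re c) -> (rgamma c * Gam m c)%C = RtoC 1.
Proof.
  revert c. induction m as [|m IH]; intros c Hc.
  - destruct (Gam_is_rgamma c Hc) as [H1 H2]. rewrite (is_rgamma_eq _ _ H2). field. exact H1.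
  - rewrite rgamma_step. replace (c * rgamma (c + RtoC 1) * Gam (S m) c)%C
      with (rgamma (c + RtoC 1) * (c * Gam (S m) c))%C by ring.
    rewrite Gam_recurrence by exact Hc. apply IH.
    replace (Re (c + RtoC 1)%C) with (Re c + 1) by (destruct c; simpl; ring). now apply (strip_pred (S m)).
Qed.

Lemma rgamma_continuous (z0 : C) : filterlim rgamma (locally z0) (locally (rgamma z0)).
Proof.
  destruct (INR_unbounded (- Re z0)) as [n Hn].
  (* Locally, [rgamma] is a polynomial divided by a continuous nonvanishing Euler integral. *)
  assert (Hs : forall z, (- INR n < Re z) -> rgamma z = (poch z n * / Gam 0 (z + RtoC (INR n)))%C).
  { intros z Hz. rewrite (rgamma_poch z n). f_equal.
    apply is_rgamma_eq, Gam_is_rgamma. destruct z; simpl in *; lra. }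
  assert (H0 : 0 < Re (z0 + RtoC (INR n))%C) by (destruct z0; simpl in *; lra).
  rewrite (Hs z0) by lra.
  apply (filterlim_ext_loc (fun z => poch z n * / Gam 0 (z + RtoC (INR n)))%C).
  - assert (Hp : 0 < Re z0 + INR n) by lra. exists (mkposreal _ Hp). intros z [Hz _].
    symmetry. apply Hs.
    unfold ball in Hz; simpl in Hz; unfold AbsRing_ball, abs, minus, plus, opp in Hz; simpl in Hz.
    apply Rabs_def2 in Hz. unfold Re in *. lra.
  - apply flim_Cmult; [apply flim_poch, filterlim_id|].
    apply flim_Cinv; [now apply Gam_is_rgamma|].
    apply (filterlim_comp _ _ _ (fun z => z + RtoC (INR n))%C (Gam 0) _ (locally (z0 + RtoC (INR n))%C)).
    + apply flim_Cplus; [apply filterlim_id | apply filterlim_const].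
    + apply (Gam_continuous 0). exact H0.
Qed.

Lemma rgamma_nat (n : nat) : rgamma (RtoC (INR n + 1)) = RtoC (/ INR (fact n)).
Proof.
  assert (H := rgamma_Gam 0 (RtoC (INR n + 1)) ltac:(simpl; pose proof (pos_INR n); lra)).
  rewrite Gam_nat in H. rewrite RtoC_inv by apply INR_fact_neq_0.
  apply (Cmult_reg_r _ _ (RtoC (INR (fact n)))); [intros E; apply RtoC_inj in E; now apply (INR_fact_neq_0 n)|].
  rewrite H. symmetry. apply Cinv_l. intros E; apply RtoC_inj in E; now apply (INR_fact_neq_0 n).
Qed.

(** * Complex sine and cosine *)

Lemma Ci_sqr : (Defs.Ci * Defs.Ci)%C = (- RtoC 1)%C.
Proof. unfold Defs.Ci, Cmult, Copp, RtoC; simpl. f_equal; ring. Qed.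

Lemma Ci_neq_0 : Defs.Ci <> RtoC 0.
Proof. intros E. injection E. lra. Qed.

Lemma RtoC_neq_0 (x : R) : x <> 0 -> RtoC x <> RtoC 0.
Proof. intros H E. now apply RtoC_inj in E. Qed.

Lemma C2_neq_0 : RtoC 2 <> RtoC 0.
Proof. apply RtoC_neq_0. lra. Qed.

Ltac nz := repeat split; auto using Ci_neq_0, C2_neq_0, C1_nz.

Lemma csin_0 : csin (RtoC 0) = RtoC 0.
Proof.
  unfold csin. rewrite Cmult_0_r, Copp_0, cexp_0. field; nz.
Qed.

Lemma ccos_0 : ccos (RtoC 0) = RtoC 1.
Proof. unfold ccos. rewrite Cmult_0_r, Copp_0, cexp_0. field; nz. Qed.

Lemma is_Cderive_csin (c : C) (t : R) :
  is_Cderive (fun t => csin (c * RtoC t)%C) t (c * ccos (c * RtoC t))%C.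
Proof.
  unfold csin, ccos, Cdiv.
  apply (is_Cderive_ext (fun t => / (RtoC 2 * Defs.Ci) *
     (cexp ((Defs.Ci * c) * RtoC t) - cexp ((- (Defs.Ci * c)) * RtoC t)))%C).
  { intros s. rewrite Cmult_comm. do 3 f_equal; ring. }
  eapply is_Cderive_eq; [|apply is_Cderive_Cmult, is_Cderive_minus; apply is_Cderive_cexp_lin].
  replace (Defs.Ci * (c * RtoC t))%C with (Defs.Ci * c * RtoC t)%C by ring.
  replace (- (Defs.Ci * c) * RtoC t)%C with (- (Defs.Ci * c * RtoC t))%C by ring.
  field; nz.
Qed.

Lemma is_Cderive_ccos (c : C) (t : R) :
  is_Cderive (fun t => ccos (c * RtoC t)%C) t (- c * csin (c * RtoC t))%C.
Proof.
  unfold csin, ccos, Cdiv.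
  apply (is_Cderive_ext (fun t => / (RtoC 2) *
     (cexp ((Defs.Ci * c) * RtoC t) + cexp ((- (Defs.Ci * c)) * RtoC t)))%C).
  { intros s. rewrite Cmult_comm. do 3 f_equal; ring. }
  eapply is_Cderive_eq; [|apply is_Cderive_Cmult, is_Cderive_plus; apply is_Cderive_cexp_lin].
  replace (Defs.Ci * (c * RtoC t))%C with (Defs.Ci * c * RtoC t)%C by ring.
  replace (- (Defs.Ci * c) * RtoC t)%C with (- (Defs.Ci * c * RtoC t))%C by ring.
  set (P := cexp _). set (Q := cexp _).
  transitivity ((Defs.Ci * Defs.Ci) * c * (P - Q) / (RtoC 2 * Defs.Ci))%C.
  - field; nz.
  - rewrite Ci_sqr. field; nz.
Qed.

(** This form shows the double zero at 0, from which the quadratic bound follows. *)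
Lemma ccos_minus_1 (w : C) : (ccos w - RtoC 1)%C =
  (/ RtoC 2 * cexp (- (Defs.Ci * w)) * ((cexp (Defs.Ci * w) - RtoC 1) * (cexp (Defs.Ci * w) - RtoC 1)))%C.
Proof.
  unfold ccos. rewrite cexp_opp. pose proof (cexp_neq_0 (Defs.Ci * w)%C). field; nz.
Qed.

Lemma Cmod_RCi (w : C) : Cmod (Defs.Ci * w)%C = Cmod w.
Proof. rewrite Cmod_mult. change Defs.Ci with Complex.Ci. rewrite Cmod_Ci. ring. Qed.

Lemma ccos_minus_1_bound (w : C) (B : R) : Cmod w <= B ->
  Cmod (ccos w - RtoC 1)%C <= (exp B * (2 + exp B) ^ 2) * Cmod w ^ 2.
Proof.
  intros HB. rewrite ccos_minus_1, !Cmod_mult.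
  assert (H1 : Cmod (cexp (Defs.Ci * w) - RtoC 1)%C <= (2 + exp B) * Cmod w).
  { eapply Rle_trans; [apply Cmod_cexp_minus_1|].
    pose proof (re_le_Cmod (Defs.Ci * w)%C) as R1. pose proof (im_le_Cmod (Defs.Ci * w)%C) as R2.
    rewrite Cmod_RCi in R1, R2. pose proof (Rle_abs (Re (Defs.Ci * w)%C)).
    assert (exp (Re (Defs.Ci * w)%C) <= exp B) by (apply exp_le; lra).
    pose proof (Rabs_pos (Re (Defs.Ci * w)%C)). pose proof (exp_pos (Re (Defs.Ci * w)%C)).
    pose proof (Cmod_ge_0 w). nra. }
  assert (H2 : Cmod (cexp (- (Defs.Ci * w))%C) <= exp B).
  { rewrite Cmod_cexp. apply exp_le.
    pose proof (re_le_Cmod (- (Defs.Ci * w))%C) as R1. rewrite Cmod_opp, Cmod_RCi in R1.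
    pose proof (Rle_abs (Re (- (Defs.Ci * w))%C)). lra. }
  assert (H3 : Cmod (/ RtoC 2) <= 1).
  { rewrite Cmod_inv by apply C2_neq_0. rewrite Cmod_R, Rabs_pos_eq by lra. lra. }
  pose proof (Cmod_ge_0 (cexp (Defs.Ci * w) - RtoC 1)%C). pose proof (Cmod_ge_0 w).
  pose proof (Cmod_ge_0 (cexp (- (Defs.Ci * w))%C)). pose proof (Cmod_ge_0 (/ RtoC 2)%C).
  replace (exp B * (2 + exp B) ^ 2 * Cmod w ^ 2) with
    (1 * exp B * (((2 + exp B) * Cmod w) * ((2 + exp B) * Cmod w))) by ring.
  apply Rmult_le_compat; [nra | nra | | nra].
  apply Rmult_le_compat; lra.
Qed.

(** ** The sine product, from the Wallis-type integrals [int_0^(pi/2) cos(2zt) cos(t)^(2N) dt] *)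

Definition Wallis (z : C) (N : nat) : C :=
  CInt (fun t => ccos (RtoC 2 * z * RtoC t) * RtoC (cos t ^ (2 * N)))%C 0 (PI / 2).

Lemma continuous_of_Cderive (f : R -> C) (x : R) (l : C) : is_Cderive f x l -> Ccont f x.
Proof. intros H. apply (ex_derive_continuous (V := C_R_NormedModule)). now exists l. Qed.

Lemma continuous_ccos_lin (c : C) (t : R) : Ccont (fun t => ccos (c * RtoC t)%C) t.
Proof. eapply continuous_of_Cderive, is_Cderive_ccos. Qed.

Lemma is_derive_cos_pow (n : nat) (t : R) : is_derive (fun t => cos t ^ n) t (- INR n * cos t ^ pred n * sin t).
Proof.
  replace (- INR n * cos t ^ pred n * sin t) with (INR n * - sin t * cos t ^ pred n) by ring.
  apply (is_derive_pow cos), is_derive_cos.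
Qed.

Lemma continuous_cos_pow (n : nat) (t : R) : Ccont (fun t => RtoC (cos t ^ n)) t.
Proof.
  apply continuous_RtoC. apply (ex_derive_continuous (V := R_NormedModule)).
  eexists. apply is_derive_cos_pow.
Qed.

Lemma continuous_Wallis_integrand (z : C) (N : nat) (t : R) :
  Ccont (fun t => ccos (RtoC 2 * z * RtoC t) * RtoC (cos t ^ (2 * N)))%C t.
Proof. apply continuous_Cmult; [apply continuous_ccos_lin | apply continuous_cos_pow]. Qed.

Lemma Wallis_rec (z : C) (N : nat) :
  (RtoC (INR (2 * N + 2)) * RtoC (INR (2 * N + 1)) * Wallis z N)%C =
  ((RtoC (INR (2 * N + 2)) * RtoC (INR (2 * N + 2)) - RtoC 4 * z * z) * Wallis z (S N))%C.
Proof.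
  set (c := (RtoC 2 * z)%C). set (a := RtoC (INR (2 * N + 2))). set (b := RtoC (INR (2 * N + 1))).
  (* Two integrations by parts are condensed into this primitive. It vanishes at both ends: through
     the sines at 0, through [cos] at [PI / 2]. *)
  pose (A := fun t => (- c * csin (c * RtoC t) * RtoC (cos t ^ (2 * S N))
     + a * (ccos (c * RtoC t) * RtoC (cos t ^ (2 * N + 1) * sin t)))%C).
  assert (HA : forall t, is_Cderive A t (- (a * b) * (ccos (c * RtoC t) * RtoC (cos t ^ (2 * N)))
     + (a * a - c * c) * (ccos (c * RtoC t) * RtoC (cos t ^ (2 * S N))))%C).
  { intros t. eapply is_Cderive_eq; [|apply is_Cderive_plus].
    2: { apply is_Cderive_mult; [apply is_Cderive_Cmult, is_Cderive_csin|].
         apply is_Cderive_RtoC, is_derive_cos_pow. }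
    2: { apply is_Cderive_Cmult. apply is_Cderive_mult; [apply is_Cderive_ccos|].
         apply is_Cderive_RtoC. apply (is_derive_mult (K := R_AbsRing) (fun t => cos t ^ (2 * N + 1)) sin);
           [apply is_derive_cos_pow | apply is_derive_sin | intros; apply Rmult_comm]. }
    cbv beta. unfold plus, mult; cbn -[Nat.mul Nat.add INR pow].
    replace (pred (2 * S N)) with (2 * N + 1)%nat by lia.
    replace (pred (2 * N + 1)) with (2 * N)%nat by lia.
    replace (2 * S N)%nat with (2 * N + 2)%nat by lia.
    rewrite !pow_add. simpl (cos t ^ 1). simpl (cos t ^ 2).
    set (C0 := cos t ^ (2 * N)). set (s := sin t). set (k := cos t).
    assert (Hs : s * s = 1 - k * k) by (unfold s, k; pose proof (sin2_cos2 t) as Q; unfold Rsqr in Q; lra).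
    rewrite !RtoC_plus, !RtoC_mult, RtoC_opp.
    rewrite !RtoC_opp. fold a b.
    assert (HsC : (RtoC s * RtoC s = RtoC 1 - RtoC k * RtoC k)%C) by (rewrite <- !RtoC_mult, <- RtoC_minus; now f_equal).
    replace a with (b + RtoC 1)%C by (unfold a, b; rewrite <- RtoC_plus; f_equal; rewrite !plus_INR; simpl; ring).
    ring [HsC]. }
  assert (HI : is_CInt (fun t => - (a * b) * (ccos (c * RtoC t) * RtoC (cos t ^ (2 * N)))
     + (a * a - c * c) * (ccos (c * RtoC t) * RtoC (cos t ^ (2 * S N))))%C 0 (PI / 2)
     (- (a * b) * Wallis z N + (a * a - c * c) * Wallis z (S N))%C).
  { apply is_CInt_plus; apply is_CInt_Cmult; apply (CInt_correct _ 0 (PI / 2));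
      intros x; apply continuous_Wallis_integrand. }
  assert (HI2 : is_CInt (fun t => - (a * b) * (ccos (c * RtoC t) * RtoC (cos t ^ (2 * N)))
     + (a * a - c * c) * (ccos (c * RtoC t) * RtoC (cos t ^ (2 * S N))))%C 0 (PI / 2)
     (A (PI / 2)%R - A 0%R)%C).
  { apply (is_RInt_derive (V := C_R_CompleteNormedModule) A); intros t _; [apply HA|].
    apply continuous_Cplus; (apply continuous_Cmult; [apply continuous_const | apply continuous_Wallis_integrand]). }
  apply CInt_eq in HI. apply CInt_eq in HI2. rewrite HI in HI2.
  assert (A0 : A 0 = RtoC 0).
  { unfold A. rewrite sin_0, Rmult_0_r, !Cmult_0_r, csin_0. ring. }
  assert (A1 : A (PI / 2) = RtoC 0).
  { unfold A. rewrite cos_PI2, !pow_i by lia. rewrite Rmult_0_l. ring. }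
  rewrite A0, A1 in HI2.
  assert (E : (a * b * Wallis z N)%C = ((a * a - c * c) * Wallis z (S N) -
     (- (a * b) * Wallis z N + (a * a - c * c) * Wallis z (S N)))%C) by ring.
  rewrite E, HI2. replace (RtoC 4) with (RtoC 2 * RtoC 2)%C by (rewrite <- RtoC_mult; f_equal; ring). unfold c. ring.
Qed.

Definition wallis (N : nat) : R := RInt (fun t => cos t ^ (2 * N)) 0 (PI / 2).

Lemma is_RInt_wallis (N : nat) : is_RInt (fun t => cos t ^ (2 * N)) 0 (PI / 2) (wallis N).
Proof.
  apply (RInt_correct (V := R_CompleteNormedModule)). apply (ex_RInt_continuous (V := R_CompleteNormedModule)).
  intros x _. apply (ex_derive_continuous (V := R_NormedModule)). eexists. apply is_derive_cos_pow.
Qed.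

Lemma Wallis_0 (N : nat) : Wallis (RtoC 0) N = RtoC (wallis N).
Proof.
  apply CInt_eq. apply (is_RInt_ext (V := C_R_NormedModule) (fun t => RtoC (cos t ^ (2 * N)))).
  - intros x _. rewrite Cmult_0_r, Cmult_0_l, ccos_0, Cmult_1_l. reflexivity.
  - apply (is_RInt_fct_extend_pair (U := R_NormedModule) (V := R_NormedModule)).
    + apply is_RInt_wallis.
    + assert (H := is_RInt_const (V := R_NormedModule) 0 (PI / 2) zero).
      rewrite (scal_zero_r (V := R_NormedModule)) in H. exact H.
Qed.

Lemma wallis_rec (N : nat) : INR (2 * N + 1) * wallis N = INR (2 * N + 2) * wallis (S N).
Proof.
  assert (H := Wallis_rec (RtoC 0) N). rewrite !Wallis_0, Cmult_0_r in H.
  replace (RtoC (INR (2 * N + 2)) * RtoC (INR (2 * N + 2)) - RtoC 0)%C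
    with (RtoC (INR (2 * N + 2)) * RtoC (INR (2 * N + 2)))%C in H by ring.
  rewrite <- !RtoC_mult in H. apply RtoC_inj in H.
  assert (INR (2 * N + 2) <> 0) by (apply not_0_INR; lia).
  apply Rmult_eq_reg_l with (INR (2 * N + 2)); [lra | assumption].
Qed.

Lemma wallis_pos (N : nat) : 0 < wallis N.
Proof.
  induction N as [|N IH].
  - unfold wallis. rewrite (is_RInt_unique _ _ _ (scal (PI / 2 - 0) 1)) by apply (is_RInt_const (V := R_NormedModule)).
    unfold scal; cbn; unfold mult; cbn. pose proof PI_RGT_0. lra.
  - assert (H := wallis_rec N).
    assert (0 < INR (2 * N + 1)) by (apply lt_0_INR; lia).
    assert (0 < INR (2 * N + 2)) by (apply lt_0_INR; lia). nra.
Qed.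

Lemma mul_cos_le_sin (t : R) : 0 <= t <= PI / 2 -> t * cos t <= sin t.
Proof.
  intros [H1 H2].
  destruct (MVT_gen (fun t => sin t - t * cos t) 0 t (fun t => t * sin t)) as [c [Hc E]].
  - intros x _. auto_derive; auto. ring.
  - intros x _. apply continuity_pt_filterlim. apply (ex_derive_continuous (V := R_NormedModule) (fun t => sin t - t * cos t)).
    auto_derive; auto.
  - rewrite Rmin_left, Rmax_right in Hc by lra. rewrite sin_0, cos_0 in E.
    assert (0 <= sin c) by (apply sin_ge_0; pose proof PI_RGT_0; lra).
    assert (0 <= c * sin c * (t - 0)) by (apply Rmult_le_pos; [apply Rmult_le_pos|]; lra). lra.
Qed.

(** [cos (2zt) - 1] is [O(t^2)], and [t * cos t <= sin t] gives [t^2 cos^(2N+2) <= sin^2 cos^(2N) =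
    cos^(2N) - cos^(2N+2)]. The integral of the latter is [wallis N - wallis (S N)], which the
    recurrence evaluates as [wallis (S N) / (2N + 1)]. *)
Lemma Wallis_ratio_bound (z : C) : exists K, forall N,
  Cmod (Wallis z (S N) / RtoC (wallis (S N)) - RtoC 1)%C <= K / INR (2 * N + 1).
Proof.
  set (c := (RtoC 2 * z)%C). set (B := Cmod c * (PI / 2)).
  set (M := exp B * (2 + exp B) ^ 2 * Cmod c ^ 2).
  exists M. intros N. pose proof (wallis_pos (S N)) as Hw. pose proof PI_RGT_0 as HPI.
  assert (HM : 0 <= M).
  { unfold M. pose proof (exp_pos B). pose proof (Cmod_ge_0 c). apply Rmult_le_pos; [|nra].
    apply Rmult_le_pos; [lra | apply pow2_ge_0]. }
  assert (HwC : RtoC (wallis (S N)) <> RtoC 0) by (apply RtoC_neq_0; lra).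
  replace (Wallis z (S N) / RtoC (wallis (S N)) - RtoC 1)%C
    with ((Wallis z (S N) + (- RtoC 1) * Wallis (RtoC 0) (S N)) / RtoC (wallis (S N)))%C
    by (rewrite Wallis_0; field; auto).
  rewrite Cmod_div, Cmod_R, (Rabs_pos_eq (wallis (S N))) by (auto; lra).
  assert (HI : CInt (fun t : R => ccos (RtoC 2 * z * RtoC t) * RtoC (cos t ^ (2 * S N)) +
      - RtoC 1 * (ccos (RtoC 2 * RtoC 0 * RtoC t) * RtoC (cos t ^ (2 * S N))))%C 0 (PI / 2)
      = (Wallis z (S N) + - RtoC 1 * Wallis (RtoC 0) (S N))%C).
  { apply CInt_eq, is_CInt_plus; [|apply is_CInt_Cmult]; apply (CInt_correct _ 0 (PI / 2));
      intros x; apply continuous_Wallis_integrand. }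
  rewrite <- HI. clear HI.
  assert (Hle : Cmod (CInt (fun t : R =>
     ccos (RtoC 2 * z * RtoC t) * RtoC (cos t ^ (2 * S N)) +
      - RtoC 1 * (ccos (RtoC 2 * RtoC 0 * RtoC t) * RtoC (cos t ^ (2 * S N))))%C 0 (PI / 2)) <= M * (wallis N - wallis (S N))).
  { apply CInt_norm_le with (g := fun t => M * (cos t ^ (2 * N) - cos t ^ (2 * S N))).
    - lra.
    - intros x. apply continuous_Cplus; [|apply continuous_Cmult; [apply continuous_const|]];
        apply continuous_Wallis_integrand.
    - intros t Ht. fold c.
      replace (RtoC 2 * RtoC 0 * RtoC t)%C with (RtoC 0) by ring. rewrite ccos_0.
      replace (ccos (c * RtoC t) * RtoC (cos t ^ (2 * S N)) + - RtoC 1 * (RtoC 1 * RtoC (cos t ^ (2 * S N))))%C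
        with ((ccos (c * RtoC t) - RtoC 1) * RtoC (cos t ^ (2 * S N)))%C by ring.
      assert (Hcos : 0 <= cos t) by (apply cos_ge_0; lra).
      rewrite Cmod_mult, Cmod_R, (Rabs_pos_eq (cos t ^ _)) by (apply pow_le; lra).
      assert (Hct : Cmod (c * RtoC t)%C = Cmod c * t) by (rewrite Cmod_mult, Cmod_R, Rabs_pos_eq; lra).
      assert (Hb := ccos_minus_1_bound (c * RtoC t)%C B).
      rewrite Hct in Hb. specialize (Hb ltac:(unfold B; pose proof (Cmod_ge_0 c); nra)).
      replace (exp B * (2 + exp B) ^ 2 * (Cmod c * t) ^ 2) with (M * t ^ 2) in Hb by (unfold M; ring).
      assert (Hcp : 0 <= cos t ^ (2 * S N)) by (apply pow_le; lra).
      eapply Rle_trans; [apply Rmult_le_compat_r; [exact Hcp | exact Hb]|].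
      rewrite Rmult_assoc. apply Rmult_le_compat_l; [exact HM|].
      replace (2 * S N)%nat with (2 + 2 * N)%nat by lia. rewrite pow_add.
      assert (0 <= cos t ^ (2 * N)) by (apply pow_le; lra).
      assert (Htc := mul_cos_le_sin t Ht).
      assert (Q : (t * cos t) ^ 2 <= sin t ^ 2) by (apply pow_incr; split; [nra | exact Htc]).
      pose proof (sin2_cos2 t) as S2. unfold Rsqr in S2.
      replace (t ^ 2 * (cos t ^ 2 * cos t ^ (2 * N))) with ((t * cos t) ^ 2 * cos t ^ (2 * N)) by ring.
      replace (cos t ^ (2 * N) - cos t ^ 2 * cos t ^ (2 * N)) with (sin t ^ 2 * cos t ^ (2 * N)).
      + apply Rmult_le_compat_r; assumption.
      + replace (sin t ^ 2) with (1 - cos t ^ 2) by (simpl; lra). ring.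
    - apply (is_RInt_scal (V := R_NormedModule)).
      apply (is_RInt_minus (V := R_NormedModule)); apply is_RInt_wallis. }
  assert (Hr := wallis_rec N).
  assert (H1 : 0 < INR (2 * N + 1)) by (apply lt_0_INR; lia).
  assert (E2 : INR (2 * N + 2) = INR (2 * N + 1) + 1) by (rewrite <- S_INR; f_equal; lia).
  rewrite E2 in Hr.
  apply Rmult_le_reg_r with (wallis (S N)); [exact Hw|].
  unfold Rdiv at 1. rewrite Rmult_assoc, Rinv_l, Rmult_1_r by lra.
  eapply Rle_trans; [exact Hle|]. right.
  replace (wallis N) with ((INR (2 * N + 1) + 1) * wallis (S N) / INR (2 * N + 1)) by (rewrite <- Hr; field; lra).
  field. lra.
Qed.

(** The product of [1 - z^2 / k^2] for [k] from 1 to [n], written with Pochhammer symbols to match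
    [rgamma_seq]. *)
Definition sine_partial (z : C) (n : nat) : C :=
  (poch (RtoC 1 + z) n * poch (RtoC 1 - z) n / (RtoC (INR (fact n)) * RtoC (INR (fact n))))%C.

(** By the two recurrences, passing from [N] to [N + 1] divides the normalized integral by
    [1 - z^2 / (N + 1)^2], exactly the factor gained by the product. *)
Lemma sine_partial_Wallis (z : C) (N : nat) :
  (sine_partial z N * (Wallis z N / RtoC (wallis N)))%C = (Wallis z 0 / RtoC (wallis 0))%C.
Proof.
  induction N as [|N IH].
  - unfold sine_partial. simpl poch. change (INR (fact 0)) with 1.
    replace (RtoC 1 * RtoC 1 / (RtoC 1 * RtoC 1))%C with (RtoC 1) by (field; nz). ring.
  - rewrite <- IH. clear IH.
    assert (Hf : RtoC (INR (fact N)) <> RtoC 0) by (apply RtoC_neq_0, INR_fact_neq_0).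
    assert (Hw : RtoC (wallis N) <> RtoC 0) by (apply RtoC_neq_0; pose proof (wallis_pos N); lra).
    assert (Hw' : RtoC (wallis (S N)) <> RtoC 0) by (apply RtoC_neq_0; pose proof (wallis_pos (S N)); lra).
    assert (HN : RtoC (INR (S N)) <> RtoC 0) by (apply RtoC_neq_0, not_0_INR; lia).
    assert (R1 := Wallis_rec z N).
    assert (R2 : (RtoC (INR (2 * N + 1)) * RtoC (wallis N))%C = (RtoC (INR (2 * N + 2)) * RtoC (wallis (S N)))%C)
      by (rewrite <- !RtoC_mult; f_equal; apply wallis_rec).
    assert (E2 : RtoC (INR (2 * N + 2)) = (RtoC 2 * RtoC (INR (S N)))%C).
    { rewrite <- RtoC_mult. f_equal. rewrite S_INR, plus_INR, mult_INR. simpl. ring. }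
    assert (E1 : RtoC (INR (2 * N + 1)) = (RtoC 2 * RtoC (INR (S N)) - RtoC 1)%C).
    { rewrite <- E2, <- RtoC_minus. f_equal. rewrite !plus_INR. simpl. ring. }
    assert (E1n : (RtoC 2 * RtoC (INR (S N)) - RtoC 1)%C <> RtoC 0).
    { rewrite <- E1. apply RtoC_neq_0, not_0_INR. lia. }
    rewrite E2, E1 in R1, R2. set (n := RtoC (INR (S N))) in *.
    unfold sine_partial. rewrite fact_simpl, mult_INR, RtoC_mult. simpl poch. fold n.
    replace (RtoC 1 + z + RtoC (INR N))%C with (n + z)%C by (unfold n; rewrite S_INR, RtoC_plus; ring).
    replace (RtoC 1 - z + RtoC (INR N))%C with (n - z)%C by (unfold n; rewrite S_INR, RtoC_plus; ring).
    set (p1 := poch _ N). set (p2 := poch _ N). set (f := RtoC (INR (fact N))) in *.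
    set (J := Wallis z N) in *. set (J' := Wallis z (S N)) in *.
    set (w := RtoC (wallis N)) in *. set (w' := RtoC (wallis (S N))) in *.
    assert (Ew : w' = ((RtoC 2 * n - RtoC 1) * w / (RtoC 2 * n))%C).
    { rewrite R2. field; nz. }
    assert (EJ : J = ((RtoC 2 * n * (RtoC 2 * n) - RtoC 4 * z * z) * J' / (RtoC 2 * n * (RtoC 2 * n - RtoC 1)))%C).
    { rewrite <- R1. field; nz. }
    rewrite Ew, EJ.
    replace (RtoC 4) with (RtoC 2 * RtoC 2)%C by (rewrite <- RtoC_mult; f_equal; ring).
    field; nz.
Qed.

Lemma Wallis_ratio_lim (z : C) :
  filterlim (fun N => Wallis z N / RtoC (wallis N))%C eventually (locally (RtoC 1)).
Proof.
  destruct (Wallis_ratio_bound z) as [K HK].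
  apply (flim_squeeze _ _ (fun N => K / INR (2 * pred N + 1))).
  - exists 1%nat. intros [|N] HN; [lia|]. apply HK.
  - replace 0 with (K * 0) by ring.
    apply (is_lim_seq_scal_l (fun N => / INR (2 * pred N + 1)) K 0).
    apply (filterlim_comp _ _ _ (fun N => (2 * pred N + 1)%nat) (fun n => / INR n) _ eventually); [|apply INR_inv_lim].
    intros P [M HM]. exists (S M). intros N HN. apply HM. lia.
Qed.

(** The invariant of [sine_partial_Wallis] has the stated value at [N = 0], where the integral is
    elementary, while its second factor tends to 1. *)
Lemma sine_product (z : C) : z <> RtoC 0 ->
  filterlim (sine_partial z) eventually (locally (csin (z * RtoC PI) / (z * RtoC PI))%C).
Proof.
  intros Hz. pose proof PI_RGT_0 as HPI. assert (HPC : RtoC PI <> RtoC 0) by (apply RtoC_neq_0; lra).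
  assert (E : (Wallis z 0 / RtoC (wallis 0))%C = (csin (z * RtoC PI) / (z * RtoC PI))%C).
  { assert (EW : Wallis z 0 = (csin (z * RtoC PI) / (RtoC 2 * z))%C).
    { apply CInt_eq.
      assert (HD : is_CInt (fun t => / (RtoC 2 * z) * (RtoC 2 * z * ccos (RtoC 2 * z * RtoC t)))%C 0 (PI / 2)
         (/ (RtoC 2 * z) * (csin (RtoC 2 * z * RtoC (PI / 2)) - csin (RtoC 2 * z * RtoC 0)))%C).
      { apply is_CInt_Cmult.
        apply (is_RInt_derive (V := C_R_CompleteNormedModule) (fun t => csin (RtoC 2 * z * RtoC t)%C)); intros t _.
        - apply is_Cderive_csin.
        - apply continuous_Cmult; [apply continuous_const | apply continuous_ccos_lin]. }
      replace (csin (z * RtoC PI) / (RtoC 2 * z))%C with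
        (/ (RtoC 2 * z) * (csin (RtoC 2 * z * RtoC (PI / 2)) - csin (RtoC 2 * z * RtoC 0)))%C.
      - eapply (is_RInt_ext (V := C_R_NormedModule)); [|exact HD]. intros t _. cbn -[Cmult Cinv].
        field; nz.
      - rewrite Cmult_0_r, csin_0. replace (RtoC 2 * z * RtoC (PI / 2))%C with (z * RtoC PI)%C.
        + unfold Cdiv. ring.
        + unfold Rdiv. rewrite RtoC_mult, RtoC_inv by lra. field; nz. }
    assert (Ew : wallis 0 = PI / 2).
    { unfold wallis. rewrite (is_RInt_unique _ _ _ (scal (PI / 2 - 0) 1)) by apply (is_RInt_const (V := R_NormedModule)).
      unfold scal; cbn; unfold mult; cbn. ring. }
    rewrite EW, Ew. unfold Rdiv. rewrite RtoC_mult, RtoC_inv by lra.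
    field; nz. }
  rewrite <- E.
  assert (Hw0 : RtoC (wallis 0) <> RtoC 0) by (apply RtoC_neq_0; pose proof (wallis_pos 0); lra).
  assert (H := flim_Cdiv (fun _ => Wallis z 0 / RtoC (wallis 0))%C _ _ _ C1_nz
                 (filterlim_const (Wallis z 0 / RtoC (wallis 0))%C) (Wallis_ratio_lim z)).
  replace (Wallis z 0 / RtoC (wallis 0) / RtoC 1)%C with (Wallis z 0 / RtoC (wallis 0))%C in H by (field; nz).
  revert H. apply filterlim_ext_loc.
  generalize (proj1 (filterlim_Cmod _ _) (Wallis_ratio_lim z) (mkposreal 1 Rlt_0_1)).
  apply filter_imp. intros N HN. simpl in HN.
  assert (Hne : (Wallis z N / RtoC (wallis N))%C <> RtoC 0).
  { intros E0. rewrite E0 in HN. replace (RtoC 0 - RtoC 1)%C with (- RtoC 1)%C in HN by ring.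
    rewrite Cmod_m1 in HN. lra. }
  rewrite <- (sine_partial_Wallis z N). set (q := (Wallis z N / RtoC (wallis N))%C) in *. now field.
Qed.

Lemma rgamma_0 : rgamma (RtoC 0) = RtoC 0.
Proof. rewrite rgamma_step. ring. Qed.

Lemma rgamma_reflection (z : C) : (RtoC PI * (rgamma z * rgamma (RtoC 1 - z)))%C = csin (z * RtoC PI)%C.
Proof.
  pose proof PI_RGT_0 as HPI. assert (HPC : RtoC PI <> RtoC 0) by (apply RtoC_neq_0; lra).
  destruct (Ceq_dec z (RtoC 0)) as [->|Hz].
  { rewrite rgamma_0, !Cmult_0_l, csin_0. ring. }
  assert (H1 := flim_Cmult _ _ _ _ (rgamma_correct (RtoC 1 + z)%C) (rgamma_correct (RtoC 1 - z)%C)).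
  assert (H2 : filterlim (fun n => rgamma_seq (RtoC 1 + z) n * rgamma_seq (RtoC 1 - z) n)%C eventually
     (locally (csin (z * RtoC PI) / (z * RtoC PI))%C)).
  (* [rgamma_seq (1 + z) n * rgamma_seq (1 - z) n] is the sine product with [n + 1] factors times
     [(1 + 1/n)^2]; the powers [n^z] and [n^(-z)] cancel. *)
  { assert (Hq : filterlim (fun n => RtoC 1 + RtoC (/ INR n))%C eventually (locally (RtoC 1))).
    { assert (E := flim_Cplus _ _ _ _ (filterlim_const (RtoC 1)) (flim_RtoC _ _ INR_inv_lim)).
      rewrite Cplus_0_r in E. exact E. }
    assert (HS : filterlim (fun n => sine_partial z (S n)) eventually (locally (csin (z * RtoC PI) / (z * RtoC PI))%C)).
    { eapply filterlim_comp; [|apply sine_product, Hz]. intros P [M HM]. exists M. intros n Hn. apply HM. lia. }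
    assert (H := flim_Cmult _ _ _ _ HS (flim_Cmult _ _ _ _ Hq Hq)).
    rewrite !Cmult_1_r in H. revert H. apply filterlim_ext_loc.
    exists 1%nat. intros n Hn. unfold sine_partial, rgamma_seq.
    assert (Hln : 0 < INR n) by (apply lt_0_INR; lia). rewrite !cpow_pos by exact Hln.
    replace ((RtoC 1 + z) * RtoC (ln (INR n)))%C with (RtoC (ln (INR n)) + z * RtoC (ln (INR n)))%C by ring.
    replace ((RtoC 1 - z) * RtoC (ln (INR n)))%C with (RtoC (ln (INR n)) + - (z * RtoC (ln (INR n))))%C by ring.
    rewrite !cexp_add, cexp_opp, !cexp_R, !exp_ln, RtoC_inv by (auto; lra).
    pose proof (cexp_neq_0 (z * RtoC (ln (INR n)))%C).
    assert (RtoC (INR (fact n)) <> RtoC 0) by (apply RtoC_neq_0, INR_fact_neq_0).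
    assert (RtoC (INR n) <> RtoC 0) by (apply RtoC_neq_0; lra).
    assert (RtoC (INR n) + RtoC 1 <> RtoC 0)%C by (rewrite <- RtoC_plus; apply RtoC_neq_0; lra).
    rewrite fact_simpl, mult_INR, RtoC_mult, S_INR, RtoC_plus. field. repeat split; auto. }
  assert (E := flim_unique (F := eventually) _ _ _ H1 H2).
  rewrite (rgamma_step z). replace (z + RtoC 1)%C with (RtoC 1 + z)%C by ring.
  replace (RtoC PI * (z * rgamma (RtoC 1 + z) * rgamma (RtoC 1 - z)))%C
    with (RtoC PI * z * (rgamma (RtoC 1 + z) * rgamma (RtoC 1 - z)))%C by ring.
  rewrite E. field. auto.
Qed.

Lemma rgamma_neq_0 (z : C) : (forall n, z <> (- RtoC (INR n))%C) -> rgamma z <> RtoC 0.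
Proof.
  intros Hz. destruct (INR_unbounded (- Re z)) as [n Hn].
  rewrite (rgamma_poch z n). apply Cmult_neq_0.
  - clear Hn. induction n as [|n IH]; simpl; [apply C1_nz|]. apply Cmult_neq_0; [exact IH|].
    intros E. apply (Hz n). replace z with (z + RtoC (INR n) - RtoC (INR n))%C by ring. rewrite E. ring.
  - intros E. assert (H := rgamma_Gam 0 (z + RtoC (INR n))%C).
    rewrite E, Cmult_0_l in H. apply C1_nz. symmetry. apply H. destruct z; simpl in *; lra.
Qed.

Lemma not_Cint_neq_opp_nat (z : C) (n : nat) : ~ Cint z -> z <> (- RtoC (INR n))%C.
Proof.
  intros H E. apply H. exists (- Z.of_nat n)%Z. rewrite E, opp_IZR, <- INR_IZR_INZ. now rewrite RtoC_opp.
Qed.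

Lemma Cint_shift (z : C) (k : Z) : Cint (RtoC (IZR k) + z)%C -> Cint z.
Proof.
  intros [m Hm]. exists (m - k)%Z. rewrite minus_IZR, RtoC_minus, <- Hm. ring.
Qed.

Lemma Cint_opp (z : C) : Cint (- z)%C -> Cint z.
Proof.
  intros [m Hm]. exists (- m)%Z. rewrite opp_IZR, RtoC_opp, <- Hm. ring.
Qed.

(** The zeros of the sine are read off from the reflection formula, since [rgamma] vanishes at most
    at nonpositive integers. *)
Lemma csin_PI_neq_0 (z : C) : ~ Cint z -> csin (z * RtoC PI)%C <> RtoC 0.
Proof.
  intros Hz. rewrite <- rgamma_reflection. apply Cmult_neq_0; [apply RtoC_neq_0; pose proof PI_RGT_0; lra|].
  apply Cmult_neq_0; apply rgamma_neq_0; intros n; apply not_Cint_neq_opp_nat; [exact Hz|].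
  intros H. apply Hz, Cint_opp. apply (Cint_shift _ 1). exact H.
Qed.

Lemma cexp_Ci_PI : cexp (Defs.Ci * RtoC PI)%C = (- RtoC 1)%C.
Proof.
  unfold cexp, Defs.Ci. simpl.
  replace (0 * PI - 1 * 0) with 0 by ring. replace (0 * 0 + 1 * PI) with PI by ring.
  rewrite exp_0, cos_PI, sin_PI. unfold Cmult, Copp, RtoC; simpl. f_equal; ring.
Qed.

Lemma csin_PI_minus_1 (z : C) : csin ((z - RtoC 1) * RtoC PI)%C = (- csin (z * RtoC PI))%C.
Proof.
  unfold csin.
  replace (Defs.Ci * ((z - RtoC 1) * RtoC PI))%C with (Defs.Ci * (z * RtoC PI) + - (Defs.Ci * RtoC PI))%C by ring.
  rewrite !(cexp_opp (_ + _)%C), !cexp_add, !cexp_opp, cexp_Ci_PI.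
  pose proof (cexp_neq_0 (Defs.Ci * (z * RtoC PI))%C).
  field; nz.
Qed.

Lemma csin_opp (z : C) : csin (- z)%C = (- csin z)%C.
Proof.
  unfold csin. replace (Defs.Ci * - z)%C with (- (Defs.Ci * z))%C by ring.
  replace (- - (Defs.Ci * z))%C with (Defs.Ci * z)%C by ring. unfold Cdiv. ring.
Qed.

(** ** The kernel [1 / (zeta + e^u)] with [zeta = exp w], [|Im w| < pi] *)

Definition kern (w : C) (u : R) : C := (/ (cexp w + RtoC (exp u)))%C.

Definition kern_const (Th A : R) : R := sqrt ((1 + cos Th) / 2) * exp (- A).

Lemma kern_const_pos (Th A : R) : 0 <= Th < PI -> 0 < kern_const Th A.
Proof.
  intros H. unfold kern_const. apply Rmult_lt_0_compat; [|apply exp_pos].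
  apply sqrt_lt_R0. assert (cos PI < cos Th) by (apply cos_decreasing_1; lra).
  rewrite cos_PI in H0. lra.
Qed.

(** For [|X e^(i th) + Y|^2 = X^2 + 2 X Y cos th + Y^2] with [cos th >= c = cos Th], the excess over
    [(1 + c)/2 * (X + Y)^2] is at least [(1 - c)/2 * (X - Y)^2]. Then [X >= exp (- A)] and
    [exp (- A) <= 1] reduce [X + Y] to [1 + Y]. *)
Lemma kern_den_lower (Th A : R) (w : C) (u : R) :
  0 <= Th < PI -> Rabs (Im w) <= Th -> 0 <= A -> - A <= Re w ->
  kern_const Th A * (1 + exp u) <= Cmod (cexp w + RtoC (exp u))%C.
Proof.
  intros HT Hw HA Hr. destruct w as [a th]. cbn [Re Im fst snd] in Hw, Hr.
  unfold cexp; cbn [Re Im fst snd].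
  set (X := exp a). set (Y := exp u). assert (HX : 0 < X) by apply exp_pos. assert (HY : 0 < Y) by apply exp_pos.
  assert (Hc : cos Th <= cos th).
  { destruct (Rle_dec 0 th) as [H|H].
    - rewrite Rabs_pos_eq in Hw by exact H. apply cos_decr_1; lra.
    - rewrite Rabs_left in Hw by lra. rewrite <- (cos_neg th). apply cos_decr_1; lra. }
  set (c := cos Th) in *.
  assert (Hc1 : -1 < c).
  { assert (cos PI < cos Th) by (apply cos_decreasing_1; lra). rewrite cos_PI in H. exact H. }
  assert (Hc2 : c <= 1) by (apply COS_bound).
  assert (L1 : sqrt ((1 + c) / 2) * (X + Y) <= Cmod (RtoC X * (cos th, sin th) + RtoC Y)%C).
  { apply Rsqr_incr_0_var; [|apply Cmod_ge_0]. rewrite Rsqr_mult, Rsqr_sqrt by lra.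
    unfold Rsqr. replace (Cmod _ * Cmod _) with (Cmod (RtoC X * (cos th, sin th) + RtoC Y)%C ^ 2) by ring.
    rewrite Cmod2_alt. cbn [Re Im fst snd Cmult Cplus RtoC].
    pose proof (sin2_cos2 th) as Q. unfold Rsqr in Q.
    replace ((X * cos th - 0 * sin th + Y) ^ 2 + (X * sin th + 0 * cos th + 0) ^ 2)
      with (X * X * (sin th * sin th + cos th * cos th) + 2 * (X * Y) * cos th + Y * Y) by ring.
    rewrite Q. assert (0 < X * Y) by nra.
    assert (2 * (X * Y) * c <= 2 * (X * Y) * cos th) by nra.
    assert (0 <= (1 - c) / 2 * ((X - Y) * (X - Y))) by (apply Rmult_le_pos; [lra | apply Rle_0_sqr]).
    nra. }
  assert (L2 : exp (- A) * (1 + Y) <= X + Y).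
  { assert (exp (- A) <= X) by (apply exp_le; lra).
    assert (exp (- A) <= 1) by (rewrite <- exp_0; apply exp_le; lra).
    assert (exp (- A) * Y <= 1 * Y) by (apply Rmult_le_compat_r; lra). lra. }
  unfold kern_const. fold c. rewrite Rmult_assoc. eapply Rle_trans; [|exact L1].
  apply Rmult_le_compat_l; [apply sqrt_pos | exact L2].
Qed.

Lemma kern_den_neq_0 (w : C) (u : R) : Rabs (Im w) < PI -> (cexp w + RtoC (exp u))%C <> RtoC 0.
Proof.
  intros Hw. pose proof (Rabs_pos (Im w)). pose proof (exp_pos u).
  assert (L := kern_den_lower (Rabs (Im w)) (Rabs (Re w)) w u ltac:(lra) (Rle_refl _) (Rabs_pos _)).
  assert (Hk := kern_const_pos (Rabs (Im w)) (Rabs (Re w)) ltac:(lra)).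
  apply Cmod_gt_0. eapply Rlt_le_trans; [|apply L; pose proof (Rle_abs (- Re w)); rewrite Rabs_Ropp in *; lra].
  nra.
Qed.

Lemma kern_bound (Th A : R) (w : C) (u : R) :
  0 <= Th < PI -> Rabs (Im w) <= Th -> 0 <= A -> - A <= Re w ->
  Cmod (kern w u) <= / kern_const Th A * / (1 + exp u).
Proof.
  intros HT Hw HA Hr. unfold kern. rewrite Cmod_inv by (apply kern_den_neq_0; lra).
  pose proof (exp_pos u). pose proof (kern_const_pos Th A HT).
  rewrite <- Rinv_mult. apply Rinv_le_contravar; [nra|]. now apply kern_den_lower.
Qed.

Lemma exp_over_1_plus_exp (s d u : R) : d <= s -> s <= 1 - d ->
  exp (s * u) * / (1 + exp u) <= exp (- d * Rabs u).
Proof.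
  intros H1 H2. pose proof (exp_pos u) as Hu. pose proof (exp_pos (s * u)).
  apply Rmult_le_reg_r with (1 + exp u); [lra|].
  rewrite Rmult_assoc, Rinv_l, Rmult_1_r by lra.
  pose proof (exp_pos (- d * Rabs u)).
  destruct (Rle_dec u 0) as [Hs|Hs].
  - rewrite (Rabs_left1 u) in * by exact Hs.
    assert (exp (s * u) <= exp (- d * - u)) by (apply exp_le; nra). nra.
  - rewrite (Rabs_pos_eq u) in * by lra.
    assert (exp (s * u) <= exp (- d * u) * exp u) by (rewrite <- exp_plus; apply exp_le; nra). nra.
Qed.

Lemma continuous_kern (w : C) (u : R) : Rabs (Im w) < PI -> Ccont (kern w) u.
Proof.
  intros Hw. apply continuous_Cinv; [now apply kern_den_neq_0|].
  apply continuous_Cplus; [apply continuous_const|]. apply continuous_RtoC, continuous_exp.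
Qed.

Lemma kern_integrand_dom (Th A d : R) (p w : C) :
  0 <= Th < PI -> Rabs (Im w) <= Th -> 0 <= A -> - A <= Re w -> 0 < d -> d <= Re p -> Re p <= 1 - d ->
  dom (/ kern_const Th A) d (fun u => cexp (p * RtoC u) * kern w u)%C.
Proof.
  intros HT Hw HA Hr Hd H1 H2. split; [exact Hd|split].
  - intros u. apply continuous_Cmult.
    + eapply continuous_of_Cderive, is_Cderive_cexp_lin.
    + apply continuous_kern. lra.
  - intros u. rewrite Cmod_mult, Cmod_cexp, Re_mult_RtoC.
    pose proof (kern_const_pos Th A HT) as Hk. apply Rinv_0_lt_compat in Hk.
    eapply Rle_trans; [apply Rmult_le_compat_l; [left; apply exp_pos | apply (kern_bound Th A w u); auto]|].
    replace (exp (Re p * u) * (/ kern_const Th A * / (1 + exp u)))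
      with (/ kern_const Th A * (exp (Re p * u) * / (1 + exp u))) by ring.
    apply Rmult_le_compat_l; [lra|]. now apply exp_over_1_plus_exp.
Qed.

Lemma kern_sqr_integrand_dom (Th A d : R) (p w : C) :
  0 <= Th < PI -> Rabs (Im w) <= Th -> 0 <= A -> - A <= Re w -> 0 < d -> d <= Re p -> Re p <= 1 - d ->
  dom (/ kern_const Th A * / kern_const Th A) d (fun u => kern w u * (cexp (p * RtoC u) * kern w u))%C.
Proof.
  intros HT Hw HA Hr Hd H1 H2. apply dom_bounded_mult.
  - intros u. apply continuous_kern. lra.
  - intros u. pose proof (kern_const_pos Th A HT) as Hk. apply Rinv_0_lt_compat in Hk.
    eapply Rle_trans; [apply (kern_bound Th A w u); auto|].
    rewrite <- (Rmult_1_r (/ kern_const Th A)) at 2. apply Rmult_le_compat_l; [lra|].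
    pose proof (exp_pos u). rewrite <- Rinv_1. apply Rinv_le_contravar; lra.
  - now apply kern_integrand_dom.
Qed.

(** Differentiate [cexp (p u) * kern w u] and replace [e^u * kern] by [1 - e^w * kern]. *)
Lemma kern_integral_parts (p w : C) (d : R) : Rabs (Im w) < PI -> 0 < d -> d <= Re p -> Re p <= 1 - d ->
  (cexp w * LInt (fun u => kern w u * (cexp (p * RtoC u) * kern w u)))%C =
  ((RtoC 1 - p) * LInt (fun u => cexp (p * RtoC u) * kern w u))%C.
Proof.
  intros Hw Hd H1 H2.
  assert (HT : 0 <= Rabs (Im w) < PI) by (split; [apply Rabs_pos | exact Hw]).
  assert (HA : - Rabs (Re w) <= Re w) by (pose proof (Rle_abs (- Re w)); rewrite Rabs_Ropp in *; lra).
  assert (D1 := kern_integrand_dom _ _ d p w HT (Rle_refl _) (Rabs_pos _) HA Hd H1 H2).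
  assert (D2 := kern_sqr_integrand_dom _ _ d p w HT (Rle_refl _) (Rabs_pos _) HA Hd H1 H2).
  assert (D1' := dom_Cmult (RtoC 1 - p)%C _ _ _ D1).
  assert (D2' := dom_Cmult (cexp w) _ _ _ D2).
  rewrite <- (LInt_Cmult _ _ _ _ D1), <- (LInt_Cmult _ _ _ _ D2).
  assert (E := LInt_derivative_0 _ _ _ _ _ _ (dom_minus _ _ _ _ _ _ D2' D1') D1).
  cbv beta in E. rewrite (LInt_minus _ _ _ _ _ _ D2' D1') in E.
  match type of E with _ -> (?a - ?b)%C = _ => assert (E0 : (a - b)%C = RtoC 0) end.
  { apply E. intros u. assert (Hne := kern_den_neq_0 w u Hw). unfold kern.
    eapply is_Cderive_eq; [|apply is_Cderive_mult; [apply is_Cderive_cexp_lin | apply is_Cderive_Cinv; [exact Hne|]]].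
    2: { apply is_Cderive_plus; [apply is_Cderive_const | apply is_Cderive_RtoC, is_derive_exp]. }
    cbv beta. field. exact Hne. }
  match type of E0 with (?a - ?b)%C = _ => replace a with ((a - b) + b)%C by ring; rewrite E0; ring end.
Qed.

(** The Beta integral: the product of the two Gamma integrals is the integral of a convolution,
    whose inner integral is again of Gamma type with value [Gam 0 1]. *)
Lemma kern_integral_base (p : C) : 0 < Re p < 1 ->
  LInt (fun u => cexp (p * RtoC u) * kern (RtoC 0) u)%C = (Gam 0 p * Gam 0 (RtoC 1 - p))%C.
Proof.
  intros Hp.
  assert (Hq : 0 < Re (RtoC 1 - p)%C) by (destruct p; simpl in *; lra).
  destruct (strip_dom 0 p) as (K1 & d1 & D1); [apply Hp|].
  destruct (strip_dom 0 (RtoC 1 - p)%C Hq) as (K2 & d2 & D2).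
  assert (Hm : 0 < Rmin d1 d2) by (apply Rmin_pos; [apply D1 | apply D2]).
  assert (D1' := dom_weaken _ _ _ (Rmax K1 K2) (Rmin d1 d2) D1 (Rmax_l _ _) (conj Hm (Rmin_l _ _))).
  assert (D2' := dom_weaken _ _ _ (Rmax K1 K2) (Rmin d1 d2) D2 (Rmax_r _ _) (conj Hm (Rmin_r _ _))).
  unfold Gam. rewrite <- (LInt_reflect _ _ _ D2).
  rewrite <- (LInt_convolution _ _ _ _ D1' (dom_reflect _ _ _ D2')).
  apply LInt_ext. intros s.
  destruct (strip_dom 0 (RtoC 1) ltac:(simpl; lra)) as (K & d & D).
  (* The two exponentials combine into [exp (- (1 + e^s) e^(- u))]; the translation by [lam] absorbs
     the factor [1 + e^s]. *)
  set (lam := ln (1 + exp s)). assert (Hl : exp lam = 1 + exp s) by (apply exp_ln; pose proof (exp_pos s); lra).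
  assert (HG : LInt (fun u => Gam_integrand 0 (RtoC 1) (- (u + - lam))) = RtoC 1).
  { rewrite (LInt_shift (fun v => Gam_integrand 0 (RtoC 1) (- v)) (- lam) K d (dom_reflect _ _ _ D)).
    rewrite (LInt_reflect _ _ _ D). apply Gam_1. }
  assert (DG := dom_shift _ (- lam) _ _ (dom_reflect _ _ _ D)).
  transitivity (cexp (p * RtoC s) * kern (RtoC 0) s * LInt (fun u => Gam_integrand 0 (RtoC 1) (- (u + - lam))))%C;
    [rewrite HG; ring | clear HG].
  rewrite <- (LInt_Cmult _ _ _ _ DG).
  apply LInt_ext. intros u. unfold Gam_integrand, kern, Erem.
  rewrite cexp_0, <- RtoC_plus, <- Hl, Cmult_1_l, cexp_R.
  replace (- (u + - lam)) with (lam + - u) by ring. rewrite exp_plus, Hl.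
  replace (p * RtoC (s - u))%C with (p * RtoC s + - (p * RtoC u))%C by (rewrite RtoC_minus; ring).
  replace ((RtoC 1 - p) * RtoC (- u))%C with (RtoC (- u) + p * RtoC u)%C by (rewrite RtoC_opp; ring).
  rewrite !cexp_add, cexp_opp, cexp_R.
  replace (s - u) with (s + - u) by ring. rewrite (exp_plus s (- u)).
  replace (- ((1 + exp s) * exp (- u))) with (- (exp s * exp (- u)) + - exp (- u)) by ring.
  rewrite exp_plus, !RtoC_mult.
  assert (RtoC (1 + exp s) <> RtoC 0) by (apply RtoC_neq_0; pose proof (exp_pos s); lra).
  pose proof (cexp_neq_0 (p * RtoC u)%C). field. auto.
Qed.

Lemma Gam_reflection (p : C) : 0 < Re p < 1 ->
  (Gam 0 p * Gam 0 (RtoC 1 - p))%C = (RtoC PI / csin (p * RtoC PI))%C.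
Proof.
  intros Hp. assert (Hq : 0 < Re (RtoC 1 - p)%C) by (destruct p; simpl in *; lra).
  destruct (Gam_is_rgamma p) as [N1 R1]; [apply Hp|].
  destruct (Gam_is_rgamma (RtoC 1 - p)%C Hq) as [N2 R2].
  rewrite <- rgamma_reflection, (is_rgamma_eq _ _ R1), (is_rgamma_eq _ _ R2).
  assert (RtoC PI <> RtoC 0) by (apply RtoC_neq_0; pose proof PI_RGT_0; lra).
  field. auto.
Qed.

(** Instead of rotating a contour, [w] is joined to 0 by the segment [t * w]: the integral satisfies
    a linear differential equation in [t], known from [kern_integral_parts], and its value at
    [t = 0] is the Beta integral. *)
Lemma kern_integral (p w : C) : 0 < Re p < 1 -> Rabs (Im w) < PI ->
  LInt (fun u => cexp (p * RtoC u) * kern w u)%C =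
  (cexp ((p - RtoC 1) * w) * (RtoC PI / csin (p * RtoC PI)))%C.
Proof.
  intros Hp Hw. set (d := Rmin (Re p) (1 - Re p)).
  assert (Hd : 0 < d) by (apply Rmin_pos; lra).
  assert (Hd1 : d <= Re p) by apply Rmin_l.
  assert (Hd2 : Re p <= 1 - d) by (assert (d <= 1 - Re p) by apply Rmin_r; lra).
  (* A margin beyond [t = 1], so that derivatives exist at the ends of the segment; when [Im w] is
     nonzero, [T * |Im w|] is the midpoint of [|Im w|] and [PI]. *)
  assert (HT : exists T, 1 < T /\ T * Rabs (Im w) < PI).
  { destruct (Req_dec (Im w) 0) as [E|E].
    - exists 2. rewrite E, Rabs_R0, Rmult_0_r. pose proof PI_RGT_0. lra.
    - assert (0 < Rabs (Im w)) by now apply Rabs_pos_lt.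
      exists ((1 + PI / Rabs (Im w)) / 2).
      assert (HI : 1 < PI / Rabs (Im w)) by (apply Rmult_lt_reg_r with (Rabs (Im w)); [assumption|];
        unfold Rdiv; rewrite Rmult_assoc, Rinv_l; lra).
      split; [lra|]. replace ((1 + PI / Rabs (Im w)) / 2 * Rabs (Im w)) with ((Rabs (Im w) + PI) / 2) by (field; lra). lra. }
  destruct HT as (T & HT1 & HT2).
  set (Th := T * Rabs (Im w)). set (A := T * Rabs (Re w)).
  assert (HTh : 0 <= Th < PI) by (split; [apply Rmult_le_pos; [lra | apply Rabs_pos] | exact HT2]).
  assert (HA : 0 <= A) by (apply Rmult_le_pos; [lra | apply Rabs_pos]).
  assert (Him : forall t, Im (RtoC t * w)%C = t * Im w) by (intros; destruct w; simpl; ring).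
  assert (Hre : forall t, Re (RtoC t * w)%C = t * Re w) by (intros; destruct w; simpl; ring).
  assert (Hin1 : forall t, Rabs t < T -> Rabs (Im (RtoC t * w)%C) <= Th).
  { intros t Ht. rewrite Him, Rabs_mult. apply Rmult_le_compat_r; [apply Rabs_pos | lra]. }
  assert (Hin2 : forall t, Rabs t < T -> - A <= Re (RtoC t * w)%C).
  { intros t Ht. rewrite Hre. assert (Rabs (t * Re w) <= A).
    { rewrite Rabs_mult. apply Rmult_le_compat_r; [apply Rabs_pos | lra]. }
    apply Rabs_le_between in H. lra. }
  pose (b := fun t => LInt (fun u => cexp (p * RtoC u) * kern (RtoC t * w) u)%C).
  assert (Db : forall t, Rabs t < T -> is_Cderive b t (w * (p - RtoC 1) * b t)%C).
  { intros t Ht.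
    assert (Hr : 0 < T - Rabs t) by lra.
    assert (Hnear : forall s, Rabs (s - t) < T - Rabs t -> Rabs s < T).
    { intros s Hs. replace s with ((s - t) + t) by ring. eapply Rle_lt_trans; [apply Rabs_triang|]. lra. }
    assert (Hc : Cmod (- w * cexp (RtoC t * w))%C >= 0) by (apply Rle_ge, Cmod_ge_0).
    eapply is_Cderive_eq; [|apply (LInt_is_derive (fun t u => cexp (p * RtoC u) * kern (RtoC t * w) u)%C
       (fun t u => (- w * cexp (RtoC t * w)) * (kern (RtoC t * w) u * (cexp (p * RtoC u) * kern (RtoC t * w) u)))%C
       t (Cmod w * exp A * (/ kern_const Th A * / kern_const Th A)) d (/ kern_const Th A) d (mkposreal _ Hr))].
    - assert (D2 := kern_sqr_integrand_dom Th A d p (RtoC t * w)%C HTh (Hin1 t Ht) HA (Hin2 t Ht) Hd Hd1 Hd2).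
      rewrite (LInt_Cmult _ _ _ _ D2).
      assert (E := kern_integral_parts p (RtoC t * w)%C d ltac:(pose proof (Hin1 t Ht); lra) Hd Hd1 Hd2).
      rewrite <- Cmult_assoc, E. fold (b t). ring.
    - intros s Hs. apply kern_integrand_dom; auto.
    - intros s Hs. simpl in Hs. specialize (Hnear s Hs).
      assert (D2 := kern_sqr_integrand_dom Th A d p (RtoC s * w)%C HTh (Hin1 s Hnear) HA (Hin2 s Hnear) Hd Hd1 Hd2).
      eapply dom_weaken; [apply dom_Cmult, D2| |lra].
      apply Rmult_le_compat_r.
      + pose proof (kern_const_pos Th A HTh) as Hk. apply Rinv_0_lt_compat in Hk. nra.
      + rewrite Cmod_mult, Cmod_opp, Cmod_cexp, Hre. apply Rmult_le_compat_l; [apply Cmod_ge_0|].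
        apply exp_le. eapply Rle_trans; [apply Rle_abs|]. rewrite Rabs_mult. apply Rmult_le_compat_r; [apply Rabs_pos | lra].
    - intros s u Hs. simpl in Hs. specialize (Hnear s Hs). specialize (Hin1 s Hnear).
      assert (Hne := kern_den_neq_0 (RtoC s * w)%C u ltac:(lra)). unfold kern.
      eapply is_Cderive_eq; [|apply is_Cderive_Cmult, is_Cderive_Cinv; [exact Hne|]].
      2: { apply is_Cderive_plus; [|apply is_Cderive_const].
           apply is_Cderive_cexp, is_Cderive_mult; [apply is_Cderive_id | apply is_Cderive_const]. }
      cbv beta. field. exact Hne.
    - intros u. specialize (Hin1 t Ht).
      assert (Hk : @continuous (prod_UniformSpace R_UniformSpace R_UniformSpace) C_UniformSpace
           (fun q => kern (RtoC (fst q) * w) (snd q)) (t, u)).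
      { apply continuous_Cinv; [apply kern_den_neq_0; apply (Rle_lt_trans _ Th); [exact Hin1 | lra]|]. apply continuous_Cplus.
        - apply continuous_cexp, continuous_Cmult; [apply continuous_RtoC, continuous_fst | apply continuous_const].
        - apply continuous_RtoC. apply (continuous_comp (fun q : R * R => snd q) exp); [apply continuous_snd | apply continuous_exp]. }
      apply continuous_Cmult; [|apply continuous_Cmult; [exact Hk | apply continuous_Cmult; [|exact Hk]]].
      + apply continuous_Cmult; [apply continuous_const|]. apply continuous_cexp, continuous_Cmult; [apply continuous_RtoC, continuous_fst | apply continuous_const].
      + apply continuous_cexp, continuous_Cmult; [apply continuous_const | apply continuous_RtoC, continuous_snd]. }
  (* The integrating factor makes the derivative zero, and the mean value bound with constant 0
     gives [B 1 = B 0]. *)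
  pose (B := fun t => (cexp (((RtoC 1 - p) * w) * RtoC t) * b t)%C).
  assert (HB : Cmod (B 1 - B 0)%C <= 2 * 0 * Rabs (1 - 0)).
  { apply (C_mean_value_bound B (fun _ => RtoC 0) 0 0 1). intros t Ht. split; [|rewrite Cmod_0; lra].
    rewrite !Rminus_0_r, Rabs_R1 in Ht.
    eapply is_Cderive_eq; [|apply is_Cderive_mult; [apply is_Cderive_cexp_lin | apply Db; lra]].
    cbv beta. ring. }
  assert (E : B 1 = B 0).
  { assert (Z : Cmod (B 1 - B 0)%C = 0) by (pose proof (Cmod_ge_0 (B 1 - B 0)%C); lra).
    apply Cmod_eq_0 in Z. replace (B 1) with ((B 1 - B 0) + B 0)%C by ring. rewrite Z. ring. }
  unfold B, b in E. rewrite Cmult_0_r, cexp_0, Cmult_0_l, Cmult_1_r, !Cmult_1_l in E.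
  rewrite kern_integral_base, Gam_reflection in E by exact Hp. rewrite <- E.
  rewrite Cmult_assoc, <- cexp_add.
  replace ((p - RtoC 1) * w + (RtoC 1 - p) * w)%C with (RtoC 0) by ring. rewrite cexp_0. ring.
Qed.

(** ** Dominated convergence for series *)

Lemma psum_S (a : nat -> C) (n : nat) : psum a (S n) = (psum a n + a n)%C.
Proof. reflexivity. Qed.

(** [sum_n] includes its upper index and [psum] does not, whence the successor here and in the tail
    estimates. *)
Lemma sum_n_psum (a : nat -> C) (n : nat) : @sum_n C_R_NormedModule a n = psum a (S n).
Proof.
  induction n as [|n IH].
  - rewrite sum_O. simpl. rewrite Cplus_0_l. reflexivity.
  - rewrite sum_Sn, IH. reflexivity.
Qed.

Lemma flim_seq_incr {U : UniformSpace} (f : nat -> U) (l : U) :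
  filterlim (fun n => f (S n)) eventually (locally l) -> filterlim f eventually (locally l).
Proof.
  intros H P HP. destruct (H P HP) as [N HN]. exists (S N). intros [|n] Hn; [lia|]. apply HN. lia.
Qed.

Lemma flim_seq_decr {U : UniformSpace} (f : nat -> U) (l : U) :
  filterlim f eventually (locally l) -> filterlim (fun n => f (S n)) eventually (locally l).
Proof. intros H P HP. destruct (H P HP) as [N HN]. exists N. intros n Hn. apply HN. lia. Qed.

Lemma psum_increment_bound (a : nat -> C) (M : nat -> R) (N n : nat) : (forall k, Cmod (a k) <= M k) ->
  Cmod (psum a (S (N + n)) - psum a (S N))%C <= sum_n M (N + n) - sum_n M N.
Proof.
  intros H. induction n as [|n IH].
  - rewrite Nat.add_0_r. replace (psum a (S N) - psum a (S N))%C with (RtoC 0) by ring. rewrite Cmod_0. lra.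
  - rewrite Nat.add_succ_r, (psum_S a (S (N + n))), sum_Sn. unfold plus; cbn -[psum sum_n].
    replace (psum a (S (N + n)) + a (S (N + n)) - psum a (S N))%C
      with ((psum a (S (N + n)) - psum a (S N)) + a (S (N + n))%nat)%C by ring.
    eapply Rle_trans; [apply Cmod_triangle|]. specialize (H (S (N + n))). lra.
Qed.

Lemma Cseries_lim (a : nat -> C) (M : nat -> R) : (forall k, Cmod (a k) <= M k) -> ex_series M ->
  filterlim (psum a) eventually (locally (Cseries a)).
Proof.
  intros H HM.
  assert (E : @ex_series R_AbsRing C_R_NormedModule a).
  { apply (ex_series_le (V := C_R_CompleteNormedModule) a M); [|exact HM].
    intros n. specialize (H n). rewrite Cmod_norm in H. exact H. }
  destruct E as [l Hl]. assert (Hl' : filterlim (psum a) eventually (locally l)).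
  { apply (flim_seq_incr (U := C_UniformSpace)). revert Hl. apply filterlim_ext. intros n. apply sum_n_psum. }
  unfold Cseries. rewrite (Clim_eq _ l Hl'). exact Hl'.
Qed.

Lemma Cseries_eq (a : nat -> C) (l : C) : filterlim (psum a) eventually (locally l) -> Cseries a = l.
Proof. apply Clim_eq. Qed.

Lemma R_ball_Rabs (x e y : R) : ball x e y -> Rabs (y - x) < e.
Proof. intros H; exact H. Qed.

Lemma Cseries_tail_bound (a : nat -> C) (M : nat -> R) (N : nat) : (forall k, Cmod (a k) <= M k) -> ex_series M ->
  Cmod (Cseries a - psum a (S N))%C <= Series M - sum_n M N.
Proof.
  intros H HM. apply le_epsilon. intros eps He. assert (He2 : 0 < eps / 2) by lra.
  assert (L1 := flim_seq_decr (U := C_UniformSpace) _ _ (Cseries_lim a M H HM)).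
  assert (L1' := proj1 (filterlim_Cmod _ _) L1 (mkposreal _ He2)).
  assert (L2' := proj1 (filterlim_locally _ _) (Series_correct M HM) (mkposreal _ He2)).
  destruct (filter_and _ _ L1' L2') as [n0 Hn0].
  destruct (Hn0 (N + n0)%nat ltac:(lia)) as [H1 H2]. cbn [pos] in H1.
  apply R_ball_Rabs, Rabs_def2 in H2. destruct H2 as [H2 _].
  change (sum_n M (N + n0) - Series M < eps / 2) in H2.
  assert (H3 := psum_increment_bound a M N n0 H).
  replace (Cseries a - psum a (S N))%C with
    (- (psum a (S (N + n0)) - Cseries a) + (psum a (S (N + n0)) - psum a (S N)))%C by ring.
  eapply Rle_trans; [apply Cmod_triangle|]. rewrite Cmod_opp. lra.
Qed.

(** A summable majorant makes the tails uniformly small, leaving a finite sum in which limits pass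
    termwise. *)
Lemma Cseries_flim {T : Type} {F : (T -> Prop) -> Prop} {FF : Filter F}
  (f : T -> nat -> C) (g : nat -> C) (M : nat -> R) :
  ex_series M -> F (fun t => forall k, Cmod (f t k) <= M k) -> (forall k, Cmod (g k) <= M k) ->
  (forall k, filterlim (fun t => f t k) F (locally (g k))) ->
  filterlim (fun t => Cseries (f t)) F (locally (Cseries g)).
Proof.
  intros HM Hf Hg Hl. apply filterlim_Cmod. intros eps.
  destruct (proj1 (filterlim_locally _ _) (Series_correct M HM) (pos_div_2 (pos_div_2 eps))) as [N HN].
  specialize (HN N (Nat.le_refl _)).
  apply R_ball_Rabs, Rabs_def2 in HN. destruct HN as [_ HN].
  change (- (eps / 2 / 2) < sum_n M N - Series M) in HN.
  assert (Hp := flim_psum (fun k t => f t k) g (S N) Hl).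
  generalize (filter_and _ _ Hf (proj1 (filterlim_Cmod _ _) Hp (pos_div_2 eps))).
  apply filter_imp. intros t [H1 H2].
  change (Cmod (psum (f t) (S N) - psum g (S N))%C < eps / 2) in H2.
  assert (T1 := Cseries_tail_bound (f t) M N H1 HM).
  assert (T2 := Cseries_tail_bound g M N Hg HM).
  replace (Cseries (f t) - Cseries g)%C with
    ((Cseries (f t) - psum (f t) (S N)) + ((psum (f t) (S N) - psum g (S N)) + - (Cseries g - psum g (S N))))%C by ring.
  eapply Rle_lt_trans; [apply Cmod_triangle|].
  eapply Rle_lt_trans; [apply Rplus_le_compat_l, Cmod_triangle|]. rewrite Cmod_opp. lra.
Qed.

(** ** The entire functions [Om a b w = sum_k w^k / (Gamma(a+k) Gamma(b+k))] *)

Lemma Re_plus_INR (a : C) (k : nat) : Re (a + RtoC (INR k))%C = Re a + INR k.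
Proof. destruct a; reflexivity. Qed.

Lemma poch_lower (a : C) (n : nat) : 1 <= Re a -> INR (fact n) <= Cmod (poch a n).
Proof.
  intros Ha. induction n as [|n IH]; [simpl; rewrite Cmod_1; lra|].
  simpl poch. rewrite Cmod_mult, fact_simpl, mult_INR, Rmult_comm.
  apply Rmult_le_compat; [apply pos_INR | apply pos_INR | exact IH |].
  eapply Rle_trans; [|apply re_le_Cmod]. rewrite Re_plus_INR, S_INR.
  pose proof (pos_INR n). rewrite Rabs_pos_eq; lra.
Qed.

Lemma rgamma_shift_continuous (a0 : C) (k : nat) :
  filterlim (fun a => rgamma (a + RtoC (INR k))%C) (locally a0) (locally (rgamma (a0 + RtoC (INR k))%C)).
Proof.
  apply (filterlim_comp _ _ _ (fun a => a + RtoC (INR k))%C rgamma _ (locally (a0 + RtoC (INR k))%C)).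
  - apply flim_Cplus; [apply filterlim_id | apply filterlim_const].
  - apply rgamma_continuous.
Qed.

(** For [k > K], [rgamma (a + K)] is [rgamma (a + k)] times a Pochhammer symbol of modulus at least
    [(k - K)!]. For [k <= K] the truncated subtraction makes the factorial 1, and continuity bounds
    finitely many values. *)
Lemma rgamma_local_bound (a0 : C) : exists B K, 0 <= B /\
  locally a0 (fun a => forall k, Cmod (rgamma (a + RtoC (INR k))%C) <= B * / INR (fact (k - K))).
Proof.
  destruct (INR_unbounded (2 - Re a0)) as [K HK].
  assert (Hfin : forall n, exists B, 0 <= B /\ locally a0 (fun a => forall k, (k <= n)%nat -> Cmod (rgamma (a + RtoC (INR k))%C) <= B)).
  { assert (H1 : forall n, locally a0 (fun a => Cmod (rgamma (a + RtoC (INR n))%C) <= Cmod (rgamma (a0 + RtoC (INR n))%C) + 1)).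
    { intros n. generalize (proj1 (filterlim_Cmod _ _) (rgamma_shift_continuous a0 n) (mkposreal 1 Rlt_0_1)).
      apply filter_imp. intros a Ha. simpl in Ha.
      replace (rgamma (a + RtoC (INR n))%C) with (rgamma (a0 + RtoC (INR n)) + (rgamma (a + RtoC (INR n)) - rgamma (a0 + RtoC (INR n))))%C by ring.
      eapply Rle_trans; [apply Cmod_triangle|]. lra. }
    induction n as [|n [B [HB IH]]].
    - exists (Cmod (rgamma (a0 + RtoC (INR 0))%C) + 1). split; [pose proof (Cmod_ge_0 (rgamma (a0 + RtoC (INR 0))%C)); lra|].
      generalize (H1 O). apply filter_imp. intros a Ha k Hk. replace k with O by lia. exact Ha.
    - exists (B + (Cmod (rgamma (a0 + RtoC (INR (S n)))%C) + 1)).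
      pose proof (Cmod_ge_0 (rgamma (a0 + RtoC (INR (S n)))%C)). split; [lra|].
      generalize (filter_and _ _ IH (H1 (S n))). apply filter_imp. intros a [Ha Hb] k Hk.
      destruct (Nat.eq_dec k (S n)) as [->|Hne]; [lra|]. specialize (Ha k ltac:(lia)). lra. }
  destruct (Hfin K) as (B & HB & HL). exists B, K. split; [exact HB|].
  assert (Hnear : locally a0 (fun a => Re a0 - 1 < Re a)).
  { exists (mkposreal 1 Rlt_0_1). intros a [Ha _].
    unfold ball in Ha; simpl in Ha; unfold AbsRing_ball, abs, minus, plus, opp in Ha; simpl in Ha.
    apply Rabs_def2 in Ha. unfold Re. lra. }
  generalize (filter_and _ _ HL Hnear). apply filter_imp. intros a [Ha Hr] k.
  destruct (Nat.le_gt_cases k K) as [Hk|Hk].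
  - replace (k - K)%nat with O by lia. simpl. rewrite Rinv_1, Rmult_1_r. now apply Ha.
  - assert (E := rgamma_poch (a + RtoC (INR K))%C (k - K)).
    rewrite <- Cplus_assoc, <- RtoC_plus, <- plus_INR in E.
    replace (K + (k - K))%nat with k in E by lia.
    assert (P := poch_lower (a + RtoC (INR K))%C (k - K) ltac:(rewrite Re_plus_INR; lra)).
    specialize (Ha K (Nat.le_refl _)). rewrite E, Cmod_mult in Ha.
    pose proof (INR_fact_lt_0 (k - K)) as Hf.
    apply Rmult_le_reg_r with (INR (fact (k - K))); [exact Hf|].
    rewrite Rmult_assoc, Rinv_l, Rmult_1_r by lra.
    eapply Rle_trans; [|exact Ha]. rewrite Rmult_comm.
    apply Rmult_le_compat_r; [apply Cmod_ge_0 | exact P].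
Qed.

Definition Om_term (a b w : C) (k : nat) : C :=
  (Cpown w k * (rgamma (a + RtoC (INR k)) * rgamma (b + RtoC (INR k))))%C.

(** With [a = 1] this is a Bessel series without its power factor; in general it is a 1F2 series
    with upper parameter 1, divided by [Gamma a * Gamma b]. Reciprocal Gammas keep it finite and
    continuous at all parameters. *)
Definition Om (a b w : C) : C := Cseries (Om_term a b w).

Lemma ex_series_shifted_exp (x D : R) (K : nat) : 0 <= x -> ex_series (fun k => x ^ k * (D * / INR (fact (k - K)))).
Proof.
  intros Hx. apply (ex_series_incr_n (V := R_NormedModule) _ K).
  apply (ex_series_ext (V := R_NormedModule) (fun k => scal (x ^ K * D) (/ INR (fact k) * x ^ k))).
  - intros k. replace (K + k - K)%nat with k by lia. rewrite pow_add. unfold scal; cbn; unfold mult; cbn. ring.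
  - apply (ex_series_scal (V := R_NormedModule)). exists (exp x).
    apply (is_series_ext (V := R_NormedModule) (fun k => scal (pow_n x k) (/ INR (fact k)))).
    + intros k. rewrite pow_n_pow. unfold scal; cbn; unfold mult; cbn. ring.
    + apply is_exp_Reals.
Qed.

Lemma Om_local_bound (a0 b0 w : C) : exists M, ex_series M /\
  locally ((a0, b0) : C * C) (fun p => forall k, Cmod (Om_term (fst p) (snd p) w k) <= M k).
Proof.
  destruct (rgamma_local_bound a0) as (B1 & K1 & HB1 & L1).
  destruct (rgamma_local_bound b0) as (B2 & K2 & HB2 & L2).
  exists (fun k => Cmod w ^ k * ((B1 * B2) * / INR (fact (k - K2)))). split.
  - apply ex_series_shifted_exp, Cmod_ge_0.
  - assert (L1' : locally ((a0, b0) : C * C) (fun p => forall k, Cmod (rgamma (fst p + RtoC (INR k))%C) <= B1 * / INR (fact (k - K1))))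
      by exact (continuous_fst (U := C_UniformSpace) (V := C_UniformSpace) a0 b0 _ L1).
    assert (L2' : locally ((a0, b0) : C * C) (fun p => forall k, Cmod (rgamma (snd p + RtoC (INR k))%C) <= B2 * / INR (fact (k - K2))))
      by exact (continuous_snd (U := C_UniformSpace) (V := C_UniformSpace) a0 b0 _ L2).
    generalize (filter_and _ _ L1' L2'). apply filter_imp. intros p [H1 H2] k.
    unfold Om_term. rewrite !Cmod_mult, Cpown_Cmod. apply Rmult_le_compat_l; [apply pow_le, Cmod_ge_0|].
    rewrite Rmult_assoc. apply Rmult_le_compat; [apply Cmod_ge_0 | apply Cmod_ge_0 | | apply H2].
    eapply Rle_trans; [apply H1|]. rewrite <- (Rmult_1_r B1) at 2. apply Rmult_le_compat_l; [exact HB1|].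
    rewrite <- Rinv_1. apply Rinv_le_contravar; [lra|].
    change 1 with (INR 1). apply le_INR, lt_O_fact.
Qed.

Lemma Om_lim (a b w : C) : filterlim (psum (Om_term a b w)) eventually (locally (Om a b w)).
Proof.
  destruct (Om_local_bound a b w) as (M & HM & HL). apply locally_singleton in HL.
  apply (Cseries_lim _ M); auto.
Qed.

Lemma Om_flim {T : Type} {F : (T -> Prop) -> Prop} {FF : Filter F} (f g : T -> C) (a b w : C) :
  filterlim f F (locally a) -> filterlim g F (locally b) ->
  filterlim (fun t => Om (f t) (g t) w) F (locally (Om a b w)).
Proof.
  intros Hf Hg. destruct (Om_local_bound a b w) as (M & HM & HL).
  apply (Cseries_flim _ _ M HM).
  - assert (Hp : filterlim (fun t => (f t, g t) : C * C) F (locally ((a, b) : C * C))).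
    { apply (@filterlim_filter_le_2 _ _ F (filter_prod (locally a) (locally b))).
      - intros P [eps HP]. exists (ball a eps) (ball b eps); try apply locally_ball.
        intros x y Hx Hy. apply HP. now split.
      - now apply filterlim_pair. }
    exact (Hp _ HL).
  - now apply locally_singleton in HL.
  - intros k. apply flim_Cmult; [apply filterlim_const|]. apply flim_Cmult.
    + apply (filterlim_comp _ _ _ f (fun c => rgamma (c + RtoC (INR k))%C) _ (locally a)); [exact Hf | apply rgamma_shift_continuous].
    + apply (filterlim_comp _ _ _ g (fun c => rgamma (c + RtoC (INR k))%C) _ (locally b)); [exact Hg | apply rgamma_shift_continuous].
Qed.

Lemma Om_term_S (a b w : C) (n : nat) :
  Om_term a b w (S n) = (w * Om_term (a + RtoC 1) (b + RtoC 1) w n)%C.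
Proof.
  unfold Om_term. rewrite S_INR, RtoC_plus. simpl Cpown.
  replace (a + (RtoC (INR n) + RtoC 1))%C with (a + RtoC 1 + RtoC (INR n))%C by ring.
  replace (b + (RtoC (INR n) + RtoC 1))%C with (b + RtoC 1 + RtoC (INR n))%C by ring. ring.
Qed.

Lemma Om_step (a b w : C) : Om a b w = (rgamma a * rgamma b + w * Om (a + RtoC 1) (b + RtoC 1) w)%C.
Proof.
  apply Cseries_eq, (flim_seq_incr (U := C_UniformSpace)).
  apply (filterlim_ext (fun n => rgamma a * rgamma b + w * psum (Om_term (a + RtoC 1) (b + RtoC 1) w) n)%C).
  - induction x as [|n IH].
    + simpl. unfold Om_term. simpl. rewrite !Cplus_0_r. ring.
    + rewrite (psum_S (Om_term a b w) (S n)), <- IH, psum_S, Om_term_S. ring.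
  - apply flim_Cplus; [apply filterlim_const|]. apply flim_Cmult; [apply filterlim_const | apply Om_lim].
Qed.

(** ** Truncations of the Bessel-K integral *)

Definition Pint (nu : C) (a b : nat) (x u : R) : C :=
  (RtoC (Erem a (exp (x - u))) * Gam_integrand b nu u)%C.

Definition Pfun (nu : C) (a b : nat) (x : R) : C := LInt (Pint nu a b x).

(** Spending an exponent [r] on the first factor leaves [exp (r * x)] outside and the exponent
    [nu - r] in [u]; the two conditions on [b] then give decay at the two ends. The freedom in [r]
    controls the growth of [Pfun] in [x]. *)
Lemma Pint_dom (nu : C) (a b N N' : nat) (r d x : R) :
  0 < d -> adm a N r -> adm b N' (d - (Re nu - r)) -> adm b N' (- d - (Re nu - r)) ->
  dom (Erem_const a N * exp (r * x) * Erem_const b N') d (Pint nu a b x).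
Proof.
  intros Hd Ha H1 H2. split; [exact Hd|split].
  - intros u. apply continuous_Cmult; [|apply continuous_Cmult].
    + apply continuous_RtoC. apply (continuous_comp (fun u : R => x - u) (fun v => Erem a (exp v))).
      * apply continuous_Rminus; [apply continuous_const | apply continuous_id].
      * apply continuous_Erem_exp.
    + apply continuous_RtoC, continuous_Erem_exp.
    + eapply continuous_of_Cderive, is_Cderive_cexp_lin.
  - intros u. unfold Pint, Gam_integrand. rewrite !Cmod_mult, !Cmod_R, Cmod_cexp, Re_mult_RtoC.
    assert (Ea := Erem_exp_bound a N r (x - u) Ha).
    pose proof (Erem_const_pos a N) as Ka. pose proof (Erem_const_pos b N') as Kb.
    assert (Main : forall d', adm b N' (d' - (Re nu - r)) ->
      Rabs (Erem a (exp (x - u))) * (Rabs (Erem b (exp u)) * exp (Re nu * u)) <=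
      Erem_const a N * exp (r * x) * Erem_const b N' * exp (d' * u)).
    { intros d' Hd'. assert (Eb := Erem_exp_bound b N' _ u Hd').
      replace (Erem_const a N * exp (r * x) * Erem_const b N' * exp (d' * u)) with
        ((Erem_const a N * exp (r * (x - u))) * (Erem_const b N' * exp ((d' - (Re nu - r)) * u) * exp (Re nu * u))).
      - pose proof (exp_pos (Re nu * u)).
        apply Rmult_le_compat; [apply Rabs_pos | apply Rmult_le_pos; [apply Rabs_pos | lra] | exact Ea |].
        apply Rmult_le_compat_r; [lra | exact Eb].
      - replace (Erem_const a N * exp (r * (x - u)) * (Erem_const b N' * exp ((d' - (Re nu - r)) * u) * exp (Re nu * u)))
          with (Erem_const a N * Erem_const b N' * (exp (r * (x - u)) * exp ((d' - (Re nu - r)) * u) * exp (Re nu * u))) by ring.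
        rewrite <- !exp_plus.
        replace (r * (x - u) + (d' - (Re nu - r)) * u + Re nu * u) with (r * x + d' * u) by ring.
        rewrite exp_plus. ring. }
    destruct (Rle_dec u 0) as [Hu|Hu].
    + rewrite (Rabs_left1 u) by exact Hu. replace (- d * - u) with (d * u) by ring. now apply Main.
    + rewrite (Rabs_pos_eq u) by lra. now apply Main.
Qed.

Lemma Pfun_bound (nu : C) (a b N N' : nat) (r d x : R) :
  0 < d -> adm a N r -> adm b N' (d - (Re nu - r)) -> adm b N' (- d - (Re nu - r)) ->
  Cmod (Pfun nu a b x) <= 2 / d * (Erem_const a N * Erem_const b N') * exp (r * x).
Proof.
  intros Hd Ha H1 H2. eapply Rle_trans; [apply (LInt_bound _ _ _ (Pint_dom nu a b N N' r d x Hd Ha H1 H2))|].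
  right. field. lra.
Qed.

Lemma Pint_continuous (a b : nat) (nu : C) (x u : R) :
  @continuous (prod_UniformSpace (prod_UniformSpace C_UniformSpace R_UniformSpace) R_UniformSpace) C_UniformSpace
    (fun q => Pint (fst (fst q)) a b (snd (fst q)) (snd q)) ((nu, x), u).
Proof.
  assert (C1 : @continuous (prod_UniformSpace (prod_UniformSpace C_UniformSpace R_UniformSpace) R_UniformSpace) R_UniformSpace
     (fun q => snd q) ((nu, x), u)) by apply continuous_snd.
  assert (C2 : @continuous (prod_UniformSpace (prod_UniformSpace C_UniformSpace R_UniformSpace) R_UniformSpace) R_UniformSpace
     (fun q => snd (fst q)) ((nu, x), u)).
  { apply (continuous_comp (fun q : (C * R) * R => fst q) (fun p : C * R => snd p)); [apply continuous_fst | apply continuous_snd]. }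
  assert (C3 : @continuous (prod_UniformSpace (prod_UniformSpace C_UniformSpace R_UniformSpace) R_UniformSpace) C_UniformSpace
     (fun q => fst (fst q)) ((nu, x), u)).
  { apply (continuous_comp (fun q : (C * R) * R => fst q) (fun p : C * R => fst p)); [apply continuous_fst | apply continuous_fst]. }
  apply continuous_Cmult; [|apply continuous_Cmult].
  - apply continuous_RtoC. apply (continuous_comp (fun q : (C * R) * R => snd (fst q) - snd q) (fun v => Erem a (exp v))).
    + now apply continuous_Rminus.
    + apply continuous_Erem_exp.
  - apply continuous_RtoC. apply (continuous_comp (fun q : (C * R) * R => snd q) (fun v => Erem b (exp v))); [exact C1 | apply continuous_Erem_exp].
  - apply continuous_cexp, continuous_Cmult; [exact C3 | now apply continuous_RtoC].
Qed.

Lemma Pfun_continuous (a b N : nat) (nu : C) (r x : R) : adm a N r -> strip b (Re nu - r) ->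
  @continuous (prod_UniformSpace C_UniformSpace R_UniformSpace) C_UniformSpace
    (fun p => Pfun (fst p) a b (snd p)) (nu, x).
Proof.
  intros Ha Hs. destruct (strip_adm b _ Hs) as (d & N' & Hd & H).
  set (K := Erem_const a N * exp (Rabs r * (Rabs x + 1)) * Erem_const b N').
  apply (LInt_continuous (P := prod_UniformSpace C_UniformSpace R_UniformSpace)
           (fun p => Pint (fst p) a b (snd p)) (nu, x) K d).
  - intros u. apply Pint_continuous.
  - assert (He : 0 < Rmin d 1) by (apply Rmin_pos; lra). exists (mkposreal _ He).
    intros [nu' x'] [[Hn _] Hx]. cbn [fst snd] in *.
    apply R_ball_Rabs in Hn. apply R_ball_Rabs in Hx. cbn [pos] in Hn, Hx.
    assert (Hn' : Rabs (Re nu' - r - (Re nu - r)) <= d).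
    { replace (Re nu' - r - (Re nu - r)) with (Re nu' - Re nu) by ring. left.
      eapply Rlt_le_trans; [exact Hn | apply Rmin_l]. }
    destruct (H _ Hn') as [H1 H2].
    eapply dom_weaken; [apply (Pint_dom nu' a b N N' r d x' Hd Ha H1 H2)| |lra].
    unfold K. pose proof (Erem_const_pos a N). pose proof (Erem_const_pos b N').
    apply Rmult_le_compat_r; [lra|]. apply Rmult_le_compat_l; [lra|].
    apply exp_le. eapply Rle_trans; [apply Rle_abs|]. rewrite Rabs_mult.
    apply Rmult_le_compat_l; [apply Rabs_pos|].
    assert (Rabs (x' - x) < 1) by (eapply Rlt_le_trans; [exact Hx | apply Rmin_r]).
    replace x' with (x + (x' - x)) by ring. eapply Rle_trans; [apply Rabs_triang|]. lra.
Qed.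

Lemma LInt_reflect_shift (h : R -> C) (K d x : R) : dom K d h ->
  (exists K' d', dom K' d' (fun u => h (x - u))) /\ LInt (fun u => h (x - u)) = LInt h.
Proof.
  intros Hh. assert (D := dom_reflect _ _ _ Hh). assert (D2 := dom_shift _ (- x) _ _ D).
  assert (E : (fun u => h (x - u)) = (fun u => (fun v => h (- v)) (u + - x))).
  { apply functional_extensionality. intros u. f_equal. ring. }
  rewrite E. split; [now eexists; eexists; apply D2|].
  rewrite (LInt_shift (fun v => h (- v)) (- x) _ _ D). apply (LInt_reflect _ _ _ Hh).
Qed.

Lemma RtoC_pow_neg_exp (a : nat) (v : R) : RtoC ((- exp v) ^ a / INR (fact a)) =
  (RtoC ((-1) ^ a / INR (fact a)) * cexp (RtoC (INR a) * RtoC v))%C.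
Proof.
  rewrite <- RtoC_mult, cexp_R, exp_nat, <- RtoC_mult. f_equal.
  replace (- exp v) with ((-1) * exp v) by ring. rewrite Rpow_mult_distr. unfold Rdiv. ring.
Qed.

(** The next Taylor term of the first exponential is a multiple of [exp (a * (x - u))], so against
    the second factor it integrates to a Gamma value at [nu - a]. Integrability of the new integrand
    is inherited as that of a difference. *)
Lemma Pfun_step_a (nu : C) (a b : nat) (x : R) : (exists K d, dom K d (Pint nu a b x)) ->
  strip b (Re nu - INR a) ->
  (exists K d, dom K d (Pint nu (S a) b x)) /\
  Pfun nu a b x = (RtoC ((-1) ^ a / INR (fact a)) * cexp (RtoC (INR a) * RtoC x) * Gam b (nu - RtoC (INR a))
                   + Pfun nu (S a) b x)%C.
Proof.
  intros (K & d & D) Hs.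
  assert (Hs' : strip b (Re (nu - RtoC (INR a))%C)) by (destruct nu; simpl in *; exact Hs).
  destruct (strip_dom b _ Hs') as (K' & d' & D').
  set (c := (RtoC ((-1) ^ a / INR (fact a)) * cexp (RtoC (INR a) * RtoC x))%C).
  assert (Dc := dom_Cmult c _ _ _ D').
  assert (E : forall u, Pint nu (S a) b x u = (Pint nu a b x u - c * Gam_integrand b (nu - RtoC (INR a)) u)%C).
  { intros u. unfold Pint, Gam_integrand. simpl Erem. rewrite RtoC_minus, RtoC_pow_neg_exp.
    replace ((nu - RtoC (INR a)) * RtoC u)%C with (nu * RtoC u + - (RtoC (INR a) * RtoC u))%C by ring.
    replace (RtoC (INR a) * RtoC (x - u))%C with (RtoC (INR a) * RtoC x + - (RtoC (INR a) * RtoC u))%C by (rewrite RtoC_minus; ring).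
    rewrite !cexp_add. unfold c. ring. }
  assert (DE := dom_minus _ _ _ _ _ _ D Dc). cbv beta in DE.
  rewrite <- (functional_extensionality _ _ E) in DE. split; [eexists; eexists; exact DE|].
  unfold Pfun. rewrite (LInt_ext _ _ E), (LInt_minus _ _ _ _ _ _ D Dc), (LInt_Cmult _ _ _ _ D').
  fold (Gam b (nu - RtoC (INR a))%C) c. ring.
Qed.

(** The same for the second exponential, after the reflection [u -> x - u] exchanges the two
    factors. *)
Lemma Pfun_step_b (nu : C) (a b : nat) (x : R) : (exists K d, dom K d (Pint nu a b x)) ->
  strip a (- Re nu - INR b) ->
  (exists K d, dom K d (Pint nu a (S b) x)) /\
  Pfun nu a b x = (RtoC ((-1) ^ b / INR (fact b)) * cexp ((nu + RtoC (INR b)) * RtoC x) * Gam a (- nu - RtoC (INR b))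
                   + Pfun nu a (S b) x)%C.
Proof.
  intros (K & d & D) Hs.
  assert (Hs' : strip a (Re (- nu - RtoC (INR b))%C)) by (destruct nu; simpl in *; exact Hs).
  destruct (strip_dom a _ Hs') as (K' & d' & D').
  destruct (LInt_reflect_shift _ _ _ x D') as [(K2 & d2 & D2) EI].
  set (c := (RtoC ((-1) ^ b / INR (fact b)) * cexp ((nu + RtoC (INR b)) * RtoC x))%C).
  assert (Dc := dom_Cmult c _ _ _ D2).
  assert (E : forall u, Pint nu a (S b) x u = (Pint nu a b x u - c * Gam_integrand a (- nu - RtoC (INR b)) (x - u))%C).
  { intros u. unfold Pint, Gam_integrand. simpl Erem. rewrite RtoC_minus, RtoC_pow_neg_exp.
    replace ((- nu - RtoC (INR b)) * RtoC (x - u))%C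
      with (nu * RtoC u + RtoC (INR b) * RtoC u + - ((nu + RtoC (INR b)) * RtoC x))%C by (rewrite RtoC_minus; ring).
    unfold c. rewrite !cexp_add, cexp_opp.
    pose proof (cexp_neq_0 ((nu + RtoC (INR b)) * RtoC x)%C). field. assumption. }
  assert (DE := dom_minus _ _ _ _ _ _ D Dc). cbv beta in DE.
  rewrite <- (functional_extensionality _ _ E) in DE. split; [eexists; eexists; exact DE|].
  unfold Pfun. rewrite (LInt_ext _ _ E), (LInt_minus _ _ _ _ _ _ D Dc), (LInt_Cmult _ _ _ _ D2), EI.
  fold (Gam a (- nu - RtoC (INR b))%C) c. ring.
Qed.

(** [exp (be * x) * Pfun (al - be) a b x] is the convolution of the Gamma integrands with exponents
    [be] and [al], so its integral is a product. *)
Lemma Pfun_Mellin (al be : C) (a b : nat) : strip a (Re be) -> strip b (Re al) ->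
  (exists K d, dom K d (fun x => cexp (be * RtoC x) * Pfun (al - be) a b x)%C) /\
  LInt (fun x => cexp (be * RtoC x) * Pfun (al - be) a b x)%C = (Gam a be * Gam b al)%C.
Proof.
  intros Ha Hb. destruct (strip_dom a be Ha) as (K1 & d1 & D1). destruct (strip_dom b al Hb) as (K2 & d2 & D2).
  assert (Hm : 0 < Rmin d1 d2) by (apply Rmin_pos; [apply D1 | apply D2]).
  assert (D1' := dom_weaken _ _ _ (Rmax K1 K2) (Rmin d1 d2) D1 (Rmax_l _ _) (conj Hm (Rmin_l _ _))).
  assert (D2' := dom_weaken _ _ _ (Rmax K1 K2) (Rmin d1 d2) D2 (Rmax_r _ _) (conj Hm (Rmin_r _ _))).
  assert (E : forall x, LInt (fun u => Gam_integrand a be (x - u) * Gam_integrand b al u)%C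
     = (cexp (be * RtoC x) * Pfun (al - be) a b x)%C).
  { intros x. assert (Di := dom_convolution_integrand _ _ _ _ D1' D2' x).
    assert (EI : Pfun (al - be) a b x = (cexp (- (be * RtoC x)) * LInt (fun u => Gam_integrand a be (x - u) * Gam_integrand b al u))%C).
    { rewrite <- (LInt_Cmult _ _ _ _ Di). apply LInt_ext. intros u. unfold Pint, Gam_integrand.
      replace ((al - be) * RtoC u)%C with (al * RtoC u + - (be * RtoC u))%C by ring.
      replace (be * RtoC (x - u))%C with (be * RtoC x + - (be * RtoC u))%C by (rewrite RtoC_minus; ring).
      rewrite !cexp_add, !cexp_opp. pose proof (cexp_neq_0 (be * RtoC x)%C). pose proof (cexp_neq_0 (be * RtoC u)%C).
      field. auto. }
    rewrite EI, Cmult_assoc, <- cexp_add.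
    replace (be * RtoC x + - (be * RtoC x))%C with (RtoC 0) by ring. rewrite cexp_0. ring. }
  assert (DC := dom_convolution _ _ _ _ D1' D2').
  rewrite (functional_extensionality _ _ E) in DC. split; [eexists; eexists; exact DC|].
  rewrite <- (LInt_ext _ _ E). apply (LInt_convolution _ _ _ _ D1' D2').
Qed.

(** ** Values of the residues *)

Lemma Gam_value (m : nat) (c : C) : strip m (Re c) -> csin (c * RtoC PI)%C <> RtoC 0 ->
  Gam m c = (RtoC PI * rgamma (RtoC 1 - c) / csin (c * RtoC PI))%C.
Proof.
  intros Hs Hn. assert (H := rgamma_Gam m c Hs). rewrite <- rgamma_reflection in Hn |- *.
  assert (rgamma c <> RtoC 0) by (intros E; apply Hn; rewrite E; ring).
  assert (rgamma (RtoC 1 - c)%C <> RtoC 0) by (intros E; apply Hn; rewrite E; ring).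
  assert (RtoC PI <> RtoC 0) by (apply RtoC_neq_0; pose proof PI_RGT_0; lra).
  apply (Cmult_reg_r _ _ (rgamma c)); [assumption|]. rewrite Cmult_comm, H. field. auto.
Qed.

Lemma csin_PI_minus_nat (z : C) (n : nat) : csin ((z - RtoC (INR n)) * RtoC PI)%C = (RtoC ((-1) ^ n) * csin (z * RtoC PI))%C.
Proof.
  induction n as [|n IH].
  - simpl. replace (z - RtoC 0)%C with z by ring. ring.
  - rewrite S_INR, RtoC_plus. replace (z - (RtoC (INR n) + RtoC 1))%C with (z - RtoC (INR n) - RtoC 1)%C by ring.
    rewrite csin_PI_minus_1, IH. simpl. rewrite RtoC_mult. ring.
Qed.

Lemma RtoC_sign_sqr (n : nat) : (RtoC ((-1) ^ n) * RtoC ((-1) ^ n))%C = RtoC 1.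
Proof. rewrite <- RtoC_mult, <- Rpow_mult_distr. f_equal. replace (-1 * -1) with 1 by ring. apply pow1. Qed.

Lemma RtoC_sign_neq_0 (n : nat) : RtoC ((-1) ^ n) <> RtoC 0.
Proof. apply RtoC_neq_0, pow_nonzero. lra. Qed.

(** [Gam_value] introduces [csin ((nu - a) * PI)], whose sign cancels that of the Taylor
    coefficient, while [1 / a!] is [rgamma (1 + a)]: what remains is a term of [Om]. *)
Lemma residue_a (nu : C) (a b : nat) (x : R) : strip b (Re nu - INR a) -> csin (nu * RtoC PI)%C <> RtoC 0 ->
  (RtoC ((-1) ^ a / INR (fact a)) * cexp (RtoC (INR a) * RtoC x) * Gam b (nu - RtoC (INR a)))%C =
  (RtoC PI / csin (nu * RtoC PI) * Om_term (RtoC 1) (RtoC 1 - nu) (RtoC (exp x)) a)%C.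
Proof.
  intros Hs Hn. pose proof (RtoC_sign_sqr a) as Hsq. pose proof (RtoC_sign_neq_0 a) as Hsn.
  rewrite Gam_value.
  2: { destruct nu; simpl in *; exact Hs. }
  2: { rewrite csin_PI_minus_nat. now apply Cmult_neq_0. }
  rewrite csin_PI_minus_nat, cexp_nat, cexp_R. unfold Om_term.
  replace (RtoC 1 + RtoC (INR a))%C with (RtoC (INR a + 1)) by (rewrite RtoC_plus; ring).
  rewrite rgamma_nat. unfold Rdiv. rewrite RtoC_mult.
  replace (RtoC 1 - (nu - RtoC (INR a)))%C with (RtoC 1 - nu + RtoC (INR a))%C by ring.
  field. auto.
Qed.

Lemma residue_b (nu : C) (a b : nat) (x : R) : strip a (- Re nu - INR b) -> csin (nu * RtoC PI)%C <> RtoC 0 ->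
  (RtoC ((-1) ^ b / INR (fact b)) * cexp ((nu + RtoC (INR b)) * RtoC x) * Gam a (- nu - RtoC (INR b)))%C =
  (- (RtoC PI / csin (nu * RtoC PI)) * cexp (nu * RtoC x) * Om_term (RtoC 1) (RtoC 1 + nu) (RtoC (exp x)) b)%C.
Proof.
  intros Hs Hn. pose proof (RtoC_sign_neq_0 b) as Hsn.
  assert (Hc : csin (- nu * RtoC PI)%C = (- csin (nu * RtoC PI))%C).
  { replace (- nu * RtoC PI)%C with (- (nu * RtoC PI))%C by ring. apply csin_opp. }
  assert (Hn' : (- csin (nu * RtoC PI))%C <> RtoC 0).
  { intros E. apply Hn. replace (csin (nu * RtoC PI)) with (- - csin (nu * RtoC PI))%C by ring. rewrite E. ring. }
  rewrite Gam_value.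
  2: { destruct nu; simpl in *; exact Hs. }
  2: { rewrite csin_PI_minus_nat, Hc. now apply Cmult_neq_0. }
  rewrite csin_PI_minus_nat, Hc.
  replace ((nu + RtoC (INR b)) * RtoC x)%C with (nu * RtoC x + RtoC (INR b) * RtoC x)%C by ring.
  rewrite cexp_add, cexp_nat, cexp_R. unfold Om_term.
  replace (RtoC 1 + RtoC (INR b))%C with (RtoC (INR b + 1)) by (rewrite RtoC_plus; ring).
  rewrite rgamma_nat. unfold Rdiv. rewrite RtoC_mult.
  replace (RtoC 1 - (- nu - RtoC (INR b)))%C with (RtoC 1 + nu + RtoC (INR b))%C by ring.
  field. auto.
Qed.

Lemma psum_Cmult (c : C) (f : nat -> C) (K : nat) : psum (fun k => c * f k)%C K = (c * psum f K)%C.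
Proof. induction K as [|K IH]; simpl; [ring | rewrite IH; ring]. Qed.

Lemma psum_ext (f g : nat -> C) (K : nat) : (forall k, f k = g k) -> psum f K = psum g K.
Proof. intros H. induction K as [|K IH]; simpl; [reflexivity | now rewrite IH, H]. Qed.

(** Leading zeros let series that start contributing at different stages of one induction share its
    index. *)
Definition delayed (m : nat) (f : nat -> C) (k : nat) : C := if (k <? m)%nat then RtoC 0 else f (k - m)%nat.

Lemma psum_delayed (m : nat) (f : nat -> C) (K : nat) : psum (delayed m f) K = psum f (K - m).
Proof.
  induction K as [|K IH]; [reflexivity|]. simpl psum at 1. rewrite IH. unfold delayed.
  destruct (Nat.ltb_spec K m) as [H|H].
  - replace (S K - m)%nat with (K - m)%nat by lia. ring.
  - replace (S K - m)%nat with (S (K - m)) by lia. reflexivity.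
Qed.

Lemma psum_delayed_lim (m : nat) (f : nat -> C) (l : C) : filterlim (psum f) eventually (locally l) ->
  filterlim (psum (delayed m f)) eventually (locally l).
Proof.
  intros H. apply (filterlim_ext (fun K => psum f (K - m))); [intros; symmetry; apply psum_delayed|].
  apply (filterlim_comp _ _ _ (fun K => (K - m)%nat) (psum f) _ eventually); [|exact H].
  intros P [N HN]. exists (N + m)%nat. intros n Hn. apply HN. lia.
Qed.

Lemma INR_sub (k n : nat) : (n <= k)%nat -> INR (k - n) = INR k - INR n.
Proof. apply minus_INR. Qed.

(** This lemma and the next ones compare the truncated [k - n] with [INR k - INR n]: while [k < n]
    the order is 0 and only positivity matters; afterwards the strip of index [k - n] is met
    exactly. *)
Lemma strip_sub_lt (k n : nat) (t : R) : (k < n)%nat -> -1 < t -> strip (k - n) (INR n - INR k + t).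
Proof.
  intros H Ht. replace (k - n)%nat with O by lia. simpl.
  assert (INR k + 1 <= INR n) by (rewrite <- S_INR; apply le_INR; lia). lra.
Qed.

Lemma strip_sub_ge (k n : nat) (t : R) : (n <= k)%nat -> 0 < t < 1 -> strip (k - n) (INR n - INR k + t).
Proof.
  intros H Ht. assert (E := INR_sub k n H). destruct (k - n)%nat as [|j].
  - simpl in *. lra.
  - rewrite S_INR in E. simpl. lra.
Qed.

Lemma strip_sub_S (k n : nat) (t : R) : (n <= k)%nat -> -1 < t < 0 -> strip (S (k - n)) (INR n - INR k + t).
Proof. intros H Ht. assert (E := INR_sub k n H). simpl. lra. Qed.

Lemma adm_sub (k n N : nat) (t : R) : -2 <= t <= 0 -> ((n <= k)%nat -> -1 <= t) -> (n + 2 <= N)%nat ->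
  adm (k - n) N (INR k - INR n + t).
Proof.
  intros H1 H2 HN. destruct (Nat.le_gt_cases n k) as [H|H].
  - specialize (H2 H). assert (E := INR_sub k n H).
    apply le_INR in HN. rewrite plus_INR in HN. simpl in HN. pose proof (pos_INR n).
    destruct (k - n)%nat as [|j]; simpl in *; [lra|].
    change (match j with O => 1 | S _ => INR j + 1 end) with (INR (S j)) in E. rewrite S_INR in E. lra.
  - replace (k - n)%nat with O by lia. simpl.
    apply le_INR in HN. rewrite plus_INR in HN. simpl in HN. pose proof (pos_INR k).
    assert (INR k + 1 <= INR n) by (rewrite <- S_INR; apply le_INR; lia). lra.
Qed.

(** * Complete expansion of the Bessel-K integral *)

Section Truncation.
Variables (al be : C) (m n : nat) (phi psi : R).
Hypotheses (Hphi : 0 < phi < 1) (Hpsi : 0 < psi < 1) (Hne : phi <> psi)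
  (Hbe : Re be = INR m + phi) (Hal : Re al = INR n + psi)
  (Hsin : csin ((al - be) * RtoC PI)%C <> RtoC 0).

Let nu : C := (al - be)%C.

(** The subtractions are truncated: the two factors stay [exp (- w)] until [k] exceeds [m], resp. [n]. *)
Definition Ptrunc (k : nat) (x : R) : C := Pfun (al - be) (k - m) (k - n) x.

Lemma Re_nu_trunc : Re nu = INR n + psi - (INR m + phi).
Proof. unfold nu. rewrite <- Hal, <- Hbe. destruct al, be; reflexivity. Qed.

(** The growth exponent [k - Re be + rho] is meant for the outer integral, where the factor
    [exp ((be - k) x)] leaves only [exp (rho * x)]. The orders [m + 2] and [n + 2] cover the worst
    negative exponents while a factor is still unsubtracted. *)
Lemma Ptrunc_adm (k : nat) (rho d : R) : phi - 1 <= rho <= phi -> psi - 1 < rho < psi ->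
  0 < d -> d <= psi - rho -> d <= 1 - (psi - rho) ->
  adm (k - m) (m + 2) (INR k - Re be + rho) /\
  adm (k - n) (n + 2) (d - (Re nu - (INR k - Re be + rho))) /\
  adm (k - n) (n + 2) (- d - (Re nu - (INR k - Re be + rho))).
Proof.
  intros H1 H2 Hd H3 H4. rewrite Re_nu_trunc, Hbe. split; [|split].
  - replace (INR k - (INR m + phi) + rho) with (INR k - INR m + (rho - phi)) by ring.
    apply adm_sub; [lra | intros; lra | lia].
  - replace (d - _) with (INR k - INR n + (d - (psi - rho))) by ring.
    apply adm_sub; [lra | intros; lra | lia].
  - replace (- d - _) with (INR k - INR n + (- d - (psi - rho))) by ring.
    apply adm_sub; [lra | intros; lra | lia].
Qed.

Lemma Ptrunc_bound (k : nat) (rho d x : R) : phi - 1 <= rho <= phi -> psi - 1 < rho < psi ->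
  0 < d -> d <= psi - rho -> d <= 1 - (psi - rho) ->
  Cmod (Ptrunc k x) <=
    2 / d * (Erem_const (k - m) (m + 2) * Erem_const (k - n) (n + 2)) * exp ((INR k - Re be + rho) * x).
Proof.
  intros H1 H2 Hd H3 H4. destruct (Ptrunc_adm k rho d H1 H2 Hd H3 H4) as (A1 & A2 & A3).
  exact (Pfun_bound nu (k - m) (k - n) (m + 2) (n + 2) (INR k - Re be + rho) d x Hd A1 A2 A3).
Qed.

Lemma Pint_trunc_dom (k : nat) (x : R) : exists K d, dom K d (Pint nu (k - m) (k - n) x).
Proof.
  set (rho := Rmin phi psi / 2).
  assert (M1 := Rmin_l phi psi). assert (M2 := Rmin_r phi psi). assert (M3 : 0 < Rmin phi psi) by (apply Rmin_pos; lra).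
  set (d := Rmin (psi - rho) (1 - (psi - rho))).
  assert (Hd : 0 < d) by (apply Rmin_pos; unfold rho; lra).
  destruct (Ptrunc_adm k rho d) as (A1 & A2 & A3); try (unfold rho; lra); try assumption.
  - apply Rmin_l.
  - apply Rmin_r.
  - eexists. exists d. apply (Pint_dom nu (k - m) (k - n) (m + 2) (n + 2) (INR k - Re be + rho) d x); assumption.
Qed.

Definition res_a (x : R) (i : nat) : C :=
  (RtoC PI / csin (nu * RtoC PI) * Om_term (RtoC 1) (RtoC 1 - nu) (RtoC (exp x)) i)%C.
Definition res_b (x : R) (i : nat) : C :=
  (- (RtoC PI / csin (nu * RtoC PI)) * cexp (nu * RtoC x) * Om_term (RtoC 1) (RtoC 1 + nu) (RtoC (exp x)) i)%C.

(** The two truncation orders are raised one at a time; which one has to come first, so that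
    the intermediate integral converges, depends on the sign of [psi - phi]. *)
Lemma Ptrunc_step (k : nat) (x : R) :
  Ptrunc k x = (delayed m (res_a x) k + delayed n (res_b x) k + Ptrunc (S k) x)%C.
Proof.
  assert (Hr := Re_nu_trunc). assert (D := Pint_trunc_dom k x). unfold Ptrunc. fold nu. unfold delayed.
  assert (Sa : forall b, (m <= k)%nat -> strip b (INR n - INR k + (psi - phi)) -> strip b (Re nu - INR (k - m))).
  { intros b H Hs. rewrite INR_sub, Hr by exact H.
    replace (INR n + psi - (INR m + phi) - (INR k - INR m)) with (INR n - INR k + (psi - phi)) by ring. exact Hs. }
  assert (Sb : forall a, (n <= k)%nat -> strip a (INR m - INR k + (phi - psi)) -> strip a (- Re nu - INR (k - n))).
  { intros a H Hs. rewrite INR_sub, Hr by exact H.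
    replace (- (INR n + psi - (INR m + phi)) - (INR k - INR n)) with (INR m - INR k + (phi - psi)) by ring. exact Hs. }
  unfold res_a, res_b.
  destruct (Nat.ltb_spec k m) as [Hm|Hm]; destruct (Nat.ltb_spec k n) as [Hn|Hn].
  - replace (S k - m)%nat with (k - m)%nat by lia. replace (S k - n)%nat with (k - n)%nat by lia. ring.
  - replace (S k - m)%nat with (k - m)%nat by lia. replace (S k - n)%nat with (S (k - n)) by lia.
    assert (St : strip (k - m) (- Re nu - INR (k - n))) by (apply Sb; [exact Hn | apply strip_sub_lt; [exact Hm | lra]]).
    destruct (Pfun_step_b nu (k - m) (k - n) x D St) as [_ E]. rewrite E, (residue_b _ _ _ _ St Hsin). ring.
  - replace (S k - m)%nat with (S (k - m)) by lia. replace (S k - n)%nat with (k - n)%nat by lia.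
    assert (St : strip (k - n) (Re nu - INR (k - m))) by (apply Sa; [exact Hm | apply strip_sub_lt; [exact Hn | lra]]).
    destruct (Pfun_step_a nu (k - m) (k - n) x D St) as [_ E]. rewrite E, (residue_a _ _ _ _ St Hsin). ring.
  - replace (S k - m)%nat with (S (k - m)) by lia. replace (S k - n)%nat with (S (k - n)) by lia.
    destruct (Rlt_dec phi psi) as [Hlt|Hlt].
    + assert (St : strip (k - n) (Re nu - INR (k - m))) by (apply Sa; [exact Hm | apply strip_sub_ge; [exact Hn | lra]]).
      assert (St2 : strip (S (k - m)) (- Re nu - INR (k - n))) by (apply Sb; [exact Hn | apply strip_sub_S; [exact Hm | lra]]).
      destruct (Pfun_step_a nu (k - m) (k - n) x D St) as [D2 E]. rewrite E, (residue_a _ _ _ _ St Hsin).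
      destruct (Pfun_step_b nu (S (k - m)) (k - n) x D2 St2) as [_ E2]. rewrite E2, (residue_b _ _ _ _ St2 Hsin). ring.
    + assert (St : strip (k - m) (- Re nu - INR (k - n))) by (apply Sb; [exact Hn | apply strip_sub_ge; [exact Hm | lra]]).
      assert (St2 : strip (S (k - n)) (Re nu - INR (k - m))) by (apply Sa; [exact Hm | apply strip_sub_S; [exact Hn | lra]]).
      destruct (Pfun_step_b nu (k - m) (k - n) x D St) as [D2 E]. rewrite E, (residue_b _ _ _ _ St Hsin).
      destruct (Pfun_step_a nu (k - m) (S (k - n)) x D2 St2) as [_ E2]. rewrite E2, (residue_a _ _ _ _ St2 Hsin). ring.
Qed.

Lemma Ptrunc_telescope (K : nat) (x : R) :
  Ptrunc 0 x = (psum (delayed m (res_a x)) K + psum (delayed n (res_b x)) K + Ptrunc K x)%C.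
Proof.
  induction K as [|K IH]; [simpl psum; ring|]. rewrite IH, (Ptrunc_step K x). simpl psum. ring.
Qed.

(** For [k > m + n] both constants are inverse factorials; the first alone beats [X ^ k], and the
    second is at most 1. *)
Lemma Erem_const_product_small (X D : R) : 0 <= X ->
  filterlim (fun k => D * (Erem_const (k - m) (m + 2) * Erem_const (k - n) (n + 2)) * X ^ k) eventually (locally 0).
Proof.
  intros HX. assert (HS := ex_series_lim_0 _ (ex_series_shifted_exp X (Rabs D) (S m) HX)).
  assert (HS' : filterlim (fun k => X ^ k * (Rabs D * / INR (fact (k - S m)))) eventually (locally 0)) by exact HS.
  apply filterlim_locally. intros eps.
  assert (HN : eventually (fun k => (m + n + 1 <= k)%nat)) by (exists (m + n + 1)%nat; auto).
  generalize (filter_and _ _ HN (proj1 (filterlim_locally _ _) HS' eps)). apply filter_imp.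
  intros k [Hk B]. apply R_ball_Rabs in B. rewrite Rminus_0_r in B.
  change (Rabs (D * (Erem_const (k - m) (m + 2) * Erem_const (k - n) (n + 2)) * X ^ k - 0) < eps).
  rewrite Rminus_0_r. eapply Rle_lt_trans; [|exact B].
  pose proof (pow_le X k HX).
  rewrite !Rabs_mult, !(Rabs_pos_eq (X ^ k)) by assumption. rewrite Rabs_Rabsolu, Rmult_comm.
  apply Rmult_le_compat_l; [assumption|]. apply Rmult_le_compat_l; [apply Rabs_pos|].
  rewrite (Rabs_pos_eq (Erem_const (k - m) (m + 2))) by (left; apply Erem_const_pos).
  rewrite (Rabs_pos_eq (Erem_const (k - n) (n + 2))) by (left; apply Erem_const_pos).
  replace (k - m)%nat with (S (k - S m)) by lia. replace (k - n)%nat with (S (k - S n)) by lia.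
  simpl Erem_const.
  assert (P : 0 < / INR (fact (k - S m))) by (apply Rinv_0_lt_compat, INR_fact_lt_0).
  rewrite Rabs_pos_eq by lra. rewrite <- Rmult_1_r. apply Rmult_le_compat_l; [lra|].
  rewrite <- Rinv_1. apply Rinv_le_contravar; [lra|]. change 1 with (INR 1). apply le_INR, lt_O_fact.
Qed.

Lemma Ptrunc_lim (x : R) : filterlim (fun K => Ptrunc K x) eventually (locally (RtoC 0)).
Proof.
  set (rho := Rmin phi psi / 2).
  assert (M1 := Rmin_l phi psi). assert (M2 := Rmin_r phi psi). assert (M3 : 0 < Rmin phi psi) by (apply Rmin_pos; lra).
  set (d := Rmin (psi - rho) (1 - (psi - rho))).
  assert (Hd : 0 < d) by (apply Rmin_pos; unfold rho; lra).
  apply (flim_squeeze _ _ (fun K => 2 / d * exp ((rho - Re be) * x) * (Erem_const (K - m) (m + 2) * Erem_const (K - n) (n + 2)) * exp x ^ K)).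
  - apply filter_forall. intros K. replace (Ptrunc K x - RtoC 0)%C with (Ptrunc K x) by ring.
    eapply Rle_trans; [apply (Ptrunc_bound K rho d x); try (unfold rho; lra); try assumption; [apply Rmin_l | apply Rmin_r]|].
    right. rewrite <- exp_nat.
    replace ((INR K - Re be + rho) * x) with ((rho - Re be) * x + INR K * x) by ring. rewrite exp_plus. ring.
  - apply Erem_const_product_small. left. apply exp_pos.
Qed.

(** The telescoped sum in the limit: the two families of residues fill two series and the truncated
    integral disappears by [Ptrunc_lim]. *)
Lemma Ptrunc_0_series (x : R) :
  Ptrunc 0 x = (RtoC PI / csin (nu * RtoC PI) *
    (Om (RtoC 1) (RtoC 1 - nu) (RtoC (exp x)) - cexp (nu * RtoC x) * Om (RtoC 1) (RtoC 1 + nu) (RtoC (exp x))))%C.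
Proof.
  set (S := (RtoC PI / csin (nu * RtoC PI))%C).
  assert (L1 : filterlim (psum (delayed m (res_a x))) eventually (locally (S * Om (RtoC 1) (RtoC 1 - nu) (RtoC (exp x)))%C)).
  { apply psum_delayed_lim. apply (filterlim_ext (fun K => S * psum (Om_term (RtoC 1) (RtoC 1 - nu) (RtoC (exp x))) K)%C).
    - intros K. symmetry. apply psum_Cmult.
    - apply flim_Cmult; [apply filterlim_const | apply Om_lim]. }
  assert (L2 : filterlim (psum (delayed n (res_b x))) eventually (locally (- S * cexp (nu * RtoC x) * Om (RtoC 1) (RtoC 1 + nu) (RtoC (exp x)))%C)).
  { apply psum_delayed_lim. apply (filterlim_ext (fun K => (- S * cexp (nu * RtoC x)) * psum (Om_term (RtoC 1) (RtoC 1 + nu) (RtoC (exp x))) K)%C).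
    - intros K. symmetry. apply psum_Cmult.
    - apply flim_Cmult; [apply filterlim_const | apply Om_lim]. }
  assert (L := flim_Cplus _ _ _ _ (flim_Cplus _ _ _ _ L1 L2) (Ptrunc_lim x)).
  apply (flim_unique (F := eventually) (fun _ => Ptrunc 0 x)); [apply filterlim_const|].
  replace (S * (Om (RtoC 1) (RtoC 1 - nu) (RtoC (exp x)) - cexp (nu * RtoC x) * Om (RtoC 1) (RtoC 1 + nu) (RtoC (exp x))))%C
    with (S * Om (RtoC 1) (RtoC 1 - nu) (RtoC (exp x)) + - S * cexp (nu * RtoC x) * Om (RtoC 1) (RtoC 1 + nu) (RtoC (exp x)) + RtoC 0)%C by ring.
  revert L. apply filterlim_ext. intros K. symmetry. apply Ptrunc_telescope.
Qed.

End Truncation.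

(** A small positive [e] moves any real off the integers. The slope [c] is free because several
    combinations of parameters must avoid the integers along a single path. *)
Lemma right_noninteger (s c : R) : c <> 0 ->
  at_right 0 (fun e => exists k : Z, IZR k < s + c * e < IZR k + 1).
Proof.
  intros Hc. destruct (Rlt_dec 0 c) as [Hp|Hp].
  - destruct (archimed s) as [H1 H2].
    assert (He : 0 < (IZR (up s) - s) / c) by (apply Rdiv_lt_0_compat; lra).
    exists (mkposreal _ He). intros e Be He0. apply R_ball_Rabs in Be. rewrite Rminus_0_r, Rabs_pos_eq in Be by lra.
    simpl in Be. exists (up s - 1)%Z. rewrite minus_IZR.
    assert (c * e < IZR (up s) - s).
    { apply Rmult_lt_compat_l with (r := c) in Be; [|exact Hp].
      replace (c * ((IZR (up s) - s) / c)) with (IZR (up s) - s) in Be by (field; lra). exact Be. }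
    nra.
  - destruct (archimed (- s)) as [H1 H2].
    assert (He : 0 < (s + IZR (up (- s))) / - c) by (apply Rdiv_lt_0_compat; lra).
    exists (mkposreal _ He). intros e Be He0. apply R_ball_Rabs in Be. rewrite Rminus_0_r, Rabs_pos_eq in Be by lra.
    simpl in Be. exists (- up (- s))%Z. rewrite opp_IZR.
    assert (- c * e < s + IZR (up (- s))).
    { apply Rmult_lt_compat_l with (r := - c) in Be; [|lra].
      replace (- c * ((s + IZR (up (- s))) / - c)) with (s + IZR (up (- s))) in Be by (field; lra). exact Be. }
    nra.
Qed.

Lemma flim_csin {T : Type} {F : (T -> Prop) -> Prop} {FF : Filter F} (f : T -> C) (a : C) :
  filterlim f F (locally a) -> filterlim (fun x => csin (f x)) F (locally (csin a)).
Proof.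
  intros H. unfold csin. apply flim_Cdiv.
  - apply Cmult_neq_0; [apply C2_neq_0 | apply Ci_neq_0].
  - apply flim_Cminus; apply flim_cexp; [|apply flim_Copp]; (apply flim_Cmult; [apply filterlim_const | exact H]).
  - apply filterlim_const.
Qed.

Lemma flim_right_shift (a : C) (c : R) :
  filterlim (fun e : R => a + RtoC (c * e))%C (at_right 0) (locally a).
Proof.
  assert (H : filterlim (fun e : R => (a + RtoC (c * e))%C) (locally 0) (locally (a + RtoC (c * 0))%C)).
  { apply flim_Cplus; [apply filterlim_const|]. apply flim_RtoC.
    apply (continuous_scal_r (V := R_NormedModule) c (fun e : R => e)), continuous_id. }
  rewrite Rmult_0_r, Cplus_0_r in H. eapply filterlim_filter_le_1; [|exact H]. apply filter_le_within.
Qed.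

Lemma Re_plus_RtoC (a : C) (r : R) : Re (a + RtoC r)%C = Re a + r.
Proof. destruct a; reflexivity. Qed.

Lemma not_Cint_of_between (a : C) (k : Z) : IZR k < Re a < IZR k + 1 -> ~ Cint a.
Proof.
  intros Hk [j Hj]. rewrite Hj in Hk. simpl in Hk.
  destruct Hk as [H1 H2]. apply lt_IZR in H1. rewrite <- plus_IZR in H2. apply lt_IZR in H2. lia.
Qed.

(** ** The Bessel-K integral as a combination of two power series *)

Definition Kint (nu : C) (x : R) : C := Pfun nu 0 0 x.

Definition Kseries (nu : C) (x : R) : C :=
  (RtoC PI / csin (nu * RtoC PI) *
    (Om (RtoC 1) (RtoC 1 - nu) (RtoC (exp x)) - cexp (nu * RtoC x) * Om (RtoC 1) (RtoC 1 + nu) (RtoC (exp x))))%C.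

Lemma Kint_series_generic (nu : C) (x : R) (k : Z) : IZR k < Re nu < IZR k + 1 -> Kint nu x = Kseries nu x.
Proof.
  intros Hk. set (s := Re nu - IZR k).
  assert (Hn : csin (nu * RtoC PI)%C <> RtoC 0) by (apply csin_PI_neq_0; now apply (not_Cint_of_between nu k)).
  (* [Z.to_nat] sends negatives to 0, so [n - m = k]. Only [al - be = nu] matters for the result;
     the auxiliary [be] is placed so that the fractional parts are [(1 - s) / 2] and [(1 + s) / 2],
     which lie in [(0, 1)] and differ by [s]. *)
  set (m := Z.to_nat (- k)). set (n := Z.to_nat k).
  assert (Hmn : INR n - INR m = IZR k).
  { unfold m, n. rewrite !INR_IZR_INZ. rewrite <- minus_IZR. f_equal. lia. }
  set (be := RtoC (INR m + (1 - s) / 2)). set (al := (nu + be)%C).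
  assert (E : (al - be)%C = nu) by (unfold al; ring).
  assert (H := Ptrunc_0_series al be m n ((1 - s) / 2) ((1 + s) / 2)).
  rewrite E in H. specialize (H ltac:(unfold s; lra) ltac:(unfold s; lra) ltac:(unfold s; lra) eq_refl).
  assert (H' := H ltac:(unfold al, be; rewrite Re_plus_RtoC; unfold s; lra) Hn x).
  unfold Ptrunc in H'. rewrite E in H'. exact H'.
Qed.

Lemma Kint_joint_continuous (nu : C) (x : R) :
  @continuous (prod_UniformSpace C_UniformSpace R_UniformSpace) C_UniformSpace
    (fun p => Kint (fst p) (snd p)) (nu, x).
Proof.
  destruct (INR_unbounded (1 - Re nu)) as [N HN]. pose proof (pos_INR N).
  apply (Pfun_continuous 0 0 N nu (- INR N) x); simpl; lra.
Qed.

Lemma Kint_flim {T : Type} {F : (T -> Prop) -> Prop} {FF : Filter F} (f : T -> C) (nu : C) (x : R) :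
  filterlim f F (locally nu) -> filterlim (fun t => Kint (f t) x) F (locally (Kint nu x)).
Proof.
  intros H. assert (Hc := Kint_joint_continuous nu x).
  assert (Hp : filterlim (fun t => (f t, x) : C * R) F (@locally (prod_UniformSpace C_UniformSpace R_UniformSpace) (nu, x))).
  { apply (@filterlim_filter_le_2 _ _ F (filter_prod (locally nu) (locally x))).
    - intros P [eps HP]. exists (ball nu eps) (ball x eps); try apply locally_ball.
      intros y z Hy Hz. apply HP. now split.
    - apply filterlim_pair; [exact H | apply filterlim_const]. }
  exact (filterlim_comp _ _ _ _ _ _ _ _ Hp Hc).
Qed.

(** A non-integer [nu] may have an integer real part, where the truncation strips degenerate; both
    sides are continuous along [nu + e]. *)
Lemma Kint_series (nu : C) (x : R) : ~ Cint nu -> Kint nu x = Kseries nu x.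
Proof.
  intros Hnu. assert (Hs := flim_right_shift nu 1).
  apply (flim_unique (F := at_right 0) (fun e => Kint (nu + RtoC (1 * e))%C x)).
  - now apply Kint_flim.
  - apply (filterlim_ext_loc (fun e => Kseries (nu + RtoC (1 * e))%C x)).
    + generalize (right_noninteger (Re nu) 1 R1_neq_R0). apply filter_imp. intros e [k Hk].
      symmetry. apply (Kint_series_generic _ x k). rewrite Re_plus_RtoC. exact Hk.
    + apply flim_Cmult.
      * apply flim_Cdiv; [now apply csin_PI_neq_0 | apply filterlim_const |].
        apply flim_csin, flim_Cmult; [exact Hs | apply filterlim_const].
      * apply flim_Cminus; [|apply flim_Cmult].
        -- apply Om_flim; [apply filterlim_const | apply flim_Cminus; [apply filterlim_const | exact Hs]].
        -- apply flim_cexp, flim_Cmult; [exact Hs | apply filterlim_const].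
        -- apply Om_flim; [apply filterlim_const | apply flim_Cplus; [apply filterlim_const | exact Hs]].
Qed.

(** ** The Stieltjes-type integral *)

Definition Xint (al be w : C) : C := LInt (fun x => cexp (be * RtoC x) * kern w x * Kint (al - be) x)%C.

(** In Mellin-Barnes terms, one line per family of poles: the first two come from the two series of
    [Kint], the third from the Mellin transforms left by the kernel. *)
Definition Xform (al be w : C) : C :=
  (RtoC PI / csin ((al - be) * RtoC PI) * (RtoC PI / csin (be * RtoC PI)) * cexp ((be - RtoC 1) * w)
     * Om (RtoC 1) (RtoC 1 - (al - be)) (- cexp w)
   - RtoC PI / csin ((al - be) * RtoC PI) * (RtoC PI / csin (al * RtoC PI)) * cexp ((al - RtoC 1) * w)
     * Om (RtoC 1) (RtoC 1 + (al - be)) (- cexp w)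
   + RtoC PI / csin (be * RtoC PI) * (RtoC PI / csin (al * RtoC PI))
     * Om (RtoC 2 - be) (RtoC 2 - al) (- cexp w))%C.

Lemma kern_Pfun_dom (Th A : R) (w c nu : C) (a b N : nat) (B r0 r rho : R) :
  0 <= Th < PI -> Rabs (Im w) <= Th -> 0 <= A -> - A <= Re w ->
  adm a N r0 -> strip b (Re nu - r0) ->
  (forall x, Cmod (Pfun nu a b x) <= B * exp (r * x)) -> Re c + r = rho -> 0 < rho <= 1 / 2 ->
  dom (/ kern_const Th A * B) rho (fun x => cexp (c * RtoC x) * kern w x * Pfun nu a b x)%C.
Proof.
  intros HT Hw HA Hr Ha Hs HB Hc Hrho. split; [lra|split].
  - intros x. apply continuous_Cmult; [apply continuous_Cmult|].
    + eapply continuous_of_Cderive, is_Cderive_cexp_lin.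
    + apply continuous_kern. lra.
    + apply (continuous_comp (fun x : R => (nu, x) : C * R) (fun p => Pfun (fst p) a b (snd p))).
      * intros P [eps HP]. exists eps. intros y Hy. apply HP. split; [apply ball_center | exact Hy].
      * now apply (Pfun_continuous a b N nu r0 x).
  - intros x. rewrite !Cmod_mult, Cmod_cexp, Re_mult_RtoC.
    pose proof (kern_const_pos Th A HT) as Hk. apply Rinv_0_lt_compat in Hk.
    pose proof (exp_pos (Re c * x)). specialize (HB x).
    assert (HB0 : 0 <= B * exp (r * x)) by (pose proof (Cmod_ge_0 (Pfun nu a b x)); lra).
    assert (HB1 : 0 <= B).
    { pose proof (exp_pos (r * x)). destruct (Rle_dec 0 B); [assumption|]. nra. }
    eapply Rle_trans.
    + apply Rmult_le_compat; [| apply Cmod_ge_0 | | exact HB].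
      * apply Rmult_le_pos; [lra | apply Cmod_ge_0].
      * apply Rmult_le_compat_l; [lra | apply (kern_bound Th A w x); auto].
    + replace (exp (Re c * x) * (/ kern_const Th A * / (1 + exp x)) * (B * exp (r * x)))
        with (/ kern_const Th A * B * ((exp (Re c * x) * exp (r * x)) * / (1 + exp x))) by ring.
      rewrite <- exp_plus. replace (Re c * x + r * x) with (rho * x) by (rewrite <- Hc; ring).
      apply Rmult_le_compat_l; [nra|]. apply exp_over_1_plus_exp; lra.
Qed.

Lemma Xint_dom (Th A d rho : R) (w al be : C) (N N' : nat) :
  0 <= Th < PI -> Rabs (Im w) <= Th -> 0 <= A -> - A <= Re w ->
  0 < rho <= 1 / 2 -> 0 < d -> rho <= Re be <= INR N + rho -> rho + d <= Re al <= INR N' + rho - d ->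
  dom (/ kern_const Th A * (2 / d * (INR (fact N) * INR (fact N')))) rho
    (fun x => cexp (be * RtoC x) * kern w x * Kint (al - be) x)%C.
Proof.
  intros HT Hw HA Hr Hrho Hd Hb Ha.
  assert (En : Re (al - be)%C = Re al - Re be) by (destruct al, be; reflexivity).
  apply (kern_Pfun_dom Th A w be (al - be) 0 0 N _ (rho - Re be) (rho - Re be)); auto; try lra.
  - simpl. lra.
  - simpl. unfold Re in *. lra.
  - intros x. apply (Pfun_bound (al - be) 0 0 N N' (rho - Re be) d x); simpl; unfold Re in *; lra.
Qed.

Lemma Xint_flim {T : Type} {F : (T -> Prop) -> Prop} {FF : Filter F} (f g : T -> C) (al be w : C) :
  Rabs (Im w) < PI -> 0 < Re al -> 0 < Re be ->
  filterlim f F (locally al) -> filterlim g F (locally be) ->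
  filterlim (fun t => Xint (f t) (g t) w) F (locally (Xint al be w)).
Proof.
  intros Hw Hal Hbe Hf Hg.
  assert (Hc : @continuous (prod_UniformSpace C_UniformSpace C_UniformSpace) C_UniformSpace
                 (fun p => Xint (fst p) (snd p) w) (al, be)).
  (* At most 1/2 and at most half of either real part: the majorant then survives moving [al] and
     [be] by [rho / 2]. *)
  { set (rho := Rmin 1 (Rmin (Re al) (Re be)) / 2).
    assert (M0 := Rmin_l 1 (Rmin (Re al) (Re be))). assert (M1 := Rmin_r 1 (Rmin (Re al) (Re be))).
    assert (M2 := Rmin_l (Re al) (Re be)). assert (M3 := Rmin_r (Re al) (Re be)).
    assert (M4 : 0 < Rmin 1 (Rmin (Re al) (Re be))) by (repeat apply Rmin_pos; lra).
    assert (Hrho : 0 < rho <= 1 / 2) by (unfold rho; lra).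
    assert (R1 : 2 * rho <= Re al) by (unfold rho; lra). assert (R2 : 2 * rho <= Re be) by (unfold rho; lra).
    destruct (INR_unbounded (Re al + 2)) as [N' HN']. destruct (INR_unbounded (Re be + 1)) as [N HN].
    assert (HT : 0 <= Rabs (Im w) < PI) by (split; [apply Rabs_pos | exact Hw]).
    assert (HA : - Rabs (Re w) <= Re w) by (pose proof (Rle_abs (- Re w)); rewrite Rabs_Ropp in *; lra).
    apply (LInt_continuous (P := prod_UniformSpace C_UniformSpace C_UniformSpace)
      (fun p x => cexp (snd p * RtoC x) * kern w x * Kint (fst p - snd p) x)%C (al, be)
      (/ kern_const (Rabs (Im w)) (Rabs (Re w)) * (2 / (rho / 2) * (INR (fact N) * INR (fact N')))) rho).
    - intros x.
      assert (C1 : @continuous (prod_UniformSpace (prod_UniformSpace C_UniformSpace C_UniformSpace) R_UniformSpace) R_UniformSpace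
         (fun q => snd q) ((al, be), x)) by apply continuous_snd.
      assert (C2 : @continuous (prod_UniformSpace (prod_UniformSpace C_UniformSpace C_UniformSpace) R_UniformSpace) C_UniformSpace
         (fun q => snd (fst q)) ((al, be), x)).
      { apply (continuous_comp (fun q : (C * C) * R => fst q) (fun p : C * C => snd p)); [apply continuous_fst | apply continuous_snd]. }
      assert (C3 : @continuous (prod_UniformSpace (prod_UniformSpace C_UniformSpace C_UniformSpace) R_UniformSpace) C_UniformSpace
         (fun q => fst (fst q)) ((al, be), x)).
      { apply (continuous_comp (fun q : (C * C) * R => fst q) (fun p : C * C => fst p)); [apply continuous_fst | apply continuous_fst]. }
      apply continuous_Cmult; [apply continuous_Cmult|].
      + apply continuous_cexp, continuous_Cmult; [exact C2 | now apply continuous_RtoC].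
      + apply (continuous_comp (fun q : (C * C) * R => snd q) (kern w)); [exact C1 | now apply continuous_kern].
      + apply (continuous_comp_2 (fun q : (C * C) * R => (fst (fst q) - snd (fst q))%C) (fun q => snd q) Kint).
        * now apply continuous_Cminus.
        * exact C1.
        * apply Kint_joint_continuous.
    - assert (He : 0 < rho / 2) by lra. exists (mkposreal _ He). intros [[a1 a2] [b1 b2]] [[Ha _] [Hb _]].
      apply R_ball_Rabs, Rabs_def2 in Ha. apply R_ball_Rabs, Rabs_def2 in Hb.
      change (a1 - Re al < rho / 2 /\ - (rho / 2) < a1 - Re al) in Ha.
      change (b1 - Re be < rho / 2 /\ - (rho / 2) < b1 - Re be) in Hb.
      cbn [fst snd]. apply Xint_dom; auto; try apply Rabs_pos; cbn [Re fst]; lra. }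
  assert (Hp : filterlim (fun t => (f t, g t) : C * C) F (locally ((al, be) : C * C))).
  { apply (@filterlim_filter_le_2 _ _ F (filter_prod (locally al) (locally be))).
    - intros P [eps HP]. exists (ball al eps) (ball be eps); try apply locally_ball.
      intros y z Hy Hz. apply HP. now split.
    - now apply filterlim_pair. }
  exact (filterlim_comp _ _ _ _ _ _ _ _ Hp Hc).
Qed.

Lemma strip_sub (k n : nat) (t : R) : 0 < t < 1 -> strip (k - n) (INR n - INR k + t).
Proof.
  intros Ht. destruct (Nat.le_gt_cases n k) as [H|H]; [now apply strip_sub_ge | apply strip_sub_lt; [exact H | lra]].
Qed.

(** * Termwise expansion of the Stieltjes-type integral *)

Section Stieltjes.
Variables (al be w : C) (m n : nat) (phi psi : R).
Hypotheses (Hphi : 0 < phi < 1) (Hpsi : 0 < psi < 1) (Hne : phi <> psi)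
  (Hbe : Re be = INR m + phi) (Hal : Re al = INR n + psi)
  (Hsin : csin ((al - be) * RtoC PI)%C <> RtoC 0)
  (Hsa : csin (al * RtoC PI)%C <> RtoC 0) (Hsb : csin (be * RtoC PI)%C <> RtoC 0)
  (Hw : Rabs (Im w) < PI).

Definition Xtrunc_integrand (k : nat) (x : R) : C :=
  (cexp ((be - RtoC (INR k)) * RtoC x) * kern w x * Ptrunc al be m n k x)%C.
Definition Xtrunc (k : nat) : C := LInt (Xtrunc_integrand k).

(** The rate [rho] does not depend on [k]: the growth of [Ptrunc k] is compensated by the exponent
    [be - k], and all dependence on [k] sits in the two remainder constants. *)
Lemma Xtrunc_dom : exists rho c, 0 < rho /\ forall k,
  dom (c * (Erem_const (k - m) (m + 2) * Erem_const (k - n) (n + 2))) rho (Xtrunc_integrand k).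
Proof.
  set (rho := Rmin phi psi / 2).
  assert (M1 := Rmin_l phi psi). assert (M2 := Rmin_r phi psi). assert (M3 : 0 < Rmin phi psi) by (apply Rmin_pos; lra).
  set (d := Rmin (psi - rho) (1 - (psi - rho))).
  assert (Hd : 0 < d) by (apply Rmin_pos; unfold rho; lra).
  assert (D1 : d <= psi - rho) by apply Rmin_l. assert (D2 : d <= 1 - (psi - rho)) by apply Rmin_r.
  assert (HT : 0 <= Rabs (Im w) < PI) by (split; [apply Rabs_pos | exact Hw]).
  assert (HA : - Rabs (Re w) <= Re w) by (pose proof (Rle_abs (- Re w)); rewrite Rabs_Ropp in *; lra).
  exists rho, (/ kern_const (Rabs (Im w)) (Rabs (Re w)) * (2 / d)). split; [unfold rho; lra|]. intros k.
  destruct (Ptrunc_adm al be m n phi psi Hphi Hpsi Hne Hbe Hal Hsin k rho d) as (A1 & A2 & A3); try (unfold rho; lra); auto.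
  rewrite Rmult_assoc.
  apply (kern_Pfun_dom (Rabs (Im w)) (Rabs (Re w)) w (be - RtoC (INR k)) (al - be) (k - m) (k - n) (m + 2)
     _ (INR k - Re be + rho) (INR k - Re be + rho)); auto; try lra; try apply Rabs_pos.
  - replace (Re (al - be)%C - (INR k - Re be + rho)) with (INR n - INR k + (psi - rho)).
    + apply strip_sub. unfold rho; lra.
    + rewrite (Re_nu_trunc al be m n phi psi Hbe Hal Hsin), Hbe. ring.
  - intros x. apply (Ptrunc_bound al be m n phi psi Hphi Hpsi Hne Hbe Hal Hsin k rho d x); unfold rho in *; try lra.
  - replace (Re (be - RtoC (INR k))%C) with (Re be - INR k) by (destruct be; reflexivity). ring.
  - unfold rho; lra.
Qed.

Let nu := (al - be)%C.
(** This name hides the successor, hence [Datatypes.S] below. *)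
Let S := (RtoC PI / csin (nu * RtoC PI))%C.

Lemma cexp_minus_nat_mult (c : C) (k : nat) (v : C) :
  (cexp ((c - RtoC (INR k)) * v) * Cpown (cexp v) k)%C = cexp (c * v)%C.
Proof. rewrite <- cexp_nat, <- cexp_add. f_equal. ring. Qed.

Lemma neg_pown_sign (v : C) (k : nat) : Cpown (- v) k = (RtoC ((-1) ^ k) * Cpown v k)%C.
Proof.
  induction k as [|k IH]; simpl; [ring|]. rewrite IH, RtoC_mult. ring.
Qed.

(** Contribution of one power [e^{(p+i) x}] of the expansion at [-oo], with [c = p + j]. *)
Lemma kern_power_term (c A B : C) (j i : nat) : 0 < Re c - INR j < 1 -> csin (c * RtoC PI)%C <> RtoC 0 ->
  (exists K d, dom K d (fun x => cexp ((c - RtoC (INR (j + i))) * RtoC x) * kern w x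
                         * (A * (Cpown (RtoC (exp x)) i * B)))%C) /\
  (Cpown (- cexp w) (j + i) *
     LInt (fun x => cexp ((c - RtoC (INR (j + i))) * RtoC x) * kern w x * (A * (Cpown (RtoC (exp x)) i * B))))%C =
  (A * (RtoC PI / csin (c * RtoC PI)) * cexp ((c - RtoC 1) * w) * (Cpown (- cexp w) i * B))%C.
Proof.
  intros Hc Hs. set (p := (c - RtoC (INR j))%C).
  assert (Hp : Re p = Re c - INR j) by (unfold p; destruct c; reflexivity).
  assert (HT : 0 <= Rabs (Im w) < PI) by (split; [apply Rabs_pos | exact Hw]).
  assert (HA : - Rabs (Re w) <= Re w) by (pose proof (Rle_abs (- Re w)); rewrite Rabs_Ropp in *; lra).
  set (d := Rmin (Re p) (1 - Re p)). assert (Hd : 0 < d) by (apply Rmin_pos; lra).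
  assert (Hd1 : d <= Re p) by apply Rmin_l.
  assert (Hd2 : Re p <= 1 - d) by (assert (d <= 1 - Re p) by apply Rmin_r; lra).
  assert (D := kern_integrand_dom _ _ d p w HT (Rle_refl _) (Rabs_pos _) HA Hd Hd1 Hd2).
  assert (E : forall x, (cexp ((c - RtoC (INR (j + i))) * RtoC x) * kern w x * (A * (Cpown (RtoC (exp x)) i * B)))%C
     = (A * B * (cexp (p * RtoC x) * kern w x))%C).
  { intros x. rewrite plus_INR, RtoC_plus, <- cexp_R.
    replace (c - (RtoC (INR j) + RtoC (INR i)))%C with (p - RtoC (INR i))%C by (unfold p; ring).
    rewrite <- (cexp_minus_nat_mult p i (RtoC x)). ring. }
  split.
  - rewrite (functional_extensionality _ _ E). eexists. exists d. apply dom_Cmult, D.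
  - rewrite (LInt_ext _ _ E), (LInt_Cmult _ _ _ _ D), (kern_integral p w) by (auto; lra).
    rewrite !neg_pown_sign. unfold p. rewrite csin_PI_minus_nat.
    replace ((c - RtoC 1) * w)%C with ((c - RtoC (INR j) - RtoC 1) * w + RtoC (INR j) * w)%C by ring.
    rewrite cexp_add, cexp_nat, pow_add, RtoC_mult.
    assert (Epow : Cpown (cexp w) (j + i) = (Cpown (cexp w) j * Cpown (cexp w) i)%C).
    { rewrite <- !cexp_nat, plus_INR, RtoC_plus, <- cexp_add. f_equal. ring. }
    rewrite Epow. pose proof (RtoC_sign_neq_0 j). field. auto.
Qed.

Lemma dom_zero (f : R -> C) : (forall x, f x = RtoC 0) -> dom 1 1 f /\ LInt f = RtoC 0.
Proof.
  intros H. assert (E : f = fun _ => RtoC 0) by (apply functional_extensionality; exact H). rewrite E.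
  assert (D : dom 1 1 (fun _ : R => RtoC 0)).
  { split; [lra|split].
    - intros x. apply continuous_const.
    - intros x. rewrite Cmod_0, Rmult_1_l. left. apply exp_pos. }
  split; [exact D|]. rewrite (LInt_ext _ (fun _ => RtoC 0 * RtoC 0)%C) by (intros; ring).
  rewrite (LInt_Cmult _ _ _ _ D). ring.
Qed.

Lemma Xtrunc_term_a (k : nat) :
  (exists K d, dom K d (fun x => cexp ((be - RtoC (INR k)) * RtoC x) * kern w x * delayed m (res_a al be x) k)%C) /\
  (Cpown (- cexp w) k * LInt (fun x => cexp ((be - RtoC (INR k)) * RtoC x) * kern w x * delayed m (res_a al be x) k))%C =
  delayed m (fun i => S * (RtoC PI / csin (be * RtoC PI)) * cexp ((be - RtoC 1) * w)
                        * Om_term (RtoC 1) (RtoC 1 - nu) (- cexp w) i)%C k.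
Proof.
  unfold delayed. destruct (Nat.ltb_spec k m) as [H|H].
  - destruct (dom_zero (fun x => cexp ((be - RtoC (INR k)) * RtoC x) * kern w x * RtoC 0)%C) as [D E]; [intros; ring|].
    split; [eexists; eexists; exact D | rewrite E; ring].
  - assert (Hk : k = (m + (k - m))%nat) by lia. set (i := (k - m)%nat) in *. rewrite Hk.
    apply (kern_power_term be S _ m i); [rewrite Hbe; lra | exact Hsb].
Qed.

Lemma Xtrunc_term_b (k : nat) :
  (exists K d, dom K d (fun x => cexp ((be - RtoC (INR k)) * RtoC x) * kern w x * delayed n (res_b al be x) k)%C) /\
  (Cpown (- cexp w) k * LInt (fun x => cexp ((be - RtoC (INR k)) * RtoC x) * kern w x * delayed n (res_b al be x) k))%C =
  delayed n (fun i => - S * (RtoC PI / csin (al * RtoC PI)) * cexp ((al - RtoC 1) * w)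
                        * Om_term (RtoC 1) (RtoC 1 + nu) (- cexp w) i)%C k.
Proof.
  unfold delayed. destruct (Nat.ltb_spec k n) as [H|H].
  - destruct (dom_zero (fun x => cexp ((be - RtoC (INR k)) * RtoC x) * kern w x * RtoC 0)%C) as [D E]; [intros; ring|].
    split; [eexists; eexists; exact D | rewrite E; ring].
  - assert (Hk : k = (n + (k - n))%nat) by lia. set (i := (k - n)%nat) in *. rewrite Hk.
    set (B := (rgamma (RtoC 1 + RtoC (INR i)) * rgamma (RtoC 1 + nu + RtoC (INR i)))%C).
    assert (E : (fun x => cexp ((be - RtoC (INR (n + i))) * RtoC x) * kern w x * res_b al be x i)%C
       = (fun x => cexp ((al - RtoC (INR (n + i))) * RtoC x) * kern w x * (- S * (Cpown (RtoC (exp x)) i * B)))%C).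
    { apply functional_extensionality. intros x. unfold res_b, Om_term. fold nu S. fold B.
      replace ((al - RtoC (INR (n + i))) * RtoC x)%C with ((be - RtoC (INR (n + i))) * RtoC x + nu * RtoC x)%C
        by (unfold nu; ring).
      rewrite cexp_add. ring. }
    rewrite E. apply (kern_power_term al (- S) B n i); [rewrite Hal; lra | exact Hsa].
Qed.

(** The summand 1 of [e^x * kern = 1 - zeta * kern] leaves the Mellin transform of [Ptrunc], a
    product of two Gamma values; the signs of their sines, both [(-1)^(k + 1)], cancel. *)
Lemma Xtrunc_term_M (k : nat) :
  (exists K d, dom K d (fun x => cexp ((be - RtoC (INR (Datatypes.S k))) * RtoC x) * Ptrunc al be m n (Datatypes.S k) x)%C) /\
  (Cpown (- cexp w) k * LInt (fun x => cexp ((be - RtoC (INR (Datatypes.S k))) * RtoC x) * Ptrunc al be m n (Datatypes.S k) x))%C =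
  (RtoC PI / csin (be * RtoC PI) * (RtoC PI / csin (al * RtoC PI)) * Om_term (RtoC 2 - be) (RtoC 2 - al) (- cexp w) k)%C.
Proof.
  set (q := RtoC (INR (Datatypes.S k))).
  assert (Sb : strip (Datatypes.S k - m) (Re (be - q)%C)).
  { replace (Re (be - q)%C) with (INR m - INR (Datatypes.S k) + phi).
    - now apply strip_sub.
    - unfold q. replace (Re (be - RtoC (INR (Datatypes.S k)))%C) with (Re be - INR (Datatypes.S k)) by (destruct be; reflexivity).
      rewrite Hbe. ring. }
  assert (Sa : strip (Datatypes.S k - n) (Re (al - q)%C)).
  { replace (Re (al - q)%C) with (INR n - INR (Datatypes.S k) + psi).
    - now apply strip_sub.
    - unfold q. replace (Re (al - RtoC (INR (Datatypes.S k)))%C) with (Re al - INR (Datatypes.S k)) by (destruct al; reflexivity).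
      rewrite Hal. ring. }
  destruct (Pfun_Mellin (al - q) (be - q) _ _ Sb Sa) as [D E].
  replace (al - q - (be - q))%C with (al - be)%C in D, E by ring.
  split; [exact D|]. unfold Ptrunc. rewrite E.
  rewrite (Gam_value _ _ Sb), (Gam_value _ _ Sa); unfold q; rewrite ?csin_PI_minus_nat;
    try (apply Cmult_neq_0; [apply RtoC_sign_neq_0 | assumption]).
  unfold Om_term.
  replace (RtoC 1 - (be - RtoC (INR (Datatypes.S k))))%C with (RtoC 2 - be + RtoC (INR k))%C
    by (rewrite S_INR, RtoC_plus; replace (RtoC 2) with (RtoC 1 + RtoC 1)%C by (rewrite <- RtoC_plus; f_equal; ring); ring).
  replace (RtoC 1 - (al - RtoC (INR (Datatypes.S k))))%C with (RtoC 2 - al + RtoC (INR k))%C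
    by (rewrite S_INR, RtoC_plus; replace (RtoC 2) with (RtoC 1 + RtoC 1)%C by (rewrite <- RtoC_plus; f_equal; ring); ring).
  pose proof (RtoC_sign_neq_0 (Datatypes.S k)) as Hn. pose proof (RtoC_sign_sqr (Datatypes.S k)) as Hsq.
  set (sg := RtoC ((-1) ^ Datatypes.S k)) in *.
  set (ga := rgamma _). set (gb := rgamma _).
  transitivity (Cpown (- cexp w) k * (RtoC PI * gb * (RtoC PI * ga)) / ((sg * sg) * (csin (be * RtoC PI) * csin (al * RtoC PI))))%C.
  - unfold ga, gb. field. auto.
  - rewrite Hsq. unfold ga, gb. field. auto.
Qed.

(** [Ptrunc_step] splits off two powers integrable against the kernel. In the rest, one factor [e^x]
    is taken from the exponential and [e^x * kern = 1 - zeta * kern] is used: the 1 gives the third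
    term, and [- zeta * kern] gives the next integral. *)
Lemma Xtrunc_step (k : nat) :
  (Cpown (- cexp w) k * Xtrunc k)%C =
  (delayed m (fun i => S * (RtoC PI / csin (be * RtoC PI)) * cexp ((be - RtoC 1) * w) * Om_term (RtoC 1) (RtoC 1 - nu) (- cexp w) i) k
   + delayed n (fun i => - S * (RtoC PI / csin (al * RtoC PI)) * cexp ((al - RtoC 1) * w) * Om_term (RtoC 1) (RtoC 1 + nu) (- cexp w) i) k
   + RtoC PI / csin (be * RtoC PI) * (RtoC PI / csin (al * RtoC PI)) * Om_term (RtoC 2 - be) (RtoC 2 - al) (- cexp w) k
   + Cpown (- cexp w) (Datatypes.S k) * Xtrunc (Datatypes.S k))%C.
Proof.
  destruct (Xtrunc_term_a k) as [(K1 & d1 & D1) E1]. destruct (Xtrunc_term_b k) as [(K2 & d2 & D2) E2].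
  destruct (Xtrunc_term_M k) as [(K3 & d3 & D3) E3]. destruct Xtrunc_dom as (rho & c & Hrho & D4).
  rewrite <- E1, <- E2, <- E3. specialize (D4 (Datatypes.S k)).
  set (f1 := fun x => (cexp ((be - RtoC (INR k)) * RtoC x) * kern w x * delayed m (res_a al be x) k)%C) in *.
  set (f2 := fun x => (cexp ((be - RtoC (INR k)) * RtoC x) * kern w x * delayed n (res_b al be x) k)%C) in *.
  set (f3 := fun x => (cexp ((be - RtoC (INR (Datatypes.S k))) * RtoC x) * Ptrunc al be m n (Datatypes.S k) x)%C) in *.
  assert (E : forall x, Xtrunc_integrand k x = (f1 x + f2 x + f3 x - cexp w * Xtrunc_integrand (Datatypes.S k) x)%C).
  { intros x. unfold Xtrunc_integrand. rewrite (Ptrunc_step al be m n phi psi Hphi Hpsi Hne Hbe Hal Hsin k x).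
    unfold f1, f2, f3.
    replace (be - RtoC (INR k))%C with (be - RtoC (INR (Datatypes.S k)) + RtoC 1)%C by (rewrite S_INR, RtoC_plus; ring).
    rewrite cexp_plus_1_mult. unfold kern. field. now apply kern_den_neq_0. }
  unfold Xtrunc at 1. rewrite (LInt_ext _ _ E).
  assert (D12 := dom_plus _ _ _ _ _ _ D1 D2). assert (D123 := dom_plus _ _ _ _ _ _ D12 D3).
  rewrite (LInt_minus _ _ _ _ _ _ D123 (dom_Cmult (cexp w) _ _ _ D4)), (LInt_plus _ _ _ _ _ _ D12 D3),
    (LInt_plus _ _ _ _ _ _ D1 D2), (LInt_Cmult _ _ _ _ D4).
  fold (Xtrunc (Datatypes.S k)). simpl Cpown. ring.
Qed.

Lemma Xtrunc_0 : Xtrunc 0 = Xform al be w.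
Proof.
  set (z := (- cexp w)%C).
  set (A1 := (S * (RtoC PI / csin (be * RtoC PI)) * cexp ((be - RtoC 1) * w))%C).
  set (A2 := (- S * (RtoC PI / csin (al * RtoC PI)) * cexp ((al - RtoC 1) * w))%C).
  set (A3 := (RtoC PI / csin (be * RtoC PI) * (RtoC PI / csin (al * RtoC PI)))%C).
  assert (T : forall K, Xtrunc 0 = (psum (delayed m (fun i => A1 * Om_term (RtoC 1) (RtoC 1 - nu) z i)) K
     + psum (delayed n (fun i => A2 * Om_term (RtoC 1) (RtoC 1 + nu) z i)) K
     + A3 * psum (Om_term (RtoC 2 - be) (RtoC 2 - al) z) K + Cpown z K * Xtrunc K)%C).
  { induction K as [|K IH]; [simpl; ring|]. rewrite IH. unfold z at 4. rewrite (Xtrunc_step K).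
    fold z A1 A2 A3. simpl psum. ring. }
  (* The uniform rate of [Xtrunc_dom] turns this into [Erem_const_product_small] with [X] the
     modulus of [zeta]. *)
  assert (L0 : filterlim (fun K => Cpown z K * Xtrunc K)%C eventually (locally (RtoC 0))).
  { destruct Xtrunc_dom as (rho & c & Hrho & D).
    apply (flim_squeeze _ _ (fun K => (2 * c / rho) * (Erem_const (K - m) (m + 2) * Erem_const (K - n) (n + 2)) * Cmod z ^ K)).
    - apply filter_forall. intros K. replace (Cpown z K * Xtrunc K - RtoC 0)%C with (Cpown z K * Xtrunc K)%C by ring.
      rewrite Cmod_mult, Cpown_Cmod, Rmult_comm. apply Rmult_le_compat_r; [apply pow_le, Cmod_ge_0|].
      eapply Rle_trans; [apply (LInt_bound _ _ _ (D K))|]. right. field. lra.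
    - apply Erem_const_product_small, Cmod_ge_0. }
  assert (Hsc : forall (A a b : C) (j : nat),
     filterlim (psum (delayed j (fun i => A * Om_term a b z i)%C)) eventually (locally (A * Om a b z)%C)).
  { intros A a b j. apply psum_delayed_lim. apply (filterlim_ext (fun K => A * psum (Om_term a b z) K)%C).
    - intros K. symmetry. apply psum_Cmult.
    - apply flim_Cmult; [apply filterlim_const | apply Om_lim]. }
  assert (L := flim_Cplus _ _ _ _ (flim_Cplus _ _ _ _ (flim_Cplus _ _ _ _ (Hsc A1 (RtoC 1) (RtoC 1 - nu)%C m)
     (Hsc A2 (RtoC 1) (RtoC 1 + nu)%C n))
     (flim_Cmult _ _ _ _ (filterlim_const A3) (Om_lim (RtoC 2 - be) (RtoC 2 - al) z))) L0).
  apply (flim_unique (F := eventually) (fun _ => Xtrunc 0)); [apply filterlim_const|].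
  replace (Xform al be w) with (A1 * Om (RtoC 1) (RtoC 1 - nu) z + A2 * Om (RtoC 1) (RtoC 1 + nu) z
      + A3 * Om (RtoC 2 - be) (RtoC 2 - al) z + RtoC 0)%C.
  - revert L. apply filterlim_ext. intros K. symmetry. apply T.
  - unfold Xform, A1, A2, A3, S, nu, z. ring.
Qed.

End Stieltjes.

Lemma between_nat (s : R) (k : Z) : 0 < s -> IZR k < s < IZR k + 1 ->
  exists m phi, 0 < phi < 1 /\ s = INR m + phi /\ INR m = IZR k.
Proof.
  intros Hs Hk. assert (0 <= k)%Z.
  { destruct (Z_lt_le_dec k 0) as [H|H]; [|exact H]. exfalso.
    assert (IZR k + 1 <= 0) by (rewrite <- plus_IZR; apply IZR_le; lia). lra. }
  exists (Z.to_nat k), (s - IZR k). rewrite INR_IZR_INZ, Z2Nat.id by exact H. lra.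
Qed.

Lemma Xint_generic (al be w : C) (ka kb kn : Z) : 0 < Re al -> 0 < Re be -> Rabs (Im w) < PI ->
  IZR ka < Re al < IZR ka + 1 -> IZR kb < Re be < IZR kb + 1 -> IZR kn < Re (al - be)%C < IZR kn + 1 ->
  Xint al be w = Xform al be w.
Proof.
  intros Ha Hb Hw Hka Hkb Hkn.
  destruct (between_nat _ _ Ha Hka) as (n & psi & Hpsi & En & En').
  destruct (between_nat _ _ Hb Hkb) as (m & phi & Hphi & Em & Em').
  assert (Hne : phi <> psi).
  { intros E. replace (Re (al - be)%C) with (Re al - Re be) in Hkn by (destruct al, be; reflexivity).
    rewrite En, Em, En', Em', E in Hkn. replace (IZR ka + psi - (IZR kb + psi)) with (IZR (ka - kb)) in Hkn
      by (rewrite minus_IZR; ring).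
    destruct Hkn as [H1 H2]. apply lt_IZR in H1. rewrite <- plus_IZR in H2. apply lt_IZR in H2. lia. }
  assert (Sa := csin_PI_neq_0 _ (not_Cint_of_between _ _ Hka)).
  assert (Sb := csin_PI_neq_0 _ (not_Cint_of_between _ _ Hkb)).
  assert (Sn := csin_PI_neq_0 _ (not_Cint_of_between _ _ Hkn)).
  rewrite <- (Xtrunc_0 al be w m n phi psi Hphi Hpsi Hne Em En Sn Sa Sb Hw).
  unfold Xint, Xtrunc. apply LInt_ext. intros x. unfold Xtrunc_integrand, Ptrunc, Kint. simpl INR.
  replace (be - RtoC 0)%C with be by ring. reflexivity.
Qed.

Lemma Xform_flim {T : Type} {F : (T -> Prop) -> Prop} {FF : Filter F} (f g : T -> C) (al be w : C) :
  ~ Cint al -> ~ Cint be -> ~ Cint (al - be)%C ->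
  filterlim f F (locally al) -> filterlim g F (locally be) ->
  filterlim (fun t => Xform (f t) (g t) w) F (locally (Xform al be w)).
Proof.
  intros Na Nb Nn Hf Hg. assert (Hfg := flim_Cminus _ _ _ _ Hf Hg).
  assert (Hs : forall (h : T -> C) (c : C), ~ Cint c -> filterlim h F (locally c) ->
    filterlim (fun t => RtoC PI / csin (h t * RtoC PI))%C F (locally (RtoC PI / csin (c * RtoC PI))%C)).
  { intros h c Hc Hh. apply flim_Cdiv; [now apply csin_PI_neq_0 | apply filterlim_const |].
    apply flim_csin, flim_Cmult; [exact Hh | apply filterlim_const]. }
  assert (He : forall (h : T -> C) (c : C), filterlim h F (locally c) ->
    filterlim (fun t => cexp ((h t - RtoC 1) * w))%C F (locally (cexp ((c - RtoC 1) * w))%C)).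
  { intros h c Hh. apply flim_cexp, flim_Cmult; [apply flim_Cminus; [exact Hh | apply filterlim_const] | apply filterlim_const]. }
  assert (Hn' := Hs (fun t => f t - g t)%C (al - be)%C Nn Hfg).
  assert (Ha' := Hs f al Na Hf). assert (Hb' := Hs g be Nb Hg).
  assert (O1 : filterlim (fun t => Om (RtoC 1) (RtoC 1 - (f t - g t)) (- cexp w))%C F (locally (Om (RtoC 1) (RtoC 1 - (al - be)) (- cexp w))%C))
    by (apply Om_flim; [apply filterlim_const | apply flim_Cminus; [apply filterlim_const | exact Hfg]]).
  assert (O2 : filterlim (fun t => Om (RtoC 1) (RtoC 1 + (f t - g t)) (- cexp w))%C F (locally (Om (RtoC 1) (RtoC 1 + (al - be)) (- cexp w))%C))
    by (apply Om_flim; [apply filterlim_const | apply flim_Cplus; [apply filterlim_const | exact Hfg]]).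
  assert (O3 : filterlim (fun t => Om (RtoC 2 - g t) (RtoC 2 - f t) (- cexp w))%C F (locally (Om (RtoC 2 - be) (RtoC 2 - al) (- cexp w))%C))
    by (apply Om_flim; (apply flim_Cminus; [apply filterlim_const | assumption])).
  exact (flim_Cplus _ _ _ _
    (flim_Cminus _ _ _ _
      (flim_Cmult _ _ _ _ (flim_Cmult _ _ _ _ (flim_Cmult _ _ _ _ Hn' Hb') (He g be Hg)) O1)
      (flim_Cmult _ _ _ _ (flim_Cmult _ _ _ _ (flim_Cmult _ _ _ _ Hn' Ha') (He f al Hf)) O2))
    (flim_Cmult _ _ _ _ (flim_Cmult _ _ _ _ Hb' Ha') O3)).
Qed.

(** Extends [Xint_generic] to non-integer parameters whose real parts, or that of their difference,
    are integers; both sides are continuous there. *)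
Lemma Xint_formula (al be w : C) : 0 < Re al -> 0 < Re be -> Rabs (Im w) < PI ->
  ~ Cint al -> ~ Cint be -> ~ Cint (al - be)%C -> Xint al be w = Xform al be w.
Proof.
  intros Ha Hb Hw Na Nb Nn.
  (* Distinct speeds 1 and 2 also move [al - be], at speed -1, off the integers. *)
  assert (H1 := flim_right_shift al 1). assert (H2 := flim_right_shift be 2).
  apply (flim_unique (F := at_right 0) (fun e => Xint (al + RtoC (1 * e)) (be + RtoC (2 * e)) w)).
  - now apply Xint_flim.
  - apply (filterlim_ext_loc (fun e => Xform (al + RtoC (1 * e)) (be + RtoC (2 * e)) w)%C); [|now apply Xform_flim].
    assert (N1 : 1 <> 0) by lra. assert (N2 : 2 <> 0) by lra. assert (N3 : -1 <> 0) by lra.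
    assert (Hpos : at_right 0 (fun e => 0 < e)) by (exists (mkposreal 1 Rlt_0_1); auto).
    generalize (filter_and _ _ Hpos (filter_and _ _ (right_noninteger (Re al) 1 N1)
      (filter_and _ _ (right_noninteger (Re be) 2 N2) (right_noninteger (Re (al - be)%C) (-1) N3)))).
    apply filter_imp. intros e (He & [ka Hka] & [kb Hkb] & [kn Hkn]).
    symmetry. apply (Xint_generic _ _ w ka kb kn); rewrite ?Re_plus_RtoC; try lra; try assumption.
    replace (al + RtoC (1 * e) - (be + RtoC (2 * e)))%C with (al - be + RtoC (-1 * e))%C
      by (replace (-1 * e) with (1 * e - 2 * e) by ring; rewrite RtoC_minus; ring).
    rewrite Re_plus_RtoC. exact Hkn.
Qed.

(** ** Principal logarithm on the right half-plane *)

Lemma Re_pos_of_Carg (z : C) : z <> RtoC 0 -> Rabs (Carg z) < PI / 2 -> 0 < Re z.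
Proof.
  intros Hz H. destruct z as [x y]. unfold Carg in H. cbn [Re Im fst snd] in *.
  pose proof PI_RGT_0. apply Rabs_def2 in H. destruct H as [H1 H2].
  destruct (Rlt_dec 0 x); [assumption|]. destruct (Rlt_dec x 0).
  - pose proof (atan_bound (y / x)). destruct (Rle_dec 0 y); lra.
  (* On the imaginary axis the argument is [PI / 2] up to sign except at the origin, where it is 0
     by convention and [z <> 0] decides. *)
  - destruct (Rlt_dec 0 y); [lra|]. destruct (Rlt_dec y 0); [lra|].
    exfalso. apply Hz. unfold RtoC. f_equal; lra.
Qed.

Lemma Carg_right (z : C) : 0 < Re z -> Carg z = atan (Im z / Re z).
Proof. intros H. unfold Carg. destruct (Rlt_dec 0 (Re z)); [reflexivity | contradiction]. Qed.

Lemma cexp_clog (z : C) : 0 < Re z -> cexp (clog z) = z.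
Proof.
  intros H. assert (Hz : z <> RtoC 0) by (intros E; rewrite E in H; simpl in H; lra).
  assert (HM : 0 < Cmod z) by now apply Cmod_gt_0.
  unfold clog, cexp. cbn [Re Im fst snd]. rewrite exp_ln by exact HM. rewrite Carg_right by exact H.
  destruct z as [x y]. cbn [Re Im fst snd] in *.
  rewrite cos_atan, sin_atan.
  assert (E : sqrt (1 + Rsqr (y / x)) = Cmod (x, y) / x).
  { apply Rmult_eq_reg_r with x; [|lra]. unfold Rdiv at 2. rewrite Rmult_assoc, Rinv_l, Rmult_1_r by lra.
    unfold Cmod. cbn [fst snd]. replace (x ^ 2 + y ^ 2) with ((1 + Rsqr (y / x)) * Rsqr x) by (unfold Rsqr; field; lra).
    rewrite sqrt_mult_alt, sqrt_Rsqr by (try lra; pose proof (Rle_0_sqr (y / x)); lra). reflexivity. }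
  rewrite E. unfold Cmult, RtoC. cbn [fst snd]. f_equal; field; lra.
Qed.

Lemma clog_half (z : C) : 0 < Re z -> clog (z / RtoC 2) = (clog z - RtoC (ln 2))%C.
Proof.
  intros H. assert (Hz : z <> RtoC 0) by (intros E; rewrite E in H; simpl in H; lra).
  assert (HM : 0 < Cmod z) by now apply Cmod_gt_0.
  assert (E : (z / RtoC 2)%C = (Re z / 2, Im z / 2)).
  { destruct z as [x y]. unfold Cdiv. rewrite <- RtoC_inv by lra. unfold Cmult, RtoC. cbn [Re Im fst snd].
    f_equal; field. }
  unfold clog. rewrite Cmod_div, Cmod_R, Rabs_pos_eq by (lra || apply C2_neq_0).
  rewrite !Carg_right by (rewrite ?E; cbn [Re fst]; lra). rewrite E. cbn [Re Im fst snd].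
  unfold Cminus, Cplus, Copp, RtoC. cbn [fst snd]. f_equal.
  - unfold Rdiv. rewrite ln_mult, ln_Rinv by lra. ring.
  - rewrite Ropp_0, Rplus_0_r. f_equal. field. unfold Re, Im in *. lra.
Qed.

Lemma cpow_neq_0 (z c : C) : z <> RtoC 0 -> cpow z c = cexp (c * clog z)%C.
Proof. intros H. unfold cpow. destruct (Ceq_dec z (RtoC 0)); [contradiction | reflexivity]. Qed.

(** ** Bessel functions in terms of [Om] *)

Lemma Cpown_2 (a : C) : Cpown a 2 = (a * a)%C.
Proof. simpl. ring. Qed.

Lemma BesselJ_Om (nu z : C) :
  BesselJ nu z = (cpow (z / RtoC 2) nu * Om (RtoC 1) (RtoC 1 + nu) (- Cpown (z / RtoC 2) 2))%C.
Proof.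
  unfold BesselJ, Om. f_equal. f_equal. apply functional_extensionality. intros k. unfold Om_term.
  rewrite neg_pown_sign, Cpown_mul_exp.
  replace (RtoC 1 + RtoC (INR k))%C with (RtoC (INR k + 1)) by (rewrite RtoC_plus; ring).
  rewrite rgamma_nat. replace (RtoC 1 + nu + RtoC (INR k))%C with (RtoC (INR k + 1) + nu)%C by (rewrite RtoC_plus; ring).
  unfold Rdiv. rewrite RtoC_mult. ring.
Qed.

Lemma BesselI_Om (nu z : C) : BesselI nu z = (cpow (z / RtoC 2) nu * Om (RtoC 1) (RtoC 1 + nu) (Cpown (z / RtoC 2) 2))%C.
Proof.
  unfold BesselI, Om. f_equal. f_equal. apply functional_extensionality. intros k. unfold Om_term.
  rewrite Cpown_mul_exp.
  replace (RtoC 1 + RtoC (INR k))%C with (RtoC (INR k + 1)) by (rewrite RtoC_plus; ring).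
  rewrite rgamma_nat. replace (RtoC 1 + nu + RtoC (INR k))%C with (RtoC (INR k + 1) + nu)%C by (rewrite RtoC_plus; ring).
  ring.
Qed.

Lemma flim_right_shift_locally (a : C) (c : R) (P : C -> Prop) :
  locally a P -> at_right 0 (fun e : R => P (a + RtoC (c * e))%C).
Proof. apply (flim_right_shift a c). Qed.

Lemma nonint_filter_proper (nu : C) : ProperFilter' (within (fun nu' : C => ~ Cint nu') (locally nu)).
Proof.
  constructor; [|apply within_filter, locally_filter]. intros H.
  assert (H1 := flim_right_shift_locally nu 1 _ H).
  assert (N1 : 1 <> 0) by lra.
  destruct (filter_ex _ (filter_and _ _ H1 (right_noninteger (Re nu) 1 N1))) as (e & He & k & Hk).
  apply He. apply (not_Cint_of_between _ k). now rewrite Re_plus_RtoC.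
Qed.

(** At every non-integer order the quotient defining [BesselK_gen] is [Kseries] up to the power of
    [t / 2], hence the integral. The integral is continuous in the order, so it also gives the limit
    at integers. *)
Lemma BesselK_Kint (nu : C) (t : R) : 0 < t ->
  BesselK nu (RtoC t) = (/ RtoC 2 * (cexp (- nu * RtoC (ln (t / 2))) * Kint nu (2 * ln (t / 2))))%C.
Proof.
  intros Ht. assert (Hp := nonint_filter_proper nu).
  apply (Clim_eq (PF := Hp)).
  apply (filterlim_ext_loc (fun nu' => / RtoC 2 * (cexp (- nu' * RtoC (ln (t / 2))) * Kint nu' (2 * ln (t / 2))))%C).
  - unfold within. apply filter_forall. intros nu' Hn. rewrite (Kint_series nu' _ Hn). unfold BesselK_gen, Kseries.
    assert (Hs := csin_PI_neq_0 nu' Hn).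
    rewrite !BesselI_Om.
    assert (E : (RtoC t / RtoC 2)%C = RtoC (t / 2)) by (rewrite RtoC_div by lra; reflexivity).
    rewrite E, !cpow_pos by lra.
    assert (E2 : Cpown (RtoC (t / 2)) 2 = RtoC (exp (2 * ln (t / 2)))).
    { rewrite Cpown_R. f_equal. replace (2 * ln (t / 2)) with (INR 2 * ln (t / 2)) by (simpl; ring).
      rewrite exp_nat, exp_ln by lra. reflexivity. }
    rewrite E2. replace (RtoC 1 + - nu')%C with (RtoC 1 - nu')%C by ring.
    set (l := RtoC (ln (t / 2))).
    replace (RtoC (2 * ln (t / 2))) with (RtoC 2 * l)%C by (unfold l; now rewrite <- RtoC_mult).
    replace (nu' * (RtoC 2 * l))%C with (nu' * l + nu' * l)%C
      by (replace (RtoC 2) with (RtoC 1 + RtoC 1)%C by (rewrite <- RtoC_plus; f_equal; ring); ring).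
    replace (- nu' * l)%C with (- (nu' * l))%C by ring. rewrite cexp_add, cexp_opp.
    unfold Rdiv. rewrite RtoC_mult, RtoC_inv by lra.
    pose proof (cexp_neq_0 (nu' * l)%C). field; nz.
  - eapply filterlim_filter_le_1; [apply filter_le_within|].
    apply flim_Cmult; [apply filterlim_const|]. apply flim_Cmult.
    + apply flim_cexp, flim_Cmult; [apply flim_Copp, filterlim_id | apply filterlim_const].
    + apply Kint_flim, filterlim_id.
Qed.

(** ** Trigonometric identities *)

Lemma cexp_Ci_minus (a b : C) : cexp (Defs.Ci * (a - b))%C = (cexp (Defs.Ci * a) / cexp (Defs.Ci * b))%C.
Proof.
  replace (Defs.Ci * (a - b))%C with (Defs.Ci * a + - (Defs.Ci * b))%C by ring. now rewrite cexp_add, cexp_opp.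
Qed.

Lemma csin_minus (a b : C) : csin (a - b)%C = (csin a * ccos b - ccos a * csin b)%C.
Proof.
  unfold csin, ccos. rewrite !cexp_opp, cexp_Ci_minus.
  pose proof (cexp_neq_0 (Defs.Ci * a)%C). pose proof (cexp_neq_0 (Defs.Ci * b)%C).
  replace (RtoC 2 * Defs.Ci)%C with (Defs.Ci + Defs.Ci)%C
    by (replace (RtoC 2) with (RtoC 1 + RtoC 1)%C by (rewrite <- RtoC_plus; f_equal; ring); ring).
  assert (Defs.Ci + Defs.Ci <> RtoC 0)%C.
  { intros E. apply (f_equal snd) in E. simpl in E. lra. }
  replace (RtoC 2) with (RtoC 1 + RtoC 1)%C by (rewrite <- RtoC_plus; f_equal; ring).
  assert (RtoC 1 + RtoC 1 <> RtoC 0)%C by (intros E; apply (f_equal fst) in E; simpl in E; lra).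
  field; nz.
Qed.

Lemma cexp_Ci_PI2 : cexp (Defs.Ci * RtoC (PI / 2))%C = Defs.Ci.
Proof.
  unfold cexp, Defs.Ci. simpl.
  replace (0 * (PI / 2) - 1 * 0) with 0 by ring. replace (0 * 0 + 1 * (PI / 2)) with (PI / 2) by ring.
  rewrite exp_0, cos_PI2, sin_PI2. unfold Cmult, RtoC; simpl. f_equal; ring.
Qed.

Lemma Ci_inv : (/ Defs.Ci)%C = (- Defs.Ci)%C.
Proof.
  apply (Cmult_reg_r _ _ Defs.Ci Ci_neq_0). rewrite Cinv_l by apply Ci_neq_0.
  replace (- Defs.Ci * Defs.Ci)%C with (- (Defs.Ci * Defs.Ci))%C by ring. rewrite Ci_sqr. ring.
Qed.

Lemma ccos_PI2_minus (a : C) : ccos (RtoC (PI / 2) - a)%C = csin a.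
Proof.
  unfold csin, ccos, Cdiv. rewrite !cexp_opp, cexp_Ci_minus, cexp_Ci_PI2.
  set (A := cexp (Defs.Ci * a)%C). assert (HA : A <> RtoC 0) by apply cexp_neq_0.
  replace (/ (RtoC 2 * Defs.Ci))%C with (/ RtoC 2 * / Defs.Ci)%C by (field; nz).
  replace (/ (Defs.Ci / A))%C with (/ Defs.Ci * A)%C by (field; nz). rewrite Ci_inv.
  unfold Cdiv. ring.
Qed.

Lemma csin_PI2_minus (a : C) : csin (RtoC (PI / 2) - a)%C = ccos a.
Proof.
  rewrite <- ccos_PI2_minus. f_equal. ring.
Qed.

(** ** The Lommel function at generic parameters *)

Definition lal (mu nu : C) : C := ((RtoC 1 - mu + nu) / RtoC 2)%C.
Definition lbe (mu nu : C) : C := ((RtoC 1 - mu - nu) / RtoC 2)%C.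

Lemma Cdiv_2_double (c : C) : (c / RtoC 2 + c / RtoC 2)%C = c.
Proof.
  replace (RtoC 2) with (RtoC 1 + RtoC 1)%C by (rewrite <- RtoC_plus; f_equal; ring).
  assert (RtoC 1 + RtoC 1 <> RtoC 0)%C by (intros E; apply (f_equal fst) in E; simpl in E; lra).
  field; assumption.
Qed.

Lemma RtoC_2_plus : RtoC 2 = (RtoC 1 + RtoC 1)%C.
Proof. rewrite <- RtoC_plus; f_equal; ring. Qed.

Lemma lal_minus_lbe (mu nu : C) : (lal mu nu - lbe mu nu)%C = nu.
Proof. unfold lal, lbe. field; nz. Qed.

Lemma Cint_half_odd (c : C) (a : C) : (a + a)%C = (RtoC 1 - c)%C -> Cint a -> Codd c.
Proof.
  intros E [j Hj]. exists (- j)%Z. rewrite plus_IZR, mult_IZR, opp_IZR.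
  replace c with (RtoC 1 - (a + a))%C by (rewrite E; ring). rewrite Hj.
  rewrite <- RtoC_plus, <- RtoC_minus. f_equal. ring.
Qed.

Lemma generic_nonint (mu nu : C) : lommel_generic (mu, nu) ->
  ~ Cint nu /\ ~ Cint (lal mu nu) /\ ~ Cint (lbe mu nu).
Proof.
  intros (H1 & H2 & H3). simpl in *. split; [exact H1|]. split; intros H.
  - apply H3. apply (Cint_half_odd _ (lal mu nu)); [|exact H]. unfold lal. rewrite Cdiv_2_double. ring.
  - apply H2. apply (Cint_half_odd _ (lbe mu nu)); [|exact H]. unfold lbe. rewrite Cdiv_2_double. ring.
Qed.

Lemma Om_comm (a b w : C) : Om a b w = Om b a w.
Proof. unfold Om. f_equal. apply functional_extensionality. intros k. unfold Om_term. ring. Qed.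

Lemma rgamma_neq_0_nonint (a : C) : ~ Cint a -> rgamma a <> RtoC 0.
Proof. intros H. apply rgamma_neq_0. intros n. now apply not_Cint_neq_opp_nat. Qed.

Lemma Cint_minus_from (a : C) (k : Z) : Cint (RtoC (IZR k) - a)%C -> Cint a.
Proof. intros H. apply Cint_opp. apply (Cint_shift _ k). exact H. Qed.

Lemma hyp1F2_Om (a b x : C) : ~ Cint a -> ~ Cint b ->
  hyp1F2_1 a b x = (Om a b x / (rgamma a * rgamma b))%C.
Proof.
  intros Ha Hb. assert (Ra := rgamma_neq_0_nonint a Ha). assert (Rb := rgamma_neq_0_nonint b Hb).
  apply Cseries_eq. apply (filterlim_ext (fun K => / (rgamma a * rgamma b) * psum (Om_term a b x) K)%C).
  - intros K. rewrite <- psum_Cmult. apply psum_ext. intros k. unfold Om_term.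
    assert (Ea := rgamma_poch a k). assert (Eb := rgamma_poch b k).
    assert (poch a k <> RtoC 0) by (intros E; apply Ra; rewrite Ea, E; ring).
    assert (poch b k <> RtoC 0) by (intros E; apply Rb; rewrite Eb, E; ring).
    assert (rgamma (a + RtoC (INR k))%C <> RtoC 0) by (intros E; apply Ra; rewrite Ea, E; ring).
    assert (rgamma (b + RtoC (INR k))%C <> RtoC 0) by (intros E; apply Rb; rewrite Eb, E; ring).
    rewrite Ea, Eb. field; nz.
  - replace (Om a b x / (rgamma a * rgamma b))%C with (/ (rgamma a * rgamma b) * Om a b x)%C by (unfold Cdiv; ring).
    apply flim_Cmult; [apply filterlim_const | apply Om_lim].
Qed.

Lemma rgamma_reflection_inv (a : C) : ~ Cint a ->
  (/ rgamma (RtoC 1 - a))%C = (RtoC PI / csin (a * RtoC PI) * rgamma a)%C.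
Proof.
  intros Ha. rewrite <- rgamma_reflection.
  assert (rgamma a <> RtoC 0) by now apply rgamma_neq_0_nonint.
  assert (rgamma (RtoC 1 - a)%C <> RtoC 0).
  { apply rgamma_neq_0_nonint. intros H0. apply Ha. now apply (Cint_minus_from _ 1). }
  assert (RtoC PI <> RtoC 0) by (apply RtoC_neq_0; pose proof PI_RGT_0; lra).
  field; nz.
Qed.

(** The third line of [Xform] is [lommel_s]; the first two are the part with [BesselJ] and
    [BesselY_gen], once the Gamma factors are rewritten by reflection. *)
Lemma lommel_S_gen_Xform (mu nu z : C) : 0 < Re z -> lommel_generic (mu, nu) ->
  lommel_S_gen mu nu z =
  (/ RtoC 4 * cexp ((mu + RtoC 1) * clog z) * (rgamma (lal mu nu) * rgamma (lbe mu nu))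
    * Xform (lal mu nu) (lbe mu nu) (RtoC 2 * (clog z - RtoC (ln 2))))%C.
Proof.
  intros Hz Hg. destruct (generic_nonint _ _ Hg) as (Nn & Na & Nb).
  assert (Hz0 : z <> RtoC 0) by (intros E; rewrite E in Hz; simpl in Hz; lra).
  assert (Hz2 : (z / RtoC 2)%C <> RtoC 0).
  { intros E. apply Hz0. replace z with (z / RtoC 2 * RtoC 2)%C by (field; nz). rewrite E. ring. }
  assert (Hez := cexp_clog z Hz). set (Lz := clog z) in *.
  set (l := (Lz - RtoC (ln 2))%C).
  assert (Hl : cexp l = (z / RtoC 2)%C).
  { unfold l, Cminus. rewrite cexp_add, cexp_opp, cexp_R, exp_ln, Hez by lra. reflexivity. }
  assert (Hzeta : cexp (RtoC 2 * l)%C = Cpown (z / RtoC 2) 2).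
  { replace (RtoC 2 * l)%C with (l + l)%C by ring. rewrite cexp_add, Hl, Cpown_2. reflexivity. }
  set (a := lal mu nu) in *. set (b := lbe mu nu) in *.
  assert (Hab : (a - b)%C = nu) by apply lal_minus_lbe.
  assert (Sa := csin_PI_neq_0 a Na). assert (Sb := csin_PI_neq_0 b Nb). assert (Sn := csin_PI_neq_0 nu Nn).
  assert (HPI : RtoC PI <> RtoC 0) by (apply RtoC_neq_0; pose proof PI_RGT_0; lra).
  assert (H4 : RtoC 4 = (RtoC 2 * RtoC 2)%C) by (rewrite <- RtoC_mult; f_equal; ring).
  pose proof C2_neq_0 as H2.
  assert (E1a : ((mu - nu + RtoC 1) / RtoC 2)%C = (RtoC 1 - a)%C) by (unfold a, lal; field; nz).
  assert (E1b : ((mu + nu + RtoC 1) / RtoC 2)%C = (RtoC 1 - b)%C) by (unfold b, lbe; field; nz).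
  assert (H3 : RtoC 3 = (RtoC 1 + RtoC 1 + RtoC 1)%C) by (rewrite <- !RtoC_plus; f_equal; ring).
  assert (E2a : ((mu - nu + RtoC 3) / RtoC 2)%C = (RtoC 2 - a)%C) by (unfold a, lal; rewrite ?H3; field; nz).
  assert (E2b : ((mu + nu + RtoC 3) / RtoC 2)%C = (RtoC 2 - b)%C) by (unfold b, lbe; rewrite ?H3; field; nz).
  assert (EJ : forall n, BesselJ n z = (cexp (n * l) * Om (RtoC 1) (RtoC 1 + n) (- cexp (RtoC 2 * l)))%C).
  { intros n. rewrite BesselJ_Om. rewrite cpow_neq_0 by exact Hz2. rewrite clog_half by exact Hz.
    now rewrite Hzeta. }
  assert (Hsq : (- (Cpown z 2 / RtoC 4))%C = (- cexp (RtoC 2 * l))%C).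
  { rewrite Hzeta, !Cpown_2, H4. field; nz. }
  assert (Es : lommel_s mu nu z = (/ RtoC 4 * cexp ((mu + RtoC 1) * Lz) * (rgamma a * rgamma b) *
     (RtoC PI / csin (b * RtoC PI) * (RtoC PI / csin (a * RtoC PI)) * Om (RtoC 2 - b) (RtoC 2 - a) (- cexp (RtoC 2 * l))))%C).
  { unfold lommel_s. rewrite cpow_neq_0 by exact Hz0. fold Lz. rewrite E2a, E2b, Hsq.
    assert (Na2 : ~ Cint (RtoC 2 - a)%C) by (intros H; apply Na; now apply (Cint_minus_from _ 2)).
    assert (Nb2 : ~ Cint (RtoC 2 - b)%C) by (intros H; apply Nb; now apply (Cint_minus_from _ 2)).
    rewrite hyp1F2_Om, Om_comm by assumption.
    (* The denominator of [lommel_s] supplies the factors [1 - a] and [1 - b] that turn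
       [rgamma (2 - a)] and [rgamma (2 - b)] into the values at [1 - a] and [1 - b]. *)
    assert (ED : (Cpown (mu + RtoC 1) 2 - Cpown nu 2)%C = (RtoC 4 * ((RtoC 1 - a) * (RtoC 1 - b)))%C).
    { rewrite !Cpown_2, <- E1a, <- E1b. field; nz. }
    rewrite ED.
    assert (Fa := rgamma_reflection_inv a Na). assert (Fb := rgamma_reflection_inv b Nb).
    rewrite (rgamma_step (RtoC 1 - a)%C) in Fa. rewrite (rgamma_step (RtoC 1 - b)%C) in Fb.
    replace (RtoC 1 - a + RtoC 1)%C with (RtoC 2 - a)%C in Fa by (rewrite RtoC_2_plus; ring).
    replace (RtoC 1 - b + RtoC 1)%C with (RtoC 2 - b)%C in Fb by (rewrite RtoC_2_plus; ring).
    assert (Ra2 := rgamma_neq_0_nonint _ Na2). assert (Rb2 := rgamma_neq_0_nonint _ Nb2).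
    assert (Ia : (RtoC 1 - a)%C <> RtoC 0).
    { intros E. apply Na. exists 1%Z. replace a with (RtoC 1 - (RtoC 1 - a))%C by ring. rewrite E. ring. }
    assert (Ib : (RtoC 1 - b)%C <> RtoC 0).
    { intros E. apply Nb. exists 1%Z. replace b with (RtoC 1 - (RtoC 1 - b))%C by ring. rewrite E. ring. }
    set (O := Om (RtoC 2 - b) (RtoC 2 - a) (- cexp (RtoC 2 * l))). set (Z := cexp ((mu + RtoC 1) * Lz)).
    transitivity (/ RtoC 4 * Z * (/ ((RtoC 1 - a) * rgamma (RtoC 2 - a)) * / ((RtoC 1 - b) * rgamma (RtoC 2 - b))) * O)%C.
    - field; nz.
    - rewrite Fa, Fb. ring. }
  unfold lommel_S_gen. rewrite Es. unfold BesselY_gen, Cgamma. rewrite E1a, E1b, !EJ.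
  rewrite (rgamma_reflection_inv a Na), (rgamma_reflection_inv b Nb).
  (* The complementary angle exchanges sine and cosine. *)
  assert (Et : ((mu - nu) * RtoC PI / RtoC 2)%C = (RtoC (PI / 2) - a * RtoC PI)%C).
  { unfold Rdiv. rewrite RtoC_mult, RtoC_inv by lra. unfold a, lal. field; nz. }
  rewrite Et, csin_PI2_minus, ccos_PI2_minus.
  assert (Etr : csin (b * RtoC PI)%C = (csin (a * RtoC PI) * ccos (nu * RtoC PI) - ccos (a * RtoC PI) * csin (nu * RtoC PI))%C).
  { rewrite <- csin_minus. f_equal. rewrite <- Hab. ring. }
  rewrite cpow_pos by lra. unfold Xform. rewrite Hab.
  replace (RtoC 1 + - nu)%C with (RtoC 1 - nu)%C by ring.
  assert (P0 : cexp ((mu - RtoC 1) * RtoC (ln 2))%C = (/ RtoC 4 * cexp ((mu + RtoC 1) * RtoC (ln 2)))%C).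
  { replace ((mu + RtoC 1) * RtoC (ln 2))%C with ((mu - RtoC 1) * RtoC (ln 2) + (RtoC (ln 2) + RtoC (ln 2)))%C by ring.
    rewrite !cexp_add, cexp_R, exp_ln by lra. rewrite H4. field; nz. }
  (* As [2 * (b - 1) = - mu - 1 - nu], the powers of [z] collapse to [2^(mu+1) (z/2)^(-nu)]; [P2] is
     the same with [nu] for [- nu]. *)
  assert (P1 : (cexp ((mu + RtoC 1) * Lz) * cexp ((b - RtoC 1) * (RtoC 2 * l)))%C
     = (cexp ((mu + RtoC 1) * RtoC (ln 2)) * cexp (- nu * l))%C).
  { rewrite <- !cexp_add. f_equal. unfold b, lbe, l. field; nz. }
  assert (P2 : (cexp ((mu + RtoC 1) * Lz) * cexp ((a - RtoC 1) * (RtoC 2 * l)))%C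
     = (cexp ((mu + RtoC 1) * RtoC (ln 2)) * cexp (nu * l))%C).
  { rewrite <- !cexp_add. f_equal. unfold a, lal, l. field; nz. }
  rewrite P0.
  set (Z := cexp ((mu + RtoC 1) * Lz)) in *. set (Eb := cexp ((b - RtoC 1) * (RtoC 2 * l))) in *.
  set (Ea := cexp ((a - RtoC 1) * (RtoC 2 * l))) in *. set (T := cexp ((mu + RtoC 1) * RtoC (ln 2))) in *.
  set (Nm := cexp (- nu * l)) in *. set (Np := cexp (nu * l)) in *.
  set (O1 := Om (RtoC 1) (RtoC 1 - nu) _). set (O2 := Om (RtoC 1) (RtoC 1 + nu) _). set (O3 := Om _ _ _).
  set (sa := csin (a * RtoC PI)) in *. set (sb := csin (b * RtoC PI)) in *. set (sn := csin (nu * RtoC PI)) in *.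
  set (ca := ccos (a * RtoC PI)) in *. set (cn := ccos (nu * RtoC PI)) in *.
  set (ga := rgamma a). set (gb := rgamma b). set (p := RtoC PI) in *.
  assert (H4n : RtoC 4 <> RtoC 0) by (rewrite H4; now apply Cmult_neq_0).
  transitivity (/ RtoC 4 * (ga * gb) * (p / sn * (p / sb) * (Z * Eb) * O1 - p / sn * (p / sa) * (Z * Ea) * O2
     + Z * (p / sb * (p / sa) * O3)))%C; [|ring].
  rewrite P1, P2.
  (* Since [b = a - nu], the subtraction formula [Etr] for [csin (b * PI)] merges the two terms in
     [J_nu]. *)
  assert (Key : (ca * (Np * O2) - sa * ((Np * O2 * cn - Nm * O1) / sn))%C = ((sa * (Nm * O1) - sb * (Np * O2)) / sn)%C).
  { rewrite Etr. field; nz. }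
  rewrite Key. field; nz.
Qed.

(** ** The asymptotic expansion from the functional equation of [Om] *)

(** Under the shift each sine changes sign, so the first two lines are multiplied by [- zeta]. In
    the third the signs cancel and [Om_step] yields the same multiple plus a constant, which
    reflection reduces to 1 after the Gamma factors. *)
Lemma Xform_step (al be w : C) : ~ Cint al -> ~ Cint be -> ~ Cint (al - be)%C ->
  (rgamma al * rgamma be * Xform (al + RtoC 1) (be + RtoC 1) w)%C =
  (RtoC 1 - cexp w * (rgamma al * rgamma be * Xform al be w))%C.
Proof.
  intros Na Nb Nn.
  assert (Sa := csin_PI_neq_0 al Na). assert (Sb := csin_PI_neq_0 be Nb). assert (Sn := csin_PI_neq_0 _ Nn).
  assert (HPI : RtoC PI <> RtoC 0) by (apply RtoC_neq_0; pose proof PI_RGT_0; lra).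
  assert (Ss : forall c, csin ((c + RtoC 1) * RtoC PI)%C = (- csin (c * RtoC PI))%C).
  { intros c. replace (csin ((c + RtoC 1) * RtoC PI)) with (- - csin ((c + RtoC 1) * RtoC PI))%C by ring.
    rewrite <- csin_PI_minus_1. do 3 f_equal. ring. }
  unfold Xform. rewrite !Ss.
  replace (al + RtoC 1 - (be + RtoC 1))%C with (al - be)%C by ring.
  replace (be + RtoC 1 - RtoC 1)%C with be by ring. replace (al + RtoC 1 - RtoC 1)%C with al by ring.
  replace (RtoC 2 - (be + RtoC 1))%C with (RtoC 1 - be)%C by (rewrite RtoC_2_plus; ring).
  replace (RtoC 2 - (al + RtoC 1))%C with (RtoC 1 - al)%C by (rewrite RtoC_2_plus; ring).
  rewrite (Om_step (RtoC 1 - be) (RtoC 1 - al)).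
  replace (RtoC 1 - be + RtoC 1)%C with (RtoC 2 - be)%C by (rewrite RtoC_2_plus; ring).
  replace (RtoC 1 - al + RtoC 1)%C with (RtoC 2 - al)%C by (rewrite RtoC_2_plus; ring).
  replace (cexp (be * w)) with (cexp w * cexp ((be - RtoC 1) * w))%C by (rewrite <- cexp_add; f_equal; ring).
  replace (cexp (al * w)) with (cexp w * cexp ((al - RtoC 1) * w))%C by (rewrite <- cexp_add; f_equal; ring).
  assert (Ra := rgamma_reflection al). assert (Rb := rgamma_reflection be).
  rewrite <- Ra in Sa |- *. rewrite <- Rb in Sb |- *.
  assert (rgamma al <> RtoC 0) by now apply rgamma_neq_0_nonint.
  assert (rgamma be <> RtoC 0) by now apply rgamma_neq_0_nonint.
  assert (rgamma (RtoC 1 - al)%C <> RtoC 0) by (intros E; apply Sa; rewrite E; ring).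
  assert (rgamma (RtoC 1 - be)%C <> RtoC 0) by (intros E; apply Sb; rewrite E; ring).
  field; nz.
Qed.

(** The factors [rgamma al * rgamma be] stay unshifted in front of the remainder, as in the final
    formula; the Pochhammer symbols account for the change at each step. *)
Lemma Xform_expansion (al be w : C) (N : nat) : ~ Cint al -> ~ Cint be -> ~ Cint (al - be)%C ->
  (rgamma al * rgamma be * Xform al be w)%C =
  (psum (fun n => / cexp w * (Cpown (- / cexp w) n * (poch al n * poch be n)))%C N
   + Cpown (- / cexp w) N * (rgamma al * rgamma be * Xform (al + RtoC (INR N)) (be + RtoC (INR N)) w))%C.
Proof.
  intros Na Nb Nn. pose proof (cexp_neq_0 w) as Hw. induction N as [|N IH].
  - simpl. rewrite !Cplus_0_r. ring.
  - rewrite IH. simpl psum. simpl Cpown. rewrite S_INR, RtoC_plus.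
    set (aN := (al + RtoC (INR N))%C). set (bN := (be + RtoC (INR N))%C).
    assert (Na' : ~ Cint aN).
    { intros H. apply Na. apply (Cint_shift _ (Z.of_nat N)). rewrite <- INR_IZR_INZ, Cplus_comm. exact H. }
    assert (Nb' : ~ Cint bN).
    { intros H. apply Nb. apply (Cint_shift _ (Z.of_nat N)). rewrite <- INR_IZR_INZ, Cplus_comm. exact H. }
    assert (Nn' : ~ Cint (aN - bN)%C).
    { replace (aN - bN)%C with (al - be)%C by (unfold aN, bN; ring). exact Nn. }
    assert (St := Xform_step aN bN w Na' Nb' Nn').
    replace (al + (RtoC (INR N) + RtoC 1))%C with (aN + RtoC 1)%C by (unfold aN; ring).
    replace (be + (RtoC (INR N) + RtoC 1))%C with (bN + RtoC 1)%C by (unfold bN; ring).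
    rewrite (rgamma_poch al N), (rgamma_poch be N). fold aN bN.
    replace (poch al N * rgamma aN * (poch be N * rgamma bN) * Xform (aN + RtoC 1) (bN + RtoC 1) w)%C
      with (poch al N * poch be N * (rgamma aN * rgamma bN * Xform (aN + RtoC 1) (bN + RtoC 1) w))%C by ring.
    rewrite St. field; nz.
Qed.

Lemma Xint_dom_ex (al be w : C) : Rabs (Im w) < PI -> 0 < Re al -> 0 < Re be ->
  exists K d, dom K d (fun x => cexp (be * RtoC x) * kern w x * Kint (al - be) x)%C.
Proof.
  intros Hw Ha Hb. set (rho := Rmin 1 (Rmin (Re al) (Re be)) / 2).
  assert (M0 := Rmin_l 1 (Rmin (Re al) (Re be))). assert (M1 := Rmin_r 1 (Rmin (Re al) (Re be))).
  assert (M2 := Rmin_l (Re al) (Re be)). assert (M3 := Rmin_r (Re al) (Re be)).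
  assert (M4 : 0 < Rmin 1 (Rmin (Re al) (Re be))) by (repeat apply Rmin_pos; lra).
  destruct (INR_unbounded (Re al + 1)) as [N' HN']. destruct (INR_unbounded (Re be)) as [N HN].
  assert (HA : - Rabs (Re w) <= Re w) by (pose proof (Rle_abs (- Re w)); rewrite Rabs_Ropp in *; lra).
  eexists. exists rho.
  apply (Xint_dom (Rabs (Im w)) (Rabs (Re w)) rho rho w al be N N'); try apply Rabs_pos; try (unfold rho; lra); try lra.
  split; [apply Rabs_pos | exact Hw].
Qed.

Lemma lal_shift (mu nu : C) (N : nat) : lal (mu - RtoC (2 * INR N)) nu = (lal mu nu + RtoC (INR N))%C.
Proof. unfold lal. rewrite RtoC_mult. field; nz. Qed.

Lemma lbe_shift (mu nu : C) (N : nat) : lbe (mu - RtoC (2 * INR N)) nu = (lbe mu nu + RtoC (INR N))%C.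
Proof. unfold lbe. rewrite RtoC_mult. field; nz. Qed.

Lemma Re_half (c : C) : Re (c / RtoC 2)%C = Re c / 2.
Proof.
  destruct c as [x y]. unfold Cdiv. rewrite <- RtoC_inv by lra. unfold Cmult, RtoC. cbn [Re fst snd]. field.
Qed.

Lemma Re_lal (mu nu : C) : Re (lal mu nu) = (1 - Re mu + Re nu) / 2.
Proof. unfold lal. rewrite Re_half. destruct mu, nu; simpl. field. Qed.

Lemma Re_lbe (mu nu : C) : Re (lbe mu nu) = (1 - Re mu - Re nu) / 2.
Proof. unfold lbe. rewrite Re_half. destruct mu, nu; simpl. field. Qed.

(** The double logarithm [log (z^2/4)], with imaginary part in [(-pi, pi)]. *)
Definition wz (z : C) : C := (RtoC 2 * (clog z - RtoC (ln 2)))%C.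

Lemma wz_strip (z : C) : Rabs (Carg z) < PI / 2 -> Rabs (Im (wz z)) < PI.
Proof.
  intros H. assert (E : Im (wz z) = 2 * Carg z).
  { unfold wz, clog. simpl. ring. }
  rewrite E, Rabs_mult, (Rabs_pos_eq 2) by lra. lra.
Qed.

Lemma cexp_wz (z : C) : 0 < Re z -> cexp (wz z) = (z * z / RtoC 4)%C.
Proof.
  intros Hz. unfold wz.
  replace (RtoC 2 * (clog z - RtoC (ln 2)))%C with (clog z + clog z + - (RtoC (ln 2) + RtoC (ln 2)))%C by ring.
  rewrite cexp_add, cexp_opp, !cexp_add, cexp_R, exp_ln, cexp_clog by (assumption || lra).
  replace (RtoC 2 * RtoC 2)%C with (RtoC 4) by (rewrite <- RtoC_mult; f_equal; ring). reflexivity.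
Qed.

Lemma scal_R_Cmult (r : R) (c : C) : @scal R_AbsRing C_R_NormedModule r c = (RtoC r * c)%C.
Proof. destruct c as [a b]. apply injective_projections; cbn; unfold mult; cbn; ring. Qed.

(** * Back from the line to the half-line *)

Section ChangeOfVariable.
Variables (mu nu z : C).
Hypotheses (Hz : 0 < Re z) (Hw : Rabs (Im (wz z)) < PI).

(** With [x = 2 ln (t/2)] one has [dx = (2/t) dt], which is the isolated factor, and
    [1 + (t/z)^2 = (zeta + e^x) / zeta], which produces the kernel and the factor [cexp (wz z)]. *)
Lemma Laplace_integrand_subst (t : R) : 0 < t ->
  (cpow (RtoC t) (- mu) * BesselK nu (RtoC t) / (RtoC 1 + Cpown (RtoC t / z) 2))%C =
  (RtoC (2 / t) * (/ RtoC 2 * cexp (wz z) * cexp (- mu * RtoC (ln 2)) *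
     (cexp (lbe mu nu * RtoC (2 * ln (t / 2))) * kern (wz z) (2 * ln (t / 2)) * Kint nu (2 * ln (t / 2)))))%C.
Proof.
  intros Ht. set (L := ln (t / 2)).
  assert (HtL : t = 2 * exp L) by (unfold L; rewrite exp_ln by lra; field).
  assert (Hln : ln t = ln 2 + L).
  { rewrite HtL, ln_mult, ln_exp by (try lra; apply exp_pos). reflexivity. }
  rewrite cpow_pos, BesselK_Kint by exact Ht. fold L. rewrite Hln.
  unfold kern. assert (Hden := kern_den_neq_0 (wz z) (2 * L) Hw).
  assert (Hze : cexp (wz z) <> RtoC 0) by apply cexp_neq_0.
  assert (Hz0 : z <> RtoC 0) by (intros E; rewrite E in Hz; simpl in Hz; lra).
  rewrite (cexp_wz z Hz) in *.
  assert (E2L : RtoC (exp (2 * L)) = (RtoC (exp L) * RtoC (exp L))%C).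
  { rewrite <- RtoC_mult, <- exp_plus. do 2 f_equal. ring. }
  rewrite E2L in *.
  assert (HeL : RtoC (exp L) <> RtoC 0) by (apply RtoC_neq_0; pose proof (exp_pos L); lra).
  assert (Eb : cexp (lbe mu nu * RtoC (2 * L))%C = (RtoC (exp L) * cexp (- mu * RtoC L) * cexp (- nu * RtoC L))%C).
  { rewrite <- cexp_R, <- !cexp_add. f_equal. unfold lbe. rewrite RtoC_mult. field; nz. }
  rewrite Eb.
  replace (- mu * RtoC (ln 2 + L))%C with (- mu * RtoC (ln 2) + - mu * RtoC L)%C by (rewrite RtoC_plus; ring).
  rewrite cexp_add.
  assert (E2t : RtoC (2 / t) = (/ RtoC (exp L))%C).
  { rewrite <- RtoC_inv by (pose proof (exp_pos L); lra). f_equal. rewrite HtL. field. pose proof (exp_pos L); lra. }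
  rewrite E2t. assert (EtC : RtoC t = (RtoC 2 * RtoC (exp L))%C) by (rewrite <- RtoC_mult; now f_equal).
  rewrite EtC, Cpown_2.
  set (e := RtoC (exp L)) in *. set (A := cexp (- mu * RtoC (ln 2))). set (B := cexp (- mu * RtoC L)).
  set (D := cexp (- nu * RtoC L)). set (Kk := Kint nu (2 * L)).
  assert (H4 : RtoC 4 = (RtoC 2 * RtoC 2)%C) by (rewrite <- RtoC_mult; f_equal; ring).
  assert (Hd2 : (z * z + RtoC 4 * (e * e))%C <> RtoC 0).
  { intros E. apply Hden. replace (z * z / RtoC 4 + e * e)%C with ((z * z + RtoC 4 * (e * e)) / RtoC 4)%C.
    - rewrite E. unfold Cdiv. ring.
    - rewrite H4. field; nz. }
  assert (Hk : (RtoC 1 + RtoC 2 * e / z * (RtoC 2 * e / z))%C = ((z * z + RtoC 4 * (e * e)) / (z * z))%C).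
  { rewrite H4. field; nz. }
  assert (Hk2 : (z * z / RtoC 4 + e * e)%C = ((z * z + RtoC 4 * (e * e)) / RtoC 4)%C).
  { rewrite H4. field; nz. }
  rewrite Hk, Hk2. set (Q := (z * z + RtoC 4 * (e * e))%C) in *.
  field; nz.
Qed.

(** Only the exponent [- mu] is treated: the integral with [t^(2N - mu)] is this one with [mu - 2N]
    in place of [mu]. *)
Lemma is_RInt_gen_Xint : 0 < Re (lal mu nu) -> 0 < Re (lbe mu nu) ->
  @is_RInt_gen C_R_NormedModule
    (fun t : R => cpow (RtoC t) (- mu) * BesselK nu (RtoC t) / (RtoC 1 + Cpown (RtoC t / z) 2))%C
    (at_right 0) (Rbar_locally p_infty)
    (/ RtoC 2 * cexp (wz z) * cexp (- mu * RtoC (ln 2)) * Xint (lal mu nu) (lbe mu nu) (wz z))%C.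
Proof.
  intros Ha Hb. destruct (Xint_dom_ex _ _ _ Hw Ha Hb) as (K & d & D).
  unfold Xint. rewrite lal_minus_lbe in *.
  set (H := fun x => (cexp (lbe mu nu * RtoC x) * kern (wz z) x * Kint nu x)%C) in *.
  set (c := (/ RtoC 2 * cexp (wz z) * cexp (- mu * RtoC (ln 2)))%C).
  set (g := fun t : R => 2 * ln (t / 2)).
  assert (Hg : forall t, 0 < t -> is_derive g t (2 / t)).
  { intros t Ht. unfold g. auto_derive; [lra|]. field. lra. }
  assert (HI : forall a b, 0 < a -> 0 < b -> is_CInt
     (fun t : R => cpow (RtoC t) (- mu) * BesselK nu (RtoC t) / (RtoC 1 + Cpown (RtoC t / z) 2))%C a b
     (c * CInt H (g a) (g b))%C).
  { intros a b Hpa Hpb. assert (Hm : 0 < Rmin a b) by (now apply Rmin_pos).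
    assert (R1 := is_RInt_comp (V := C_R_CompleteNormedModule) (fun x => c * H x)%C g (fun t => 2 / t) a b).
    rewrite (CInt_eq _ _ _ _ (is_CInt_Cmult H (g a) (g b) c _ (CInt_correct H _ _ (proj1 (proj2 D))))) in R1.
    apply (is_RInt_ext (V := C_R_NormedModule) (fun t => scal (2 / t) (c * H (g t))%C)).
    - intros t Ht. rewrite Laplace_integrand_subst by lra. rewrite scal_R_Cmult. reflexivity.
    - apply R1.
      + intros x _. apply continuous_Cmult; [apply continuous_const | apply D].
      + intros x Hx. split; [apply Hg; lra|].
        apply (continuous_mult (K := R_AbsRing) (fun _ => 2) (fun t => / t)); [apply continuous_const|].
        apply (ex_derive_continuous (V := R_NormedModule)). auto_derive. lra. }
  assert (Lg0 : filterlim g (at_right 0) (Rbar_locally m_infty)).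
  { intros P [M HM]. exists (mkposreal _ (exp_pos (M / 2))). intros t Ht Ht0. apply HM. unfold g.
    apply R_ball_Rabs in Ht. rewrite Rminus_0_r, Rabs_pos_eq in Ht by lra. simpl in Ht.
    assert (ln (t / 2) < M / 2); [|lra]. rewrite <- (ln_exp (M / 2)). apply ln_increasing; lra. }
  assert (Lgi : filterlim g (Rbar_locally p_infty) (Rbar_locally p_infty)).
  { intros P [M HM]. exists (2 * exp (M / 2)). intros t Ht. apply HM. unfold g.
    pose proof (exp_pos (M / 2)).
    assert (M / 2 < ln (t / 2)); [|lra]. rewrite <- (ln_exp (M / 2)) at 1. apply ln_increasing; lra. }
  assert (L : filterlim (fun ab : R * R => c * CInt H (g (fst ab)) (g (snd ab)))%C
     (filter_prod (at_right 0) (Rbar_locally p_infty)) (locally (c * LInt H)%C)).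
  { apply flim_Cmult; [apply filterlim_const|].
    (* The product filter moves the two endpoints independently, beyond the symmetric limit defining
       [LInt]. *)
    apply (LInt_flim_gen H K d (fun ab => g (fst ab)) (fun ab => g (snd ab)) D).
    - apply (filterlim_comp _ _ _ fst g _ (at_right 0)); [apply filterlim_fst | exact Lg0].
    - apply (filterlim_comp _ _ _ snd g _ (Rbar_locally p_infty)); [apply filterlim_snd | exact Lgi]. }
  intros P HP.
  assert (HL : filter_prod (at_right 0) (Rbar_locally p_infty)
     (fun ab : R * R => P (c * CInt H (g (fst ab)) (g (snd ab)))%C)) by exact (L P HP).
  assert (Hpos : filter_prod (at_right 0) (Rbar_locally p_infty) (fun ab : R * R => 0 < fst ab /\ 0 < snd ab)).
  { apply (Filter_prod _ _ _ (fun x => 0 < x) (fun x => 0 < x)); [|now exists 0 | intros; now split].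
    exists (mkposreal 1 Rlt_0_1). auto. }
  generalize (filter_and _ _ Hpos HL). unfold filtermapi. apply filter_imp.
  intros [a b] [[Hpa Hpb] HPab].
  exists (c * CInt H (g a) (g b))%C. split; [now apply HI | exact HPab].
Qed.

End ChangeOfVariable.

(** ** The expansion at generic parameters and passage to the limit *)

Lemma Cpown_inv (a : C) (n : nat) : a <> RtoC 0 -> Cpown (/ a) n = (/ Cpown a n)%C.
Proof.
  intros Ha. induction n as [|n IH]; simpl; [field; nz|]. rewrite IH. pose proof (Cpown_neq_0 a n Ha). field; nz.
Qed.

(** Each factor [(- mu + 2n + 1)^2 - nu^2] is a difference of squares equal to
    [4 (alpha + n)(beta + n)]. *)
Lemma lommel_a_poch (n : nat) (mu nu : C) :
  lommel_a n (- mu) nu = (Cpown (RtoC 4) n * (poch (lal mu nu) n * poch (lbe mu nu) n))%C.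
Proof.
  induction n as [|n IH]; [simpl; ring|].
  change (lommel_a (S n) (- mu) nu) with
    (lommel_a n (- mu) nu * (Cpown (- mu + RtoC (2 * INR (S n) - 1)) 2 - Cpown nu 2))%C.
  rewrite IH. simpl poch. simpl (Cpown (RtoC 4) (S n)).
  replace (Cpown (- mu + RtoC (2 * INR (S n) - 1)) 2 - Cpown nu 2)%C
    with (RtoC 4 * ((lal mu nu + RtoC (INR n)) * (lbe mu nu + RtoC (INR n))))%C; [ring|].
  rewrite S_INR, !Cpown_2. replace (2 * (INR n + 1) - 1) with (2 * INR n + 1) by ring.
  rewrite RtoC_plus, RtoC_mult. unfold lal, lbe.
  replace (RtoC 4) with (RtoC 2 * RtoC 2)%C by (rewrite <- RtoC_mult; f_equal; ring). field; nz.
Qed.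

Definition expansion_sum (N : nat) (z mu nu : C) : C :=
  (cpow z (mu - RtoC 1) * psum (fun n => RtoC ((-1) ^ n) * lommel_a n (- mu) nu / Cpown z (2 * n)) N)%C.

Definition expansion_rem (N : nat) (z mu nu : C) : C :=
  (/ RtoC 4 * cexp ((mu + RtoC 1) * clog z) * (Cpown (- / cexp (wz z)) N *
     (rgamma (lal mu nu) * rgamma (lbe mu nu) *
        Xint (lal mu nu + RtoC (INR N)) (lbe mu nu + RtoC (INR N)) (wz z))))%C.

(** [Xform] makes sense for all generic parameters, so the expansion may start where [Xint]
    diverges. Only the shifted pair has to lie in the half-planes of convergence, and there
    [Xint_formula] recovers an integral. *)
Lemma lommel_S_gen_expansion (N : nat) (z mu nu : C) : 0 < Re z -> Rabs (Im (wz z)) < PI ->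
  lommel_generic (mu, nu) -> 0 < Re (lal mu nu) + INR N -> 0 < Re (lbe mu nu) + INR N ->
  lommel_S_gen mu nu z = (expansion_sum N z mu nu + expansion_rem N z mu nu)%C.
Proof.
  intros Hz Hw Hg Ha Hb. destruct (generic_nonint _ _ Hg) as (Nn & Na & Nb).
  assert (Nab : ~ Cint (lal mu nu - lbe mu nu)%C) by (now rewrite lal_minus_lbe).
  rewrite (lommel_S_gen_Xform mu nu z Hz Hg). fold (wz z).
  rewrite <- !Cmult_assoc, (Cmult_assoc (rgamma (lal mu nu))), (Xform_expansion _ _ (wz z) N Na Nb Nab).
  unfold expansion_sum, expansion_rem.
  rewrite (Xint_formula (lal mu nu + RtoC (INR N)) (lbe mu nu + RtoC (INR N)) (wz z)).
  - rewrite <- !Cmult_assoc, Cmult_plus_distr_l, Cmult_plus_distr_l. f_equal.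
    rewrite <- !psum_Cmult. apply psum_ext. intros n.
    assert (Hz0 : z <> RtoC 0) by (intros E; rewrite E in Hz; simpl in Hz; lra).
    assert (Hzz : (z * z)%C <> RtoC 0) by now apply Cmult_neq_0.
    assert (H4 : RtoC 4 <> RtoC 0) by (apply RtoC_neq_0; lra).
    rewrite lommel_a_poch, Cpown_mul_exp, Cpown_2, neg_pown_sign, cpow_neq_0 by exact Hz0.
    rewrite Cpown_inv by apply cexp_neq_0. rewrite (cexp_wz z Hz).
    replace (z * z / RtoC 4)%C with (z * z * / RtoC 4)%C by reflexivity.
    rewrite Cpown_mult, Cpown_inv by exact H4.
    replace ((mu + RtoC 1) * clog z)%C with ((mu - RtoC 1) * clog z + (clog z + clog z))%C by ring.
    rewrite !(cexp_add _ (_ + _)), cexp_add, cexp_clog by exact Hz.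
    pose proof (Cpown_neq_0 _ n Hzz). pose proof (Cpown_neq_0 _ n H4). field; nz.
  - now rewrite Re_plus_RtoC.
  - now rewrite Re_plus_RtoC.
  - exact Hw.
  - intros H. apply Na. apply (Cint_shift _ (Z.of_nat N)). rewrite <- INR_IZR_INZ, Cplus_comm. exact H.
  - intros H. apply Nb. apply (Cint_shift _ (Z.of_nat N)). rewrite <- INR_IZR_INZ, Cplus_comm. exact H.
  - replace (lal mu nu + RtoC (INR N) - (lbe mu nu + RtoC (INR N)))%C with (lal mu nu - lbe mu nu)%C by ring. exact Nab.
Qed.

Lemma not_Codd_of_between (a : C) (k : Z) : IZR k < Re a < IZR k + 1 -> ~ Codd a.
Proof.
  intros Hk [j Hj]. apply (not_Cint_of_between a k Hk). exists (2 * j + 1)%Z. exact Hj.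
Qed.

(** Generic pairs accumulate at every pair; otherwise the [Clim] in [lommel_S] would not be
    determined. *)
Lemma generic_filter_proper (p : C * C) : ProperFilter' (within lommel_generic (locally p)).
Proof.
  constructor; [|apply within_filter, locally_filter]. intros H. destruct p as [mu nu].
  (* Along this path [nu], [mu + nu] and [mu - nu] move at speeds 1, 3 and 1, none of them zero. *)
  assert (Hp : filterlim (fun e : R => ((mu + RtoC (2 * e))%C, (nu + RtoC (1 * e))%C) : C * C) (at_right 0) (locally ((mu, nu) : C * C))).
  { apply (@filterlim_filter_le_2 _ _ (at_right 0) (filter_prod (locally mu) (locally nu))).
    - intros P [eps HP]. exists (ball mu eps) (ball nu eps); try apply locally_ball.
      intros y z Hy Hz. apply HP. now split.
    - apply filterlim_pair; apply flim_right_shift. }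
  assert (H1 : at_right 0 (fun e : R => lommel_generic ((mu + RtoC (2 * e))%C, (nu + RtoC (1 * e))%C) -> False))
    by exact (Hp _ H).
  assert (N1 : 1 <> 0) by lra. assert (N3 : 3 <> 0) by lra.
  destruct (filter_ex _ (filter_and _ _ H1 (filter_and _ _ (right_noninteger (Re nu) 1 N1)
     (filter_and _ _ (right_noninteger (Re (mu + nu)%C) 3 N3) (right_noninteger (Re (mu - nu)%C) 1 N1)))))
    as (e & He & [k1 Hk1] & [k2 Hk2] & [k3 Hk3]).
  apply He. split; [|split]; cbn [fst snd].
  - apply (not_Cint_of_between _ k1). now rewrite Re_plus_RtoC.
  - apply (not_Codd_of_between _ k2).
    replace (mu + RtoC (2 * e) + (nu + RtoC (1 * e)))%C with (mu + nu + RtoC (3 * e))%C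
      by (replace (3 * e) with (2 * e + 1 * e) by ring; rewrite RtoC_plus; ring).
    now rewrite Re_plus_RtoC.
  - apply (not_Codd_of_between _ k3).
    replace (mu + RtoC (2 * e) - (nu + RtoC (1 * e)))%C with (mu - nu + RtoC (1 * e))%C
      by (replace (2 * e) with (1 * e + 1 * e) by ring; rewrite RtoC_plus; ring).
    now rewrite Re_plus_RtoC.
Qed.

Section Limits.
Context {T : Type} {F : (T -> Prop) -> Prop} {FF : Filter F}.
Variables (f g : T -> C) (mu nu : C).
Hypotheses (Hf : filterlim f F (locally mu)) (Hg : filterlim g F (locally nu)).

Lemma flim_lal : filterlim (fun t => lal (f t) (g t)) F (locally (lal mu nu)).
Proof.
  apply flim_Cdiv; [apply C2_neq_0 | | apply filterlim_const].
  apply flim_Cplus; [apply flim_Cminus; [apply filterlim_const | exact Hf] | exact Hg].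
Qed.

Lemma flim_lbe : filterlim (fun t => lbe (f t) (g t)) F (locally (lbe mu nu)).
Proof.
  apply flim_Cdiv; [apply C2_neq_0 | | apply filterlim_const].
  apply flim_Cminus; [apply flim_Cminus; [apply filterlim_const | exact Hf] | exact Hg].
Qed.

Lemma flim_expansion_sum (N : nat) (z : C) : z <> RtoC 0 ->
  filterlim (fun t => expansion_sum N z (f t) (g t)) F (locally (expansion_sum N z mu nu)).
Proof.
  intros Hz. unfold expansion_sum. apply flim_Cmult.
  - rewrite cpow_neq_0 by exact Hz.
    apply (filterlim_ext (fun t => cexp ((f t - RtoC 1) * clog z)%C)); [intros; symmetry; now apply cpow_neq_0|].
    apply flim_cexp, flim_Cmult; [apply flim_Cminus; [exact Hf|] |]; apply filterlim_const.
  - apply (flim_psum (fun n t => RtoC ((-1) ^ n) * lommel_a n (- f t) (g t) / Cpown z (2 * n))%C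
      (fun n => RtoC ((-1) ^ n) * lommel_a n (- mu) nu / Cpown z (2 * n))%C N).
    intros k. apply flim_Cdiv; [now apply Cpown_neq_0 | | apply filterlim_const].
    apply flim_Cmult; [apply filterlim_const|]. rewrite lommel_a_poch.
    apply (filterlim_ext (fun t => Cpown (RtoC 4) k * (poch (lal (f t) (g t)) k * poch (lbe (f t) (g t)) k))%C);
      [intros; symmetry; apply lommel_a_poch|].
    apply flim_Cmult; [apply filterlim_const|]. apply flim_Cmult; apply flim_poch; [apply flim_lal | apply flim_lbe].
Qed.

Lemma flim_rgamma (h : T -> C) (a : C) : filterlim h F (locally a) ->
  filterlim (fun t => rgamma (h t)) F (locally (rgamma a)).
Proof. intros H. apply (filterlim_comp _ _ _ h rgamma _ (locally a)); [exact H | apply rgamma_continuous]. Qed.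

Lemma flim_expansion_rem (N : nat) (z : C) : Rabs (Im (wz z)) < PI ->
  0 < Re (lal mu nu) + INR N -> 0 < Re (lbe mu nu) + INR N ->
  filterlim (fun t => expansion_rem N z (f t) (g t)) F (locally (expansion_rem N z mu nu)).
Proof.
  intros Hw Ha Hb. unfold expansion_rem. apply flim_Cmult.
  - apply flim_Cmult; [apply filterlim_const|].
    apply flim_cexp, flim_Cmult; [apply flim_Cplus; [exact Hf|] |]; apply filterlim_const.
  - apply flim_Cmult; [apply filterlim_const|]. apply flim_Cmult.
    + apply flim_Cmult; apply flim_rgamma; [apply flim_lal | apply flim_lbe].
    + apply Xint_flim; rewrite ?Re_plus_RtoC; auto;
        (apply flim_Cplus; [|apply filterlim_const]); [apply flim_lal | apply flim_lbe].
Qed.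

End Limits.

(** The right-hand side is continuous in [(mu, nu)], exceptional values included, because it
    contains only [rgamma], polynomials, exponentials and [Xint]. It is therefore the limit defining
    [lommel_S]. *)
Lemma lommel_S_expansion (N : nat) (z mu nu : C) : 0 < Re z -> Rabs (Im (wz z)) < PI ->
  0 < Re (lal mu nu) + INR N -> 0 < Re (lbe mu nu) + INR N ->
  lommel_S mu nu z = (expansion_sum N z mu nu + expansion_rem N z mu nu)%C.
Proof.
  intros Hz Hw Ha Hb. assert (Hz0 : z <> RtoC 0) by (intros E; rewrite E in Hz; simpl in Hz; lra).
  apply (Clim_eq (PF := generic_filter_proper (mu, nu))).
  assert (FW : Filter (within lommel_generic (locally ((mu, nu) : C * C)))) by (apply within_filter, locally_filter).
  assert (L1 : filterlim (fun p : C * C => fst p) (within lommel_generic (locally ((mu, nu) : C * C))) (locally mu)).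
  { eapply filterlim_filter_le_1; [apply filter_le_within|].
    apply (continuous_fst (U := C_UniformSpace) (V := C_UniformSpace) mu nu). }
  assert (L2 : filterlim (fun p : C * C => snd p) (within lommel_generic (locally ((mu, nu) : C * C))) (locally nu)).
  { eapply filterlim_filter_le_1; [apply filter_le_within|].
    apply (continuous_snd (U := C_UniformSpace) (V := C_UniformSpace) mu nu). }
  assert (HRe : forall (h : C * C -> C) (a : C) (c : R),
     filterlim h (within lommel_generic (locally ((mu, nu) : C * C))) (locally a) -> 0 < Re a + c ->
     within lommel_generic (locally ((mu, nu) : C * C)) (fun p => 0 < Re (h p) + c)).
  { intros h a c Hh Hp. assert (HR := flim_Re _ _ Hh).
    generalize (proj1 (filterlim_locally _ _) HR (mkposreal _ Hp)). apply filter_imp. intros p Bp.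
    apply R_ball_Rabs, Rabs_def2 in Bp. simpl in Bp. lra. }
  apply (filterlim_ext_loc (fun p => expansion_sum N z (fst p) (snd p) + expansion_rem N z (fst p) (snd p))%C).
  - assert (HG : within lommel_generic (locally ((mu, nu) : C * C)) lommel_generic).
    { unfold within. apply filter_forall. auto. }
    generalize (filter_and _ _ HG (filter_and _ _ (HRe _ _ (INR N) (flim_lal _ _ mu nu L1 L2) Ha) (HRe _ _ (INR N) (flim_lbe _ _ mu nu L1 L2) Hb))).
    apply filter_imp. intros [m n] (Hgen & HA & HB). symmetry. now apply lommel_S_gen_expansion.
  - apply flim_Cplus.
    + now apply (flim_expansion_sum (fun p : C * C => fst p) (fun p => snd p)).
    + now apply (flim_expansion_rem (fun p : C * C => fst p) (fun p => snd p)).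
Qed.

Theorem theorem1 (mu nu z : C) (N : nat) :
  z <> RtoC 0 -> Rabs (Carg z) < PI / 2 ->
  Re mu + Rabs (Re nu) < 2 * INR N + 1 ->
  exists I : C,
    @is_RInt_gen C_R_NormedModule
      (fun t : R =>
         Cdiv (Cmult (cpow (RtoC t) (Cminus (RtoC (2 * INR N)) mu)) (BesselK nu (RtoC t)))
              (Cplus (RtoC 1) (Cpown (Cdiv (RtoC t) z) 2)))
      (at_right 0) (Rbar_locally p_infty) I /\
    lommel_R N z mu nu =
      Cmult
        (Cmult (RtoC ((-1) ^ N))
               (Cmult (cpow (RtoC 2) (Cplus mu (RtoC 1)))
                      (cpow z (Cminus (Cminus mu (RtoC (2 * INR N))) (RtoC 1)))))
        (Cmult (Cmult (rgamma (Cdiv (Cplus (Cminus nu mu) (RtoC 1)) (RtoC 2)))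
                      (rgamma (Cdiv (Cminus (Cminus (RtoC 1) mu) nu) (RtoC 2))))
               I).
Proof.
  intros Hz0 Harg Hreg. assert (Hz := Re_pos_of_Carg z Hz0 Harg). assert (Hw := wz_strip z Harg).
  assert (Hnu := Rle_abs (Re nu)). assert (Hnu' := Rle_abs (- Re nu)). rewrite Rabs_Ropp in Hnu'.
  (* The shift of [mu] by [- 2N] adds [N] to both [lal] and [lbe], and the hypothesis on [mu] and
     [nu] says that the shifted real parts are positive. *)
  set (mu' := (mu - RtoC (2 * INR N))%C).
  assert (Ha : 0 < Re (lal mu nu) + INR N) by (rewrite Re_lal; lra).
  assert (Hb : 0 < Re (lbe mu nu) + INR N) by (rewrite Re_lbe; lra).
  assert (Ha' : 0 < Re (lal mu' nu)) by (unfold mu'; rewrite lal_shift, Re_plus_RtoC; exact Ha).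
  assert (Hb' : 0 < Re (lbe mu' nu)) by (unfold mu'; rewrite lbe_shift, Re_plus_RtoC; exact Hb).
  exists (/ RtoC 2 * cexp (wz z) * cexp (- mu' * RtoC (ln 2)) * Xint (lal mu' nu) (lbe mu' nu) (wz z))%C.
  split.
  - replace (RtoC (2 * INR N) - mu)%C with (- mu')%C by (unfold mu'; ring).
    now apply is_RInt_gen_Xint.
  - unfold lommel_R. rewrite (lommel_S_expansion N z mu nu Hz Hw Ha Hb).
    fold (expansion_sum N z mu nu).
    replace (expansion_sum N z mu nu + expansion_rem N z mu nu - expansion_sum N z mu nu)%C
      with (expansion_rem N z mu nu) by ring.
    unfold expansion_rem, mu'. rewrite lal_shift, lbe_shift.
    set (X := Xint _ _ _).
    replace ((nu - mu + RtoC 1) / RtoC 2)%C with (lal mu nu) by (unfold lal; f_equal; ring).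
    change ((RtoC 1 - mu - nu) / RtoC 2)%C with (lbe mu nu).
    assert (Hzz : (z * z)%C <> RtoC 0) by now apply Cmult_neq_0.
    assert (H4 : RtoC 4 <> RtoC 0) by (apply RtoC_neq_0; lra).
    rewrite neg_pown_sign, Cpown_inv by apply cexp_neq_0. rewrite (cexp_wz z Hz).
    rewrite cpow_pos, cpow_neq_0 by (assumption || lra).
    assert (Ez : cexp ((mu - RtoC (2 * INR N) - RtoC 1) * clog z)%C =
       (cexp ((mu + RtoC 1) * clog z) / (Cpown (z * z) N * (z * z)))%C).
    { replace ((mu - RtoC (2 * INR N) - RtoC 1) * clog z)%C
        with ((mu + RtoC 1) * clog z + - (RtoC (INR N) * (clog z + clog z) + (clog z + clog z)))%C
        by (rewrite RtoC_mult; ring).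
      rewrite cexp_add, cexp_opp, (cexp_add (_ * _)%C (_ + _)%C), cexp_nat, !cexp_add, cexp_clog by exact Hz. reflexivity. }
    (* The [2^(2N - mu)] of the integral meets the prefactor [2^(mu + 1)]; the resulting [4^N]
       matches the denominator of [zeta^N = (z^2 / 4)^N]. *)
    assert (E2 : (cexp ((mu + RtoC 1) * RtoC (ln 2)) * cexp (- (mu - RtoC (2 * INR N)) * RtoC (ln 2)))%C
       = (RtoC 2 * Cpown (RtoC 4) N)%C).
    { rewrite <- cexp_add.
      replace ((mu + RtoC 1) * RtoC (ln 2) + - (mu - RtoC (2 * INR N)) * RtoC (ln 2))%C
        with (RtoC (ln 2) + RtoC (INR N) * (RtoC (ln 2) + RtoC (ln 2)))%C by (rewrite RtoC_mult; ring).
      rewrite cexp_add, cexp_nat, cexp_add, cexp_R, exp_ln, <- RtoC_mult by lra.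
      replace (2 * 2) with 4 by ring. reflexivity. }
    rewrite Ez. replace (z * z / RtoC 4)%C with (z * z * / RtoC 4)%C by reflexivity.
    rewrite Cpown_mult, Cpown_inv by exact H4.
    pose proof (Cpown_neq_0 _ N Hzz). pose proof (Cpown_neq_0 _ N H4).
    set (A := cexp ((mu + RtoC 1) * RtoC (ln 2))) in *. set (B := cexp (- (mu - RtoC (2 * INR N)) * RtoC (ln 2))) in *.
    set (Z := cexp ((mu + RtoC 1) * clog z)). set (s := RtoC ((-1) ^ N)).
    set (q := Cpown (z * z) N) in *. set (ff := Cpown (RtoC 4) N) in *.
    set (ga := rgamma (lal mu nu)). set (gb := rgamma (lbe mu nu)).
    transitivity (s * ((A * B) * (Z / (q * (z * z)))) * (ga * gb * (/ RtoC 2 * (z * z * / RtoC 4) * X)))%C; [|ring].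
    rewrite E2. field; nz.
Qed.
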